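(* Let $\Omega\subset\mathbb H^1$ be a bounded open set with Lipschitz boundary, and let $A$ be a vector potential of either one of the following types: (i) a smooth vector potential on $\mathbb H^1$ whose associated magnetic field $B=DA$ satisfies $B\not\equiv0$ on $\Omega$; (ii) an Aharonov--Bohm potential on $\mathbb H^1\setminus\mathcal Z$ with non-integer flux, i.e., up to gauge invariance (adding $d_{\mathrm H}f$ with $f\in C^\infty(\mathbb H^1\setminus\mathcal Z)$ real-valued), $A=\alpha\,d\varphi\mod\omega$ with $\alpha\in\mathbb R\setminus\mathbb Z$. Then there exists a positive constant $c(A,\Omega)$, depending on $A$ and $\Omega$, such that $$-\Delta_A-\frac{r^2}{\rho^4}\ \ge\ c(A,\Omega)\,\chi_\Omega\qquad\text{in } L^2(\mathbb H^1)$$ in the sense of quadratic forms, where $\chi_\Omega$ is the indicator function of $\Omega$. Moreover, if $A$ is of type (i), $c(A,\Omega)$ depends on $A$ only through the associated magnetic field $B$.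
   Context: The Heisenberg group $\mathbb H^1$ is $\mathbb R^3$ with coordinates $(x,y,z)$ and left-invariant vector fields $X=\partial_x-\frac y2\partial_z$, $Y=\partial_y+\frac x2\partial_z$, $Z=\partial_z$. The contact form is $\omega=dz-\frac12(x\,dy-y\,dx)$; $\{dx,dy,\omega\}$ is dual to $\{X,Y,Z\}$. Set $\mathcal Z=\{(0,0,z):z\in\mathbb R\}$, $r=\sqrt{x^2+y^2}$, $\rho=\left((x^2+y^2)^2+16z^2\right)^{1/4}$. $\varphi$ is the angular coordinate in $(x,y)=(r\cos\varphi,r\sin\varphi)$. $dq$ is Lebesgue measure. For open $U\subset\mathbb H^1$, vector potentials are horizontal $1$-forms, i.e. elements of $\Omega^1_{\mathrm H}(U)=\Omega^1(U)/\operatorname{span}\{\omega\}$ (smooth real $1$-forms modulo $\omega$), written $A=A_x\,dx+A_y\,dy\mod\omega$. The horizontal differential is $d_{\mathrm H}f=(Xf)dx+(Yf)dy\mod\omega$. The magnetic field of $A$ is $DA=d\tilde A$, where $\tilde A$ is the unique $1$-form with $\tilde A=A\mod\omega$ and $d\tilde A\in\operatorname{span}\{dx\wedge\omega,dy\wedge\omega\}$; explicitly $DA=b_1\,dx\wedge\omega+b_2\,dy\wedge\omega$ with $b_1=X(XA_y-YA_x)-ZA_x$, $b_2=Y(XA_y-YA_x)-ZA_y$. An Aharonov--Bohm potential is an $A\in\Omega^1_{\mathrm H}(U)$ with $DA=0$ that is not of the form $d_{\mathrm H}f$, $f\in C^\infty(U)$. $-\Delta_A$ is the self-adjoint operator associated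 with the closure of $$Q_A(u)=\int_{\mathbb H^1}\left(|(X+iA_x)u|^2+|(Y+iA_y)u|^2\right)dq,$$ defined initially for $u\in C_c^\infty(\mathbb H^1)$ in case (i) and $u\in C_c^\infty(\mathbb H^1\setminus\mathcal Z)$ in case (ii). The inequality in the sense of quadratic forms means $Q_A(u)-\int_{\mathbb H^1}\frac{r^2}{\rho^4}|u|^2\,dq\ge c(A,\Omega)\int_\Omega|u|^2\,dq$ for all such $u$. *)

(* Defs.v *)
From HB Require Import structures.
From mathcomp Require Import all_boot all_order all_algebra.
From mathcomp Require Import complex.
From mathcomp Require Import all_classical all_reals all_analysis.

Set Implicit Arguments.
Unset Strict Implicit.
Unset Printing Implicit Defensive.

Import Order.TTheory GRing.Theory Num.Theory.
Import numFieldNormedType.Exports.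
Import ComplexField.Normc.

Local Open Scope classical_set_scope.
Local Open Scope ring_scope.

(* The point (x, y, z) is encoded as ((x, y), z). The topology is the product
   one, i.e. the Euclidean one. *)
Notation heis R := (R * R * R)%type.

Section Heisenberg.
Variable R : realType.
Local Notation H := (heis R).
Implicit Types (U Omega : set H) (f g : H -> R) (p q : H).

Definition cx p : R := p.1.1.
Definition cy p : R := p.1.2.
Definition cz p : R := p.2.

Definition basis_vec (i : 'I_3) : H :=
  ((i == 0 :> nat)%:R, (i == 1 :> nat)%:R, (i == 2 :> nat)%:R).

Definition partial (i : 'I_3) f : H -> R := fun p => 'D_(basis_vec i) f p.

(* [f] is C^oo on the open set [U]: its partial derivatives of all orders exist
   and are continuous at every point of [U]. The values of [f] outside [U] are
   irrelevant. *)
Definition smooth_on U f : Prop :=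
  forall (s : seq 'I_3) p, U p ->
    {for p, continuous (foldr partial f s)} /\
    forall i, derivable (foldr partial f s) p (basis_vec i).

Definition vfX f : H -> R :=
  fun p => partial 0 f p - cy p / 2 * partial 2 f p.
Definition vfY f : H -> R :=
  fun p => partial 1 f p + cx p / 2 * partial 2 f p.
Definition vfZ f : H -> R := partial 2 f.

Definition zaxis : set H := [set p | cx p = 0 /\ cy p = 0].

Definition rr p : R := Num.sqrt (cx p ^+ 2 + cy p ^+ 2).
Definition rho p : R :=
  ((cx p ^+ 2 + cy p ^+ 2) ^+ 2 + 16 * cz p ^+ 2) `^ (4^-1).

(* The library proves this too, but its instance is shadowed by the one for
   products of subprobabilities, so that it is never inferred. *)
Lemma product_sigma_finite d1 d2 (T1 : measurableType d1)
    (T2 : measurableType d2) (m1 : {sigma_finite_measure set T1 -> \bar R})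
    (m2 : {sigma_finite_measure set T2 -> \bar R}) :
  sigma_finite setT (m1 \x m2)%E.
Proof.
have /sigma_finiteP[F [TF ndF Foo]] := sigma_finiteT m1.
have /sigma_finiteP[G [TG ndG Goo]] := sigma_finiteT m2.
exists (fun n => F n `*` G n).
  rewrite -setXTT TF TG predeqE => -[x y]; split.
    move=> [/= [n _ Fnx] [k _ Gky]]; exists (maxn n k) => //; split.
    - by move: x Fnx; exact/subsetPset/ndF/leq_maxl.
    - by move: y Gky; exact/subsetPset/ndG/leq_maxr.
  by move=> [n _ []/= ? ?]; split; exists n.
move=> k; have [? ?] := Foo k; have [? ?] := Goo k.
split; first exact: measurableX.
by rewrite product_measure1E// lte_mul_pinfty// ge0_fin_numE.
Qed.

Definition lebesgue2 := (@lebesgue_measure R \x @lebesgue_measure R)%E.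
HB.instance Definition _ := Measure.on lebesgue2.
HB.instance Definition _ := Measure_isSigmaFinite.Build _ _ _ lebesgue2
  (product_sigma_finite lebesgue_measure lebesgue_measure).

Definition lebesgue3 := (lebesgue2 \x @lebesgue_measure R)%E.
HB.instance Definition _ := Measure.on lebesgue3.
HB.instance Definition _ := Measure_isSigmaFinite.Build _ _ _ lebesgue3
  (product_sigma_finite lebesgue2 lebesgue_measure).

(* Since {dx, dy, omega} is a coframe, every class of 1-forms modulo omega has a
   unique representative A_x dx + A_y dy, and it is encoded by the pair
   (A_x, A_y). Potentials on an open set are total functions, constrained on
   that set only. *)
Definition potential : Type := H -> R * R.
Implicit Types A : potential.

Definition potx A : H -> R := fun p => (A p).1.
Definition poty A : H -> R := fun p => (A p).2.

Definition smooth_potential U A : Prop :=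
  smooth_on U (potx A) /\ smooth_on U (poty A).

Definition dH f : potential := fun p => (vfX f p, vfY f p).

(* The coefficients (b_1, b_2) of DA = b_1 dx /\ omega + b_2 dy /\ omega. As
   d omega = - dx /\ dy, the lift of A whose differential has no dx /\ dy
   component is A_x dx + A_y dy + (curlH A) omega. *)
Definition curlH A : H -> R := fun p => vfX (poty A) p - vfY (potx A) p.
Definition magnetic_field A : H -> R * R := fun p =>
  (vfX (curlH A) p - vfZ (potx A) p, vfY (curlH A) p - vfZ (poty A) p).

Definition aharonov_bohm U A : Prop :=
  [/\ smooth_potential U A,
      (forall p, U p -> magnetic_field A p = 0) &
      ~ exists2 f, smooth_on U f & forall p, U p -> A p = dH f p].

(* d phi = (x dy - y dx) / r^2 *)
Definition dphi : potential :=
  fun p => (- cy p / rr p ^+ 2, cx p / rr p ^+ 2).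

Definition typei Omega A : Prop :=
  smooth_potential setT A /\ exists2 p, Omega p & magnetic_field A p <> 0.

Definition typeii A : Prop :=
  aharonov_bohm (~` zaxis) A /\
  exists (alpha : R) f, [/\ alpha \isn't a Num.int, smooth_on (~` zaxis) f &
    forall p, (~` zaxis) p -> A p = alpha *: dphi p + dH f p].

Implicit Types u : H -> R[i].

Definition lift_complex (D : (H -> R) -> H -> R) u : H -> R[i] :=
  fun p => Complex (D (fun q => complex.Re (u q)) p)
                   (D (fun q => complex.Im (u q)) p).

Definition test_function U u : Prop :=
  [/\ smooth_on setT (fun p => complex.Re (u p)),
      smooth_on setT (fun p => complex.Im (u p)),
      compact (closure [set p | u p != 0]) &
      closure [set p | u p != 0] `<=` U].

Definition magnetic_form A u : \bar R :=
  (\int[lebesgue3]_p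
    (normc (lift_complex vfX u p + 'i%C * (potx A p)%:C%C * u p) ^+ 2 +
     normc (lift_complex vfY u p + 'i%C * (poty A p)%:C%C * u p) ^+ 2)%:E)%E.

(* - Delta_A - r^2 / rho^4 >= c chi_Omega as quadratic forms on C_c^oo(U).
   The weight evaluates to 0 at the origin, a Lebesgue-null set. In [\bar R],
   +oo - +oo = -oo, so the subtraction cannot make the inequality vacuous. *)
Definition hardy_ineq U Omega A (c : R) : Prop :=
  forall u, test_function U u ->
    (magnetic_form A u
       - \int[lebesgue3]_p (rr p ^+ 2 / rho p ^+ 4 * normc (u p) ^+ 2)%:E
     >= c%:E * \int[lebesgue3]_(p in Omega) (normc (u p) ^+ 2)%:E)%E.

Definition dot p q : R := cx p * cx q + cy p * cy q + cz p * cz q.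

(* Around each boundary point, in a suitable orthonormal frame [e], [Omega] is
   the strict epigraph of a Lipschitz function of two variables. *)
Definition lipschitz_boundary Omega : Prop :=
  forall p, (closure Omega `\` Omega^°) p ->
  exists e : 'I_3 -> H, exists gamma : R * R -> R,
    [/\ forall i j, dot (e i) (e j) = (i == j)%:R,
        exists k : R, k.-lipschitz gamma &
        \forall q \near p,
          Omega q <-> gamma (dot (e 0) q, dot (e 1) q) < dot (e 2) q].

End Heisenberg.

(* Main.v *)
(* Let Q be the quadratic form of A and V = grad_H N / (4 N), where N = r^4 + 16 z^2. Completing the square turns
   Q(u) - int r^2/rho^4 |u|^2 into the remainder int |(grad_H + iA + V) u|^2 = int N^(-1/2) |(grad_H + iA) w|^2
   with w = N^(1/4) u; everything is done with N + e, letting e tend to 0 at the end. Using V + W instead of V, with W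
   supported in the unit gauge ball, the remainder also bounds |u|^2 on that ball up to a multiple of int sqrt(N) |u|^2.
   It remains to bound int |w|^2 on bounded sets by int |(grad_H + iA) w|^2 on larger ones.

   Parallel transport along a horizontal segment controls the change of w, and of |w|. Hence a bound on |w|^2 spreads from
   a nonempty open set G to any bounded set along finitely many horizontal paths, and on G it follows from a closed
   horizontal loop whose holonomy exp(i theta) stays away from 1 when the loop is started from any point of G. If
   B <> 0, a small bow tie has by Stokes a holonomy given by the flux of B through a dilated loop. For an
   Aharonov-Bohm potential, a square around the axis, closed up by a square beside it, has theta = 2 pi alpha. *)
Require Import Defs.
From HB Require Import structures.
From mathcomp Require Import all_boot all_order all_algebra.
From mathcomp Require Import complex.
From mathcomp Require Import ring lra.
From mathcomp Require Import all_classical all_reals all_analysis.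
From mathcomp Require Import measurable_realfun.
Import Order.TTheory GRing.Theory Num.Theory.
Import numFieldNormedType.Exports.
Local Open Scope classical_set_scope.
Local Open Scope ring_scope.

Set Implicit Arguments.
Unset Strict Implicit.
Unset Printing Implicit Defensive.

(** * Invariance of Lebesgue measure *)

Section Measure.
Variable R : realType.
Local Notation H := (heis R).
Local Notation RM := (measurableTypeR R).
Local Notation MH := (RM * RM * RM)%type.
Local Notation mu3 := (@lebesgue3 R).

(** Since |w|^2 = sqrt(N + e) |u|^2, a Poincaré inequality for w degenerates at the origin as e
    tends to 0; the field W repairs this. The square is completed twice in the same Q(u), with V and
    with V + W. Comparing the two identities bounds the remainder for V below by int (div W - 2 V.W
    - |W|^2) |u|^2, whose factor is at least 1/4 - 5 sqrt(N + e) in the unit gauge ball and 0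
    outside. The negative part is -5 |w|^2, which Poincaré absorbs, with constants uniform for 0 < e
    <= 1. Dependence on B alone shapes the rest. Constants are chosen before the pair (|w|^2,
    |(grad_H + iA) w|^2) and even before A, so nothing rests on compactness of a sequence of
    functions; only the loop and a lower bound for its holonomy enter, and for type (i) both are
    built from B. A closed horizontal loop projects to a plane curve of zero net area. This forces
    figures such as bow ties and pairs of squares, and makes the holonomy of a loop dilated by t of
    order t^3 instead of the t^2 familiar in the plane. *)

Lemma measurable_ballR (x r : R) : measurable (ball x r).
Proof. by apply: open_measurable; exact: ball_open. Qed.

Lemma bigcup_countable_measurable d (T : measurableType d) (I : countType) (D : set I)
    (F : I -> set T) :
  (forall i, D i -> measurable (F i)) -> measurable (\bigcup_(i in D) F i).
Proof.
move=> mF.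
pose G (n : nat) := if unpickle n is Some i then (if `[< D i >] then F i else set0) else set0.
have -> : \bigcup_(i in D) F i = \bigcup_n G n.
  apply/seteqP; split => [x [i Di Fx]|x [n _]].
    by exists (pickle i) => //; rewrite /G pickleK asboolT.
  by rewrite /G; case: (unpickle n) => // i; case: asboolP => // Di Fx; exists i.
apply: bigcupT_measurable => n; rewrite /G; case: (unpickle n) => // i.
by case: asboolP => // Di; exact: mF.
Qed.

(** [MH] carries the product sigma-algebra whereas [open] refers to the product topology; the
    countable base of cubes with rational centres links the two. *)
Lemma open_measurable_heis (U : set H) : open U -> measurable (U : set MH).
Proof.
move=> oU.
pose B (i : (rat * rat * rat) * nat) : set H :=
  (ball (ratr i.1.1.1 : R) (i.2.+1%:R^-1)) `*` (ball (ratr i.1.1.2 : R) (i.2.+1%:R^-1))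
    `*` (ball (ratr i.1.2 : R) (i.2.+1%:R^-1)).
have -> : U = \bigcup_(i in [set i | B i `<=` U]) B i.
  apply/seteqP; split => [p Up|p [i /= iU Bi]]; last exact: iU.
  have /nbhs_ballP[e /= e0 eU] : nbhs p U by exact: open_nbhs_nbhs.
  have [n n0] : exists n : nat, n.+1%:R^-1 < e / 2 :> R.
    have e20 : 0 < e / 2 by rewrite divr_gt0.
    have [n _ /(_ n (leqnn _)) h] := near_infty_natSinv_lt (PosNum e20).
    by exists n.
  have rx (x : R) : exists q : rat, ball (ratr q : R) (n.+1%:R^-1) x.
    have /rat_in_itvoo[q] : x < x + n.+1%:R^-1 by rewrite ltrDl.
    rewrite in_itv /= => /andP[h1 h2]; exists q.
    have k0 : 0 < n.+1%:R^-1 :> R by [].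
    by rewrite -ball_normE /ball_ /= ltr_norml; apply/andP; move: k0 h1 h2; set k := _^-1;
      move=> *; split; lra.
  have [[q1 h1] [q2 h2] [q3 h3]] := And3 (rx p.1.1) (rx p.1.2) (rx p.2).
  exists (q1, q2, q3, n) => //= -[[x y] z] [[/= b1 b2] b3]; apply: eU.
  have tri (a b c : R) : ball a (n.+1%:R^-1) b -> ball a (n.+1%:R^-1) c -> ball b e c.
    move=> ab ac; apply: (@le_ball _ _ _ (n.+1%:R^-1 + n.+1%:R^-1)); first by move: n0; set k := _^-1; lra.
    by apply: ball_triangle ac; exact: ball_sym.
  by split; [split|]; [exact: tri h1 b1|exact: tri h2 b2|exact: tri h3 b3].
apply: bigcup_countable_measurable => i _; apply: measurableX; last exact: measurable_ballR.
by apply: measurableX; exact: measurable_ballR.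
Qed.

Lemma continuous_measurable_heis (f : H -> R) : continuous f -> measurable_fun (setT : set MH) f.
Proof.
move=> /continuousP cf; apply: (measurability _ (RGenOpens.measurableE R)).
move=> _ [_ [a [b ->] <-]]; rewrite setTI; apply: open_measurable_heis.
exact/cf/interval_open.
Qed.

(** Makes the push-forward available as a measure, so that the uniqueness of Lebesgue measure on
    intervals and on rectangles can be applied to it. *)
Lemma pushforward_ext d (T : measurableType d) (f : T -> T) (m : {measure set T -> \bar R})
  (mf : measurable_fun setT f) : exists nu : {measure set T -> \bar R},
  forall A, nu A = m (f @^-1` A).
Proof.
by exists (@measure_function_pushforward__canonical__measure_function_Measure _ _ _ _ R m f mf).
Qed.

Lemma ge0_integral_invariant d (T : measurableType d) (f : T -> T)
    (m : {measure set T -> \bar R}) (g : T -> \bar R) :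
  measurable_fun setT f -> (forall A, measurable A -> m (f @^-1` A) = m A) ->
  measurable_fun setT g -> (forall x, 0 <= g x)%E ->
  (\int[m]_x g (f x) = \int[m]_x g x)%E.
Proof.
move=> mf mE mg g0.
rewrite -(@ge0_integral_pushforward _ _ _ _ R f mf m setT g)//.
pose nu := @measure_function_pushforward__canonical__measure_function_Measure _ _ _ _ R m f mf.
apply: (@eq_measure_integral _ _ _ setT m nu).
by move=> A mA _; rewrite -mE.
Qed.

Lemma integral_invariant d (T : measurableType d) (f : T -> T)
    (m : {measure set T -> \bar R}) (g : T -> \bar R) :
  measurable_fun setT f -> (forall A, measurable A -> m (f @^-1` A) = m A) ->
  measurable_fun setT g -> (\int[m]_x g (f x) = \int[m]_x g x)%E.
Proof.
move=> mf mE mg; rewrite [LHS]integralE [RHS]integralE; congr (_ - _)%E.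
  have h := @ge0_integral_invariant _ T f m (g^\+)%E mf mE (measurable_funepos mg) (funepos_ge0 g).
  by under eq_integral do rewrite funepos_comp.

have h := @ge0_integral_invariant _ T f m (g^\-)%E mf mE (measurable_funeneg mg) (funeneg_ge0 g).
by under eq_integral do rewrite funeneg_comp.
Qed.

Lemma lebesgue_translation (c : R) (A : set R) : measurable A ->
  lebesgue_measure ((fun x => x + c) @^-1` A) = lebesgue_measure A.
Proof.
move=> mA.
have mt : measurable_fun setT (fun x : measurableTypeR R => x + c : measurableTypeR R).
  by apply: measurable_funD => //; exact: measurable_id.
have [nu nuE] := pushforward_ext lebesgue_measure mt.
rewrite [RHS](@lebesgue_measure_unique R nu) ?nuE //.
move=> X [[a b] _ <-] /=; rewrite nuE.
have -> : (fun x => x + c) @^-1` `]a, b] = `]a - c, b - c]%classic.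
  by apply/seteqP; split => x /=; rewrite !in_itv /= ltrBlDr lerBrDr.
have l1 := @lebesgue_measure_itv R `]a, b].
have l2 := @lebesgue_measure_itv R `]a - c, b - c].
transitivity (if a < b then (b - a)%:E else 0%:E : \bar R).
  by rewrite [LHS]l1 /= lte_fin EFinB.
rewrite [RHS]l2 /= lte_fin ltrD2r.
by case: ifP => // _; rewrite -!EFinB; congr EFin; ring.
Qed.

(** The group law. X and Y are left-invariant, so their flows are right multiplications; this is why
    the measure is studied under right translations. *)
Definition hmul (p q : H) : H :=
  (cx p + cx q, cy p + cy q, cz p + cz q + (cx p * cy q - cy p * cx q) / 2).

Lemma measurable_translation2 (a b : R) :
  measurable_fun setT (fun q : RM * RM => (q.1 + a, q.2 + b) : RM * RM).
Proof.
apply: measurable_fun_pair; apply: measurable_funD => //.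
Qed.

Lemma lebesgue2_translation (a b : R) (A : set (RM * RM)) : measurable A ->
  @lebesgue2 R ((fun q => (q.1 + a, q.2 + b)) @^-1` A) = @lebesgue2 R A.
Proof.
move=> mA.
have [nu nuE] := pushforward_ext (@lebesgue2 R) (measurable_translation2 a b).
rewrite [RHS](@product_measure_unique _ _ _ _ R lebesgue_measure lebesgue_measure nu) ?nuE//.
move=> B C mB mC; rewrite nuE.
have mT (c : R) (D : set R) : measurable D -> measurable ((fun x => x + c) @^-1` D).
  move=> mD; rewrite -[X in measurable X]setTI.
  have : measurable_fun setT (fun x : R => x + c) by apply: measurable_funD.
  exact.
have -> : (fun q => (q.1 + a, q.2 + b)) @^-1` (B `*` C) =
  ((fun x => x + a) @^-1` B) `*` ((fun x => x + b) @^-1` C) by [].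
have e1 := lebesgue_translation a mB; have e2 := lebesgue_translation b mC.
rewrite -[RHS](f_equal2 *%E e1 e2).
by apply: product_measure1E; exact: mT.
Qed.

Lemma cx_continuous : continuous (@cx R).
Proof. by move=> p; apply: (cvg_comp _ _ cvg_fst cvg_fst). Qed.

Lemma cy_continuous : continuous (@cy R).
Proof. by move=> p; apply: (cvg_comp _ _ cvg_fst cvg_snd). Qed.

Lemma cz_continuous : continuous (@cz R).
Proof. by move=> p; apply: cvg_snd. Qed.

Lemma hmul_measurable (q : H) : measurable_fun setT (hmul ^~ q : MH -> MH).
Proof.
have mx := continuous_measurable_heis cx_continuous.
have my := continuous_measurable_heis cy_continuous.
have mz := continuous_measurable_heis cz_continuous.
apply: measurable_fun_pair; first apply: measurable_fun_pair; repeat apply: measurable_funD => //.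
apply: measurable_funM => //; apply: measurable_funB; apply: measurable_funM => //.
Qed.

(** Right multiplication translates the plane, and on the vertical line over (x, y) it is a
    translation by an amount that depends on (x, y) only; slicing reduces the claim to dimensions
    one and two. *)
Lemma lebesgue3_translation (q : H) (A : set MH) : measurable A ->
  mu3 ((hmul ^~ q) @^-1` A) = mu3 A.
Proof.
move=> mA.
pose T := fun s : RM * RM => (s.1 + q.1.1, s.2 + q.1.2) : RM * RM.
transitivity (\int[@lebesgue2 R]_s lebesgue_measure (xsection A (T s)))%E.
  rewrite /lebesgue3 /product_measure1.
  apply: eq_integral => s _ /=.
  have mx : measurable (xsection A (T s)) by exact: measurable_xsection.
  rewrite -[RHS](lebesgue_translation (cz q + (s.1 * cy q - s.2 * cx q) / 2) mx).
  congr (lebesgue_measure _); apply/seteqP; split => z /=;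
    by rewrite /xsection /= !inE /hmul /= addrA.
rewrite (@ge0_integral_invariant _ _ T (@lebesgue2 R) (lebesgue_measure \o xsection A)) //.
- exact: measurable_translation2.
- by move=> B mB; exact: lebesgue2_translation.
- exact: measurable_fun_xsection.
Qed.

Lemma ge0_integral_hmul (q : H) (f : MH -> \bar R) : measurable_fun setT f ->
  (forall p, 0 <= f p)%E -> (\int[mu3]_p f (hmul p q) = \int[mu3]_p f p)%E.
Proof.
move=> mf f0.
apply: (@ge0_integral_invariant _ MH (hmul ^~ q) mu3 f) => //.
- exact: hmul_measurable.
- by move=> B mB; exact: lebesgue3_translation.
Qed.

Lemma integral_hmul (q : H) (f : MH -> \bar R) : measurable_fun setT f ->
  (\int[mu3]_p (f (hmul p q)) = \int[mu3]_p (f p))%E.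
Proof.
move=> mf.
apply: (@integral_invariant _ MH (hmul ^~ q) mu3 f) => //.
- exact: hmul_measurable.
- by move=> B mB; exact: lebesgue3_translation.
Qed.

End Measure.

(** * Continuity of real-valued expressions *)

Section ContinuityR.
Variable R : realType.
Section Continuity.
Variable T : topologicalType.
Implicit Types f g : T -> R.

Lemma ct_cst (k : R) : continuous (fun _ : T => k).
Proof. by move=> t; exact: cvg_cst. Qed.

Lemma ctD f g : continuous f -> continuous g -> continuous (fun t => f t + g t).
Proof. by move=> cf cg t; exact: (continuousD (cf t) (cg t)). Qed.

Lemma ctN f : continuous f -> continuous (fun t => - f t).
Proof. by move=> cf t; exact: (continuousN (cf t)). Qed.

Lemma ctM f g : continuous f -> continuous g -> continuous (fun t => f t * g t).
Proof. by move=> cf cg t; exact: (continuousM (cf t) (cg t)). Qed.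

Lemma ctX f n : continuous f -> continuous (fun t => f t ^+ n).
Proof.
move=> cf; elim: n => [|n IH]; first exact: ct_cst.
have -> : (fun t => f t ^+ n.+1) = (fun t => f t * f t ^+ n) by apply/funext => t; rewrite exprS.
exact: ctM.
Qed.

Lemma ctV f : (forall t, f t != 0) -> continuous f -> continuous (fun t => (f t)^-1).
Proof. by move=> f0 cf t; exact: (continuousV (f0 t) (cf t)). Qed.

Lemma ct_comp (h : R -> R) f : continuous h -> continuous f -> continuous (fun t => h (f t)).
Proof. by move=> ch cf t; exact: (continuous_comp (cf t) (ch (f t))). Qed.

Lemma ct_pair (U V : topologicalType) (f : T -> U) (g : T -> V) :
  continuous f -> continuous g -> continuous (fun t => (f t, g t)).
Proof. by move=> cf cg t; apply: cvg_pair; [exact: cf|exact: cg]. Qed.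

End Continuity.

Lemma ct_id : continuous (fun x : R => x).
Proof. by move=> ?; exact: cvg_id. Qed.

End ContinuityR.

Ltac cont_step := lazymatch goal with
  | |- continuous (fun _ => ?c) => exact: ct_cst
  | |- continuous (fun x => x) => exact: ct_id
  | |- continuous (fun t => (@?f t, @?g t)) => apply: ct_pair
  | |- continuous (fun t => @?f t + @?g t) => apply: ctD
  | |- continuous (fun t => @?f t * @?g t) => apply: ctM
  | |- continuous (fun t => - @?f t) => apply: ctN
  | |- continuous (fun t => (@?f t) ^+ ?n) => apply: ctX
  end.
Ltac cont := repeat (first [assumption | cont_step]).

(** * Horizontal lines *)

Section Line.
Variable R : realType.
Local Notation H := (heis R).
Local Notation RM := (measurableTypeR R).
Local Notation MH := (RM * RM * RM)%type.
Local Notation mu3 := (@lebesgue3 R).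
Local Notation lam := (@lebesgue_measure R).

Lemma is_derive_continuousR (f : R -> R) (x d : R) : is_derive x 1 f d -> {for x, continuous f}.
Proof. by move=> [dv _]; apply: differentiable_continuous; apply/derivable1_diffP. Qed.

Lemma FTC_derive (g g' : R -> R) (a b : R) : a < b ->
  (forall s : R, is_derive s 1 g (g' s)) -> continuous g' ->
  (\int[lam]_(s in `[a, b]) (g' s)%:E = (g b - g a)%:E)%E.
Proof.
move=> ab dg cg; rewrite (@continuous_FTC2 R g' g a b) ?EFinB //.
- exact: continuous_subspaceT.
- split.
  + by move=> x _; case: (dg x).
  + by apply: cvg_at_right_filter; exact: is_derive_continuousR (dg _).
  + by apply: cvg_at_left_filter; exact: is_derive_continuousR (dg _).
- by move=> x _; rewrite derive1E; case: (dg x).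
Qed.

Lemma integrable01 (h : R -> R) : continuous h -> lam.-integrable `[0%R, 1%R] (EFin \o h).
Proof.
by move=> ch; apply: continuous_compact_integrable; [exact: segment_compact|exact: continuous_subspaceT].
Qed.

Lemma lebesgue01 : lam `[0%R, 1%R]%classic = 1%E.
Proof.
by rewrite [LHS](@lebesgue_measure_itv R `[0%R, 1%R]) /= lte_fin ltr01 oppr0 adde0.
Qed.

Lemma integral01_cst (k : R) : (\int[lam]_(s in `[0%R, 1%R]) k%:E = k%:E)%E.
Proof.
rewrite integral_cst; last exact: measurable_itv.
transitivity (k%:E * 1)%E; last by rewrite mule1.
congr (_ * _)%E; exact: lebesgue01.
Qed.

(** Cauchy-Schwarz on [0, 1]: integrate 2 L g' <= L^2 + g'^2, where L is the increment, so that the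
    left side integrates to 2 L^2. *)
Lemma sq_increment_le (g g' : R -> R) :
  (forall s : R, is_derive s 1 g (g' s)) -> continuous g' ->
  (((g 1 - g 0) ^+ 2)%:E <= \int[lam]_(s in `[0%R, 1%R]) ((g' s) ^+ 2)%:E)%E.
Proof.
move=> dg cg; set L := g 1 - g 0.
have mi : measurable (`[0%R, 1%R]%classic : set R) by exact: measurable_itv.
have cg2 : continuous (fun s => g' s ^+ 2) by exact: ctX.
have cL : continuous (fun s => 2 * L * g' s) by cont.
have h : (\int[lam]_(s in `[0%R, 1%R]) (2 * L * g' s)%:E <=
   \int[lam]_(s in `[0%R, 1%R]) (L ^+ 2 + g' s ^+ 2)%:E)%E.
  apply: le_integral => //.
  - exact: (integrable01 cL).
  - by apply: (@integrable01 (fun s => L ^+ 2 + g' s ^+ 2)); cont.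
  - by move=> x _; rewrite lee_fin -subr_ge0; have := sqr_ge0 (L - g' x); lra.
have e1 : (\int[lam]_(s in `[0%R, 1%R]) (2 * L * g' s)%:E = (2 * L * L)%:E)%E.
  rewrite (@FTC_derive (fun s => 2 * L * g s) (fun s => 2 * L * g' s)) ?ltr01//.
    by rewrite /L; congr EFin; ring.
move: h; rewrite e1.
have -> : (\int[lam]_(s in `[0%R, 1%R]) (L ^+ 2 + g' s ^+ 2)%:E =
   (L ^+ 2)%:E + \int[lam]_(s in `[0%R, 1%R]) (g' s ^+ 2)%:E)%E.
  rewrite (@integralD_EFin _ _ _ lam _ mi (cst (L ^+ 2)) (fun s => g' s ^+ 2)).
  - congr (_ + _)%E; exact: integral01_cst.
  - by apply: (integrable01 (@ct_cst _ _ (L ^+ 2))).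
  - exact: (integrable01 cg2).
have [r ->] : exists r : R, (\int[lam]_(s in `[0%R, 1%R]) (g' s ^+ 2)%:E)%E = r%:E.
  exists (fine (\int[lam]_(s in `[0%R, 1%R]) (g' s ^+ 2)%:E)%E); rewrite fineK//.
  exact: integrable_fin_num (integrable01 cg2).
by rewrite -EFinD !lee_fin; lra.
Qed.

(** The curve s -> [hmul p (hor a b s)] is the integral curve of aX + bY through [p], a straight
    segment in coordinates. *)
Definition hor (a b s : R) : H := (s * a, s * b, 0).

Lemma hmul_hor (p : H) (a b s t : R) :
  hmul (hmul p (hor a b s)) (hor a b t) = hmul p (hor a b (s + t)).
Proof. by rewrite /hmul /hor /cx /cy /cz /=; congr (_, _, _); field. Qed.

Lemma hmul_hor0 (p : H) (a b : R) : hmul p (hor a b 0) = p.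
Proof.
by case: p => -[x y] z; rewrite /hmul /hor /cx /cy /cz /=; congr (_, _, _); field.
Qed.

(** The derivative is asked at s = 0 only, but at every [p]: the one-parameter group law [hmul_hor]
    carries it to all s. *)
Definition hder (a b : R) (f f' : H -> R) :=
  forall p, is_derive (0 : R) 1 (fun s => f (hmul p (hor a b s))) (f' p).

Lemma is_derive_line (f : H -> R) (p : H) (a b s d : R) :
  is_derive (0 : R) 1 (fun t : R => f (hmul (hmul p (hor a b s)) (hor a b t))) d ->
  is_derive s 1 (fun s => f (hmul p (hor a b s))) d.
Proof.
move=> h.
have -> : (fun s0 => f (hmul p (hor a b s0))) =
   (fun t => f (hmul (hmul p (hor a b s)) (hor a b t))) \o (fun t => t - s).
  by apply/funext => t /=; rewrite hmul_hor; congr (f (hmul _ (hor _ _ _))); ring.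
rewrite -[X in is_derive _ _ _ X]mulr1; apply: is_derive1_comp; first by rewrite subrr.
by apply: is_derive_eq; rewrite subr0.
Qed.

Lemma hder_line a b f f' p (s : R) : hder a b f f' ->
  is_derive s 1 (fun s => f (hmul p (hor a b s))) (f' (hmul p (hor a b s))).
Proof. by move=> h; apply: is_derive_line; exact: h. Qed.

Lemma hmul_hor_continuous (p : H) a b : continuous (fun s => hmul p (hor a b s)).
Proof.
rewrite /hmul /hor /cx /cy /cz /=.
by cont.
Qed.

Lemma hmul_hor_measurable a b :
  measurable_fun setT (fun q : MH * RM => hmul q.1 (hor a b q.2) : MH).
Proof.
have m1 : measurable_fun setT (fun q : MH * RM => q.1.1.1).
  by apply: measurableT_comp => //; apply: measurableT_comp.
have m2 : measurable_fun setT (fun q : MH * RM => q.1.1.2).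
  by apply: measurableT_comp => //; apply: measurableT_comp.
have m3 : measurable_fun setT (fun q : MH * RM => q.1.2) by apply: measurableT_comp.
have m4 : measurable_fun setT (fun q : MH * RM => q.2) by exact: measurable_snd.
have m4M (c : R) : measurable_fun setT (fun q : MH * RM => q.2 * c).
  by apply: measurable_funM => //; exact: measurable_cst.
apply: measurable_fun_pair; first by apply: measurable_fun_pair; apply: measurable_funD => //; exact: m4M.
rewrite /hmul /hor /cx /cy /cz /=.
apply: measurable_funD; first by apply: measurable_funD => //; exact: measurable_cst.
apply: measurable_funM; last exact: measurable_cst.
by apply: measurable_funB; apply: measurable_funM => //; exact: m4M.
Qed.

Definition box (M : R) : set MH := [set p | [/\ `|cx p| <= M, `|cy p| <= M & `|cz p| <= M]].

Lemma boxE M : box M = `[- M, M]%classic `*` `[- M, M]%classic `*` `[- M, M]%classic.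
Proof.
apply/seteqP; split => -[[x y] z]; rewrite /box /cx /cy /cz /= !in_itv /= !ler_norml.
  by move=> [-> -> ->].
by move=> [[-> ->] ->].
Qed.

Lemma measurable_box M : measurable (box M).
Proof. by rewrite boxE; apply: measurableX; [apply: measurableX|]; exact: measurable_itv. Qed.

Lemma lebesgue3_box M : (mu3 (box M) < +oo)%E.
Proof.
pose J : set RM := `[- M, M]%classic.
have l1 : (lam J < +oo)%E.
  by rewrite [ltLHS](@lebesgue_measure_itv R `[- M, M]); case: ifP => _ //=; rewrite -EFinD ltry.
have mi : measurable J by exact: measurable_itv.
have e2 : @lebesgue2 R (J `*` J) = (lam J * lam J)%E by exact: product_measure1E.
have e3 : mu3 (box M) = (@lebesgue2 R (J `*` J) * lam J)%E.
  by rewrite boxE; apply: product_measure1E => //; exact: measurableX.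
rewrite e3 e2.
have l2 : (lam J * lam J < +oo)%E by apply: lte_mul_pinfty; rewrite ?ge0_fin_numE.
by apply: lte_mul_pinfty => //; rewrite ?ge0_fin_numE// mule_ge0.
Qed.

Lemma compact_box M : compact (box M : set H).
Proof.
rewrite boxE; apply: compact_setX; last exact: segment_compact.
by apply: compact_setX; exact: segment_compact.
Qed.

Lemma continuous_bounded_box (f : H -> R) M : continuous f ->
  exists K, forall p, box M p -> `|f p| <= K.
Proof.
move=> cf.
have : compact [set f x | x in box M].
  by apply: continuous_compact; [exact: continuous_subspaceT|exact: compact_box].
move=> /compact_bounded[K [_ hK]]; exists (K + 1) => p bp.
by apply: (hK (K + 1)); [rewrite ltrDl|exists p].
Qed.

Definition ccont (f : H -> R) := continuous f /\ exists M, forall p, f p != 0 -> box M p.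

Lemma integrable_box (f : H -> R) M : continuous f -> mu3.-integrable (box M) (EFin \o f).
Proof.
move=> cf; apply: measurable_bounded_integrable.
- exact: measurable_box.
- exact: lebesgue3_box.
- by apply: measurable_funTS; exact: continuous_measurable_heis.
- have [K hK] := continuous_bounded_box M cf.
  exists K; split; first exact: num_real.
  by move=> x Kx p bp /=; apply: le_trans (hK _ bp) (ltW Kx).
Qed.

Lemma ccont_integrable (f : H -> R) : ccont f -> mu3.-integrable setT (EFin \o f).
Proof.
move=> [cf [M hM]].
have := integrable_box M cf.
move=> /(integrable_mkcond _ (measurable_box M)).
apply: eq_integrable => // p _ /=; rewrite patchE; case: ifPn => //.
by apply: contraNeq => fp; rewrite inE; apply: hM; apply: contra_neq fp => ->.
Qed.

Definition I3 (f : H -> R) : R := fine (\int[mu3]_p (f p)%:E)%E.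

Lemma I3E f : ccont f -> (\int[mu3]_p (f p)%:E)%E = (I3 f)%:E.
Proof.
by move=> cf; rewrite /I3 fineK//; apply: integrable_fin_num (ccont_integrable cf).
Qed.

(** Integration by parts through invariance alone: integrate F(p hor(1)) - F(p) = int_0^1 F'(p
    hor(s)) ds over p. The left side vanishes by right invariance, and by Fubini and invariance the
    right side is the integral of F'. *)
Lemma hder_integral0 a b (F F' : H -> R) : ccont F -> ccont F' -> hder a b F F' ->
  (\int[mu3]_p (F' p)%:E = 0)%E.
Proof.
move=> cF cF' dF.
have cF'c := cF'.1.
pose G (q : MH * RM) : \bar R := (F' (hmul q.1 (hor a b q.2)) * \1_(`[0%R, 1%R]%classic : set RM) q.2)%:E.
have mF' := continuous_measurable_heis cF'.1.
have mF := continuous_measurable_heis cF.1.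
have mG : measurable_fun setT G.
  apply/measurable_EFinP; apply: measurable_funM.
    exact: (measurableT_comp mF' (hmul_hor_measurable a b)).
  apply: measurableT_comp; last exact: measurable_snd.
  by apply: measurable_indic; exact: measurable_itv.
have trans (f : H -> R) s : continuous f ->
    (\int[mu3]_p (f (hmul p (hor a b s)))%:E = \int[mu3]_p (f p)%:E)%E.
  move=> cf; apply: (@integral_hmul _ (hor a b s) (EFin \o f)).
  by apply/measurable_EFinP; exact: continuous_measurable_heis.
have inner p : (\int[lam]_s G (p, s) = (F (hmul p (hor a b 1)) - F p)%:E)%E.
  have cl : continuous (fun s => F' (hmul p (hor a b s))).
    by move=> s; apply: continuous_comp; [exact: hmul_hor_continuous|exact: cF'c].
  have := FTC_derive ltr01 (fun s => hder_line p s dF) cl.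
  rewrite hmul_hor0 => <-.
  rewrite [RHS]integral_mkcond; apply: eq_integral => s _.
  by rewrite /G /= patchE indicE; case: ifP => _; rewrite ?mulr1 ?mulr0.
have outer s : (\int[mu3]_p G (p, s) = (\1_(`[0%R, 1%R]%classic : set RM) s)%:E * \int[mu3]_p (F' p)%:E)%E.
  rewrite -(trans F' s cF'c) /G /= indicE; case: (s \in _) => /=.
    by rewrite mul1e; apply: eq_integral => p _; rewrite mulr1.
  by rewrite mul0e; apply: integral0_eq => p _; rewrite mulr0.
have iG : (mu3 \x lam)%E.-integrable setT G.
  apply/(integrable21ltyP mu3 lam mG).
  have nF : continuous (fun p => `|F' p|).
    by move=> p; apply: continuous_comp; [exact: cF'c|exact: norm_continuous].
  have e s : (\int[mu3]_p `|G (p, s)| = (\1_(`[0%R, 1%R]%classic : set RM) s)%:E * \int[mu3]_p (`|F' p|)%:E)%E.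
    rewrite -(trans _ s nF) /G /= indicE; case: (s \in _) => /=.
      by rewrite mul1e; apply: eq_integral => p _; rewrite mulr1.
    by rewrite mul0e; apply: integral0_eq => p _; rewrite mulr0 normr0.
  under eq_integral do rewrite e.
  have cn : ccont (fun p => `|F' p|).
    split => //; have [_ [M hM]] := cF'; exists M => p; rewrite normr_eq0; exact: hM.
  rewrite (I3E cn).
  have -> : (\int[lam]_x ((\1_(`[0%R, 1%R]%classic : set RM) x)%:E * (I3 (fun p => `|F' p|))%:E) =
     \int[lam]_(x in `[0%R, 1%R]) (I3 (fun p => `|F' p|))%:E)%E.
    rewrite [RHS]integral_mkcond; apply: eq_integral => s _.
    by rewrite patchE indicE; case: ifP => _; rewrite ?mul1e ?mul0e.
  by rewrite integral01_cst ltry.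
have := Fubini iG.
under eq_integral do rewrite inner.
under [in RHS]eq_integral do rewrite outer.
have iF := ccont_integrable cF.
have iF1 : mu3.-integrable setT (EFin \o (fun p => F (hmul p (hor a b 1)))).
  apply/integrableP; split.
    apply/measurable_EFinP; exact: (measurableT_comp mF (hmul_measurable (hor a b 1))).
  have nF : continuous (fun p => `|F p|).
    by move=> p; apply: continuous_comp; [exact: cF.1|exact: norm_continuous].
  have /integrableP[_] := iF.
  by rewrite -[X in (X < _)%E -> _](trans _ 1 nF).
rewrite (integralB_EFin _ iF1 iF)//.
rewrite (trans _ _ cF.1) (I3E cF) -EFinB subrr (I3E cF').
have -> : (\int[lam]_x ((\1_(`[0%R, 1%R]%classic : set RM) x)%:E * (I3 F')%:E) =
     \int[lam]_(x in `[0%R, 1%R]) (I3 F')%:E)%E.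
  rewrite [RHS]integral_mkcond; apply: eq_integral => s _.
  by rewrite patchE indicE; case: ifP => _; rewrite ?mul1e ?mul0e.
by rewrite integral01_cst => <-.
Qed.

End Line.

(** * Differentiability *)

Section Chain.
Variable R : realType.
Local Notation H := (heis R).

Definition C1_at (f : H -> R) (p : H) :=
  (\forall q \near p, forall i, derivable f q (basis_vec R i)) /\
  forall i, {for p, continuous (partial i f)}.

Lemma is_derive_along (f : H -> R) (q v : H) (s : R) : derivable f (s *: v + q) v ->
  is_derive s 1 (fun s => f (s *: v + q)) ('D_v f (s *: v + q)).
Proof.
move=> d.
have e : (fun h : R => h^-1 *: (((fun s => f (s *: v + q)) \o shift s) (h *: 1) - f (s *: v + q))) =
  (fun h : R => h^-1 *: ((f \o shift (s *: v + q)) (h *: v) - f (s *: v + q))).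
  apply/funext => h /=; congr (_ *: (f _ - _)).
  by rewrite /shift/= [h *: 1]mulr1 scalerDl addrA.
by split; rewrite /derivable /derive e.
Qed.

Lemma MVT_line (f : H -> R) (q v : H) (s : R) (P : H -> Prop) :
  (forall t : R, `|t| <= `|s| -> P (t *: v + q)) ->
  (forall q', P q' -> derivable f q' v) ->
  exists2 t : R, `|t| <= `|s| & f (s *: v + q) - f q = s * 'D_v f (t *: v + q).
Proof.
move=> Pt dP.
pose g s := f (s *: v + q).
have dg (t : R) : `|t| <= `|s| -> is_derive t 1 g ('D_v f (t *: v + q)).
  by move=> ts; apply: is_derive_along; exact/dP/Pt.
have cg (t : R) : `|t| <= `|s| -> {for t, continuous g} by move=> /dg; exact: is_derive_continuousR.
have g0 : g 0 = f q by rewrite /g scale0r add0r.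
have cgin (a b : R) : (forall t : R, t \in `[a, b] -> `|t| <= `|s|) -> {within `[a, b], continuous g}.
  move=> h; apply: derivable_within_continuous => t /h /dg; by case.
have [s0|s0|->] := ltgtP s 0.
- have h (t : R) : t \in `[s, 0] -> `|t| <= `|s|.
    by rewrite in_itv /= => /andP[h1 h2]; rewrite !ler0_norm ?(ltW s0)// lerN2.
  have [t tI e] := MVT s0 (fun t ti => dg t (h t (subset_itv_oo_cc ti))) (cgin _ _ h).
  exists t; first exact/h/subset_itv_oo_cc.
  by move: e; rewrite g0 -/(g s); set D := 'D_v _ _ => e; apply: oppr_inj; rewrite opprB e; ring.
- have h (t : R) : t \in `[0, s] -> `|t| <= `|s|.
    by rewrite in_itv /= => /andP[h1 h2]; rewrite !ger0_norm ?(ltW s0).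
  have [t tI e] := MVT s0 (fun t ti => dg t (h t (subset_itv_oo_cc ti))) (cgin _ _ h).
  exists t; first exact/h/subset_itv_oo_cc.
  by move: e; rewrite g0 -/(g s) subr0 mulrC.
- by exists 0 => //; rewrite scale0r add0r mul0r subrr.
Qed.

(** Continuous partial derivatives give a total differential: the increment is telescoped along the
    three axes, and on each leg the mean value theorem meets a partial derivative close to its value
    at [p]. *)
Lemma C1_increment (f : H -> R) (p : H) (e : R) : C1_at f p -> 0 < e ->
  exists2 d : R, 0 < d & forall x y z : R, `|x| < d -> `|y| < d -> `|z| < d ->
   `|f (p + (x, y, z)) - f p - (x * partial 0 f p + y * partial 1 f p + z * partial 2 f p)|
     <= e * (`|x| + `|y| + `|z|).
Proof.
move=> [/nbhs_ballP[d0 /= d0p hd0] cp] e0.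
have cpi i : exists2 d, 0 < d & forall q, ball p d q -> `|partial i f p - partial i f q| <= e.
  have /cvgrPdist_le /(_ e e0) := cp i.
  by move=> /nbhs_ballP[d /= dp hd]; exists d.
have [da da0 hda] := cpi 0; have [db db0 hdb] := cpi 1; have [dc dc0 hdc] := cpi 2.
pose d := Num.min (Num.min d0 da) (Num.min db dc).
have dp : 0 < d by rewrite !lt_min d0p da0 db0 dc0.
exists d => // x y z xd yd zd.
have inb (x' y' z' : R) : `|x'| < d -> `|y'| < d -> `|z'| < d -> ball p d (p + (x', y', z')).
  move=> h1 h2 h3; split; [split|]; rewrite -ball_normE /ball_ /= opprD addrA subrr add0r normrN //.
pose v i := basis_vec R i.
have e0v (t : R) : t *: v 0 = (t, 0, 0) :> H.
  by rewrite /v /basis_vec /=; congr (_, _, _); rewrite /GRing.scale/= ?mulr1 ?mulr0.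
have e1v (t : R) : t *: v 1 = (0, t, 0) :> H.
  by rewrite /v /basis_vec /=; congr (_, _, _); rewrite /GRing.scale/= ?mulr1 ?mulr0.
have e2v (t : R) : t *: v 2 = (0, 0, t) :> H.
  by rewrite /v /basis_vec /=; congr (_, _, _); rewrite /GRing.scale/= ?mulr1 ?mulr0.
have z0d : `|0 : R| < d by rewrite normr0.
have der i q' : ball p d q' -> derivable f q' (v i).
  move=> bq; apply: hd0; apply: le_ball bq; by rewrite /d !ge_min lexx.
have addE (a b c a' b' c' : R) : ((a, b, c) : H) + (a', b', c') = (a + a', b + b', c + c') by [].
have [t1 t1s E1] : exists2 t : R, `|t| <= `|x| & f (x *: v 0 + (p + (0, y, z))) - f (p + (0, y, z)) =
   x * 'D_(v 0) f (t *: v 0 + (p + (0, y, z))).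
  apply: (@MVT_line f (p + (0, y, z)) (v 0) x (ball p d)) => [t tx|]; last exact: der.
  by rewrite addrCA e0v addE !(addr0, add0r); apply: inb => //; exact: le_lt_trans xd.
have [t2 t2s E2] : exists2 t : R, `|t| <= `|y| & f (y *: v 1 + (p + (0, 0, z))) - f (p + (0, 0, z)) =
   y * 'D_(v 1) f (t *: v 1 + (p + (0, 0, z))).
  apply: (@MVT_line f (p + (0, 0, z)) (v 1) y (ball p d)) => [t tx|]; last exact: der.
  by rewrite addrCA e1v addE !(addr0, add0r); apply: inb => //; exact: le_lt_trans yd.
have [t3 t3s E3] : exists2 t : R, `|t| <= `|z| & f (z *: v 2 + p) - f p =
   z * 'D_(v 2) f (t *: v 2 + p).
  apply: (@MVT_line f p (v 2) z (ball p d)) => [t tx|]; last exact: der.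
  by rewrite addrC e2v; apply: inb => //; exact: le_lt_trans zd.
have B1 : `|partial 0 f p - 'D_(v 0) f (t1 *: v 0 + (p + (0, y, z)))| <= e.
  apply: hda; rewrite addrCA e0v addE !(addr0, add0r).
  apply: (@le_ball _ _ _ d); first by rewrite /d !ge_min lexx ?orbT.
  by apply: inb => //; exact: le_lt_trans xd.
have B2 : `|partial 1 f p - 'D_(v 1) f (t2 *: v 1 + (p + (0, 0, z)))| <= e.
  apply: hdb; rewrite addrCA e1v addE !(addr0, add0r).
  apply: (@le_ball _ _ _ d); first by rewrite /d !ge_min lexx ?orbT.
  by apply: inb => //; exact: le_lt_trans yd.
have B3 : `|partial 2 f p - 'D_(v 2) f (t3 *: v 2 + p)| <= e.
  apply: hdc; rewrite addrC e2v.
  apply: (@le_ball _ _ _ d); first by rewrite /d !ge_min lexx ?orbT.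
  by apply: inb => //; exact: le_lt_trans zd.
move: E1 E2 E3 B1 B2 B3.
rewrite addrCA e0v addE !(addr0, add0r) => E1.
rewrite addrCA e1v addE !(addr0, add0r) => E2.
rewrite [z *: _ + _]addrC e2v => E3.
set D1 := 'D_(v 0) f _ in E1 *; set D2 := 'D_(v 1) f _ in E2 *; set D3 := 'D_(v 2) f _ in E3 *.
move=> B1 B2 B3.
have -> : f (p + (x, y, z)) - f p - (x * partial 0 f p + y * partial 1 f p + z * partial 2 f p) =
  - (x * (partial 0 f p - D1) + y * (partial 1 f p - D2) + z * (partial 2 f p - D3)).
  have -> : f (p + (x, y, z)) - f p = x * D1 + y * D2 + z * D3 by rewrite -E1 -E2 -E3; ring.
  by move: (partial 0 f p) (partial 1 f p) (partial 2 f p) D1 D2 D3 {E1 E2 E3 B1 B2 B3} => *; ring.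
rewrite normrN; apply: le_trans (ler_normD _ _) _; rewrite (mulrDr e); apply: lerD.
  apply: le_trans (ler_normD _ _) _; rewrite (mulrDr e); apply: lerD;
  by rewrite normrM mulrC ler_wpM2r.
by rewrite normrM mulrC ler_wpM2r.
Qed.

(** Carathéodory's form of the derivative writes the increments of the curve as [k1 z * (z - t)] and
    so on. The difference quotient of the composite then differs from the continuous [L z] by the
    error in [C1_increment], which is proportional to [K z]. *)
Lemma chain_rule (f : H -> R) (t : R) (c1 c2 c3 : R -> R) (d1 d2 d3 : R) (p : H) :
  p = (c1 t, c2 t, c3 t) -> C1_at f p ->
  is_derive t 1 c1 d1 -> is_derive t 1 c2 d2 -> is_derive t 1 c3 d3 ->
  is_derive t 1 (fun s => f (c1 s, c2 s, c3 s))
   (d1 * partial 0 f p + d2 * partial 1 f p + d3 * partial 2 f p).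
Proof.
move=> pE Cf /is_derive1_caratheodory[k1 [E1 K1 D1]] /is_derive1_caratheodory[k2 [E2 K2 D2]]
  /is_derive1_caratheodory[k3 [E3 K3 D3]].
pose D := d1 * partial 0 f p + d2 * partial 1 f p + d3 * partial 2 f p.
pose g z := if z == t then D else (f (c1 z, c2 z, c3 z) - f (c1 t, c2 t, c3 t)) / (z - t).
apply/is_derive1_caratheodory; exists g; split; last by rewrite /g eqxx.
- move=> z; rewrite /g; case: eqVneq => [->|zt]; first by rewrite !subrr mulr0.
  by rewrite divfK// subr_eq0.
pose L z := k1 z * partial 0 f p + k2 z * partial 1 f p + k3 z * partial 2 f p.
have cL : {for t, continuous L}.
  by apply: continuousD; [apply: continuousD|]; (apply: continuousM; [by []|exact: cvg_cst]).
pose K z := `|k1 z| + `|k2 z| + `|k3 z|.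
have cK : {for t, continuous K}.
  have cn (k : R -> R) : {for t, continuous k} -> {for t, continuous (fun z => `|k z|)}.
    by move=> ck; apply: continuous_comp => //; exact: norm_continuous.
  by apply: continuousD; [apply: continuousD|]; exact: cn.
have cc (c k : R -> R) : (forall z, c z - c t = k z * (z - t)) -> {for t, continuous k} -> {for t, continuous c}.
  move=> ec ck.
  have -> : c = (fun z => c t + k z * (z - t)) by apply/funext => z; rewrite -ec; ring.
  apply: continuousD; first exact: cvg_cst.
  by apply: continuousM => //; apply: continuousB; [exact: cvg_id|exact: cvg_cst].
apply/cvgrPdist_le => e e0.
have gt : g t = L t by rewrite /g eqxx /L D1 D2 D3.
rewrite gt.
(* Near t one has [K z <= K t + 1], so the error [e' * K z] is at most e / 2; the other half of [e]
   pays for [L t - L z]. *)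
pose e' := e / 2 / (K t + 1 + 1).
have Kt0 : 0 <= K t by rewrite /K !addr_ge0.
have e'0 : 0 < e' by rewrite !divr_gt0 //; lra.
have [d d0 hd] := C1_increment Cf e'0.
have /cvgrPdist_lt /(_ _ d0) n1 := cc _ _ E1 K1.
have /cvgrPdist_lt /(_ _ d0) n2 := cc _ _ E2 K2.
have /cvgrPdist_lt /(_ _ d0) n3 := cc _ _ E3 K3.
have e20 : 0 < e / 2 by rewrite divr_gt0.
move/cvgrPdist_le : cL => /(_ _ e20) nL.
move/cvgrPdist_le : cK => /(_ 1 ltr01) nK.
near=> z.
have L1 : `|L t - L z| <= e / 2 by near: z.
have N1 : `|c1 z - c1 t| < d by rewrite distrC; near: z.
have N2 : `|c2 z - c2 t| < d by rewrite distrC; near: z.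
have N3 : `|c3 z - c3 t| < d by rewrite distrC; near: z.
have NK : `|K t - K z| <= 1 by near: z.
suff : `|L z - g z| <= e / 2.
  move=> h; have -> : L t - g z = (L t - L z) + (L z - g z) by ring.
  apply: le_trans (ler_normD _ _) _; lra.
rewrite /g; case: eqVneq => [->|zt].
  by rewrite /L D1 D2 D3 subrr normr0 ltW.
have zt0 : 0 < `|z - t| by rewrite normr_gt0 subr_eq0.
have := hd _ _ _ N1 N2 N3.
rewrite {1}pE.
have -> : ((c1 t, c2 t, c3 t) : H) + (c1 z - c1 t, c2 z - c2 t, c3 z - c3 t) = (c1 z, c2 z, c3 z).
  by congr (_, _, _); rewrite /= addrC subrK.
rewrite E1 E2 E3 -pE.
set F1 := f (c1 z, c2 z, c3 z).
have -> : F1 - f p - (k1 z * (z - t) * partial 0 f p + k2 z * (z - t) * partial 1 f p +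
  k3 z * (z - t) * partial 2 f p) = - (z - t) * (L z - (F1 - f p) / (z - t)).
  have zt' : z - t != 0 by rewrite subr_eq0.
  rewrite /L; move: (partial 0 f p) (partial 1 f p) (partial 2 f p) (k1 z) (k2 z) (k3 z) (F1 - f p) zt'.
  by move: (z - t) => w P0 P1 P2 a1 a2 a3 G w0; field.
rewrite normrM normrN !normrM -!mulrDl -/(K z) mulrA [X in _ <= X]mulrC ler_pM2l// => h.
apply: le_trans h _.
have KK : K z <= K t + 1 by move: NK; rewrite ler_norml => /andP[]; lra.
apply: (@le_trans _ _ (e' * (K t + 1 + 1))); first by rewrite ler_pM2l//; lra.
by rewrite /e' divfK// gt_eqF//; lra.
Unshelve. all: by end_near. Qed.

Lemma smooth_C1_at U f p : open U -> smooth_on U f -> U p -> C1_at f p.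
Proof.
move=> oU sf Up; split.
  near=> q; have Uq : U q by near: q; exact: open_nbhs_nbhs.
  by have [_] := sf [::] q Uq.
by move=> i; have [] := sf [:: i] p Up.
Unshelve. all: by end_near. Qed.

Definition gC1 (f : H -> R) := [/\ continuous f, forall p i, derivable f p (basis_vec R i) &
  forall i, continuous (partial i f)].

Lemma gC1_at (f : H -> R) p : gC1 f -> C1_at f p.
Proof. by move=> [_ d c]; split; [by apply: filterE => q i; exact: d|move=> i; exact: c]. Qed.

Lemma smooth_gC1 (f : H -> R) : smooth_on setT f -> gC1 f.
Proof.
move=> sf; split.
- by move=> p; case: (sf [::] p I).
- by move=> p; case: (sf [::] p I).
- by move=> i p; case: (sf [:: i] p I).
Qed.

End Chain.

(** * Horizontal derivatives and the ground state identity *)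

Section HC1.
Variable R : realType.
Local Notation H := (heis R).
Implicit Types f g : H -> R.

(** Horizontally C^1. The derivatives are carried as data, so those of products, quotients and roots
    are computed symbolically, and they are linear in the direction (a, b). *)
Definition hC1 f fX fY := [/\ continuous f, continuous fX, continuous fY &
  forall a b, hder a b f (fun p => a * fX p + b * fY p)].

Lemma hder_eq a b f f' g' : (forall p, f' p = g' p) -> hder a b f f' -> hder a b f g'.
Proof. by move=> e h p; rewrite -e; exact: h. Qed.

Lemma hC1_eq f fX fY gX gY : hC1 f fX fY -> (forall p, fX p = gX p) -> (forall p, fY p = gY p) ->
  hC1 f gX gY.
Proof. by move=> h /funext <- /funext <-. Qed.

Lemma hC1_ext f fX fY g gX gY : hC1 f fX fY -> (forall p, f p = g p) ->
  (forall p, fX p = gX p) -> (forall p, fY p = gY p) -> hC1 g gX gY.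
Proof. by move=> h /funext <- /funext <- /funext <-. Qed.

Lemma hC1_X f fX fY : hC1 f fX fY -> hder 1 0 f fX.
Proof. by case=> _ _ _ /(_ 1 0); apply: hder_eq => p; rewrite mul1r mul0r addr0. Qed.

Lemma hC1_Y f fX fY : hC1 f fX fY -> hder 0 1 f fY.
Proof. by case=> _ _ _ /(_ 0 1); apply: hder_eq => p; rewrite mul1r mul0r add0r. Qed.

Lemma hC1_cst (k : R) : hC1 (fun _ => k) (fun _ => 0) (fun _ => 0).
Proof.
split; try exact: ct_cst.
by move=> a b p; rewrite !mulr0 addr0; exact: is_derive_cst.
Qed.

Lemma hC1D f fX fY g gX gY : hC1 f fX fY -> hC1 g gX gY ->
  hC1 (fun p => f p + g p) (fun p => fX p + gX p) (fun p => fY p + gY p).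
Proof.
move=> [cf cfX cfY df] [cg cgX cgY dg]; split; try exact: ctD.
move=> a b p; have d1 := df a b p; have d2 := dg a b p.
by apply: is_derive_eq; ring.
Qed.

Lemma hC1M f fX fY g gX gY : hC1 f fX fY -> hC1 g gX gY ->
  hC1 (fun p => f p * g p) (fun p => fX p * g p + f p * gX p) (fun p => fY p * g p + f p * gY p).
Proof.
move=> [cf cfX cfY df] [cg cgX cgY dg].
split; [exact: ctM|by cont|by cont|].
move=> a b p; have d1 := df a b p; have d2 := dg a b p.
by apply: is_derive_eq; rewrite !hmul_hor0 /GRing.scale /=; ring.
Qed.

Lemma hC1_comp (h h' : R -> R) f fX fY : hC1 f fX fY ->
  (forall p, is_derive (f p) 1 h (h' (f p))) -> continuous (fun p => h' (f p)) ->
  hC1 (fun p => h (f p)) (fun p => h' (f p) * fX p) (fun p => h' (f p) * fY p).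
Proof.
move=> [cf cfX cfY df] dh ch; split; try exact: ctM.
  by move=> p; apply: (continuous_comp (cf p)); exact: is_derive_continuousR (dh p).
move=> a b p.
have -> : a * (h' (f p) * fX p) + b * (h' (f p) * fY p) = h' (f p) * (a * fX p + b * fY p) by ring.
apply: (@is_derive1_comp _ h (fun s => f (hmul p (hor a b s)))); last exact: df.
by rewrite hmul_hor0; exact: dh.
Qed.

Lemma hC1_cx : hC1 (@cx R) (fun _ => 1) (fun _ => 0).
Proof.
split; [exact: cx_continuous|exact: ct_cst|exact: ct_cst|].
move=> a b p; rewrite /hmul /hor /cx /=.
by apply: is_derive_eq; rewrite /GRing.scale /=; ring.
Qed.

Lemma hC1_cy : hC1 (@cy R) (fun _ => 0) (fun _ => 1).
Proof.
split; [exact: cy_continuous|exact: ct_cst|exact: ct_cst|].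
move=> a b p; rewrite /hmul /hor /cy /=.
by apply: is_derive_eq; rewrite /GRing.scale /=; ring.
Qed.

Lemma hC1_cz : hC1 (@cz R) (fun p => - cy p / 2) (fun p => cx p / 2).
Proof.
have cy_c := @cy_continuous R; have cx_c := @cx_continuous R.
split; [exact: cz_continuous|apply: ctM; [exact: ctN|exact: ct_cst]
  |apply: ctM; [by []|exact: ct_cst]|].
move=> a b p; rewrite /hmul /hor /cz /cx /cy /=.
by apply: is_derive_eq; rewrite /GRing.scale /=; ring.
Qed.

Lemma hC1_sqrt f fX fY : hC1 f fX fY -> (forall p, 0 < f p) ->
  hC1 (fun p => Num.sqrt (f p)) (fun p => fX p / (2 * Num.sqrt (f p)))
     (fun p => fY p / (2 * Num.sqrt (f p))).
Proof.
move=> hf f0.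
have cs : continuous (fun p => (2 * Num.sqrt (f p))^-1).
  apply: ctV; first by move=> p; rewrite gt_eqF// mulr_gt0// sqrtr_gt0.
  apply: ctM; first exact: ct_cst.
  by apply: ct_comp; [exact: sqrt_continuous|case: hf].
apply: (@hC1_eq _ _ _ _ _ (@hC1_comp Num.sqrt (fun t => (2 * Num.sqrt t)^-1) f fX fY hf _ cs)).
- by move=> p; exact: is_derive1_sqrt.
- by move=> p; rewrite mulrC.
- by move=> p; rewrite mulrC.
Qed.

Lemma hC1_inv f fX fY : hC1 f fX fY -> (forall p, f p != 0) ->
  hC1 (fun p => (f p)^-1) (fun p => - fX p / f p ^+ 2) (fun p => - fY p / f p ^+ 2).
Proof.
move=> hf f0.
have ci : continuous (fun p => - (f p ^+ 2)^-1).
  apply: ctN; apply: ctV; first by move=> p; rewrite expf_neq0.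
  by apply: ctX; case: hf.
apply: (@hC1_eq _ _ _ _ _ (@hC1_comp (fun t => t^-1) (fun t => - (t ^+ 2)^-1) f fX fY hf _ ci)).
- move=> p; have := @is_deriveV R id (f p) 1 1 (f0 p) _.
  move=> /(_ (is_derive_id _ _)); rewrite /GRing.scale /= mulr1.
  exact.
- by move=> p; rewrite mulrC mulrN mulNr.
- by move=> p; rewrite mulrC mulrN mulNr.
Qed.

(** A cutoff with one continuous derivative fits [hC1], and its polynomial form reduces the lower
    bound [potW_ge] to elementary algebra. *)
Lemma is_derive_bump (t : R) :
  is_derive t 1 (fun t => Num.max 0 (1 - t) ^+ 2) (- 2 * Num.max 0 (1 - t)).
Proof.
pose m (t : R) := Num.max 0 (1 - t).
apply/is_derive1_caratheodory.
pose g (z : R) := if z == t then - 2 * m t else (m z ^+ 2 - m t ^+ 2) / (z - t).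
exists g; split; last by rewrite /g eqxx.
  move=> z; rewrite /g; case: eqVneq => [->|zt]; first by rewrite !subrr mulr0.
  by rewrite divfK// subr_eq0.
have gt : g t = - 2 * m t by rewrite /g eqxx.
apply/cvgrPdist_le => e e0; near=> z; rewrite gt.
have zt : `|t - z| <= e by near: z; exact: cvgr_dist_le.
(* the quotient differs from - 2 m(t) by at most |z - t| *)
suff h : `|- 2 * m t - g z| <= `|t - z| by exact: le_trans h zt.
rewrite /g; case: eqVneq => [->|zt']; first by rewrite !subrr normr0.
have w0 : 0 < `|z - t| by rewrite normr_gt0 subr_eq0.
have -> : - 2 * m t - (m z ^+ 2 - m t ^+ 2) / (z - t) =
   - (2 * m t * (z - t) + (m z ^+ 2 - m t ^+ 2)) / (z - t).
  have F (a b w : R) : w != 0 -> - 2 * a - b / w = - (2 * a * w + b) / w by move=> w0'; field.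
  by rewrite F// subr_eq0.
rewrite normrM normfV normrN ler_pdivrMr// distrC -expr2 real_normK ?num_real//.
rewrite ler_norml; rewrite /m /Num.max; case: ltP => ?; case: ltP => ?; apply/andP; split; nra.
Unshelve. all: by end_near. Qed.

Lemma C1_at_hder f p a b : C1_at f p ->
  is_derive (0 : R) 1 (fun s => f (hmul p (hor a b s))) (a * vfX f p + b * vfY f p).
Proof.
move=> Cp; rewrite /hmul /hor /vfX /vfY.
pose c1 (s : R) := cx p + s * a; pose c2 (s : R) := cy p + s * b.
pose c3 (s : R) := cz p + 0 + (cx p * (s * b) - cy p * (s * a)) / 2.
have d1 : is_derive (0 : R) 1 c1 a by apply: is_derive_eq; rewrite /GRing.scale/=; ring.
have d2 : is_derive (0 : R) 1 c2 b by apply: is_derive_eq; rewrite /GRing.scale/=; ring.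
have d3 : is_derive (0 : R) 1 c3 ((cx p * b - cy p * a) / 2).
  by apply: is_derive_eq; rewrite /GRing.scale/=; ring.
have pE : p = (c1 0, c2 0, c3 0).
  by have := hmul_hor0 p a b; rewrite /hmul /hor /=.
have := chain_rule pE Cp d1 d2 d3.
have -> : a * partial 0 f p + b * partial 1 f p + (cx p * b - cy p * a) / 2 * partial 2 f p =
  a * (partial 0 f p - cy p / 2 * partial 2 f p) + b * (partial 1 f p + cx p / 2 * partial 2 f p).
  by move: (partial 0 f p) (partial 1 f p) (partial 2 f p) => P0 P1 P2; field.
by [].
Qed.

Lemma gC1_hC1 f : gC1 f -> hC1 f (vfX f) (vfY f).
Proof.
move=> cf; have [c0 _ cp] := cf.
have cy_c := @cy_continuous R; have cx_c := @cx_continuous R.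
split => //.
- rewrite /vfX; apply: ctD; [exact: cp|apply: ctN; apply: ctM; [|exact: cp]].
  by apply: ctM => //; exact: ct_cst.
- rewrite /vfY; apply: ctD; [exact: cp|apply: ctM; [|exact: cp]].
  by apply: ctM => //; exact: ct_cst.
move=> a b p; apply: C1_at_hder; exact: gC1_at.
Qed.

Lemma smooth_hC1 f : smooth_on setT f -> hC1 f (vfX f) (vfY f).
Proof. by move=> /smooth_gC1; exact: gC1_hC1. Qed.

End HC1.

Section Hardy.
Variable R : realType.
Local Notation H := (heis R).
Local Notation RM := (measurableTypeR R).
Local Notation MH := (RM * RM * RM)%type.
Local Notation mu3 := (@lebesgue3 R).
Implicit Types f g : H -> R.

Lemma ccontD f g : ccont f -> ccont g -> ccont (fun p => f p + g p).
Proof.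
move=> [cf [M hM]] [cg [N hN]]; split; first exact: ctD.
exists (Num.max M N) => p fg.
have [fp|/eqP fp] := boolP (f p == 0).
  by have [] := hN p; [move: fg; rewrite (eqP fp) add0r|split; rewrite le_max; apply/orP; right].
by have [] := hM p; [exact/eqP|split; rewrite le_max; apply/orP; left].
Qed.

Lemma ccontM f g : continuous f -> ccont g -> ccont (fun p => f p * g p).
Proof.
move=> cf [cg [N hN]]; split; first exact: ctM.
by exists N => p; rewrite mulf_eq0 negb_or => /andP[_ /hN].
Qed.

Lemma ccontMr f g : ccont f -> continuous g -> ccont (fun p => f p * g p).
Proof.
move=> cf cg; have [c h] := ccontM cg cf.
have -> : (fun p => f p * g p) = (fun p => g p * f p) by apply/funext => p; rewrite mulrC.
by [].
Qed.

Lemma I3D f g : ccont f -> ccont g -> I3 (fun p => f p + g p) = I3 f + I3 g.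
Proof.
move=> cf cg; apply: EFin_inj; rewrite EFinD -!I3E//; last exact: ccontD.
exact: (integralD_EFin _ (ccont_integrable cf) (ccont_integrable cg)).
Qed.

Lemma I3_le f g : ccont f -> ccont g -> (forall p, f p <= g p) -> I3 f <= I3 g.
Proof.
move=> cf cg fg; rewrite -lee_fin -!I3E//.
apply: le_integral => //; [exact: ccont_integrable|exact: ccont_integrable|].
by move=> p _; rewrite lee_fin.
Qed.

Variables (u1 u1X u1Y u2 u2X u2Y : H -> R).
Hypotheses (hu1 : hC1 u1 u1X u1Y) (hu2 : hC1 u2 u2X u2Y).
Hypotheses (su1 : ccont u1) (su2 : ccont u2).
Variables (c1 c2 c3 c4 : H -> R).
Hypotheses (sc1 : ccont c1) (sc2 : ccont c2) (sc3 : ccont c3) (sc4 : ccont c4).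
(* c1 + i c2 = Xu + i A_x u and c3 + i c4 = Yu + i A_y u *)
Hypothesis cX : forall p, u1 p * c1 p + u2 p * c2 p = u1 p * u1X p + u2 p * u2X p.
Hypothesis cY : forall p, u1 p * c3 p + u2 p * c4 p = u1 p * u1Y p + u2 p * u2Y p.

(** Expand |c + V u|^2, where c is the covariant gradient. By [cX] and [cY] the cross term 2
    V.Re(conj(u) c) equals V.grad |u|^2, free of the potential, and integrating it by parts gives
    -(div V) |u|^2. *)
Lemma ground_state_identity (V1 V1X V1Y V2 V2X V2Y : H -> R) :
  hC1 V1 V1X V1Y -> hC1 V2 V2X V2Y ->
  I3 (fun p => c1 p ^+ 2 + c2 p ^+ 2 + (c3 p ^+ 2 + c4 p ^+ 2)) =
  I3 (fun p => (c1 p + V1 p * u1 p) ^+ 2 + (c2 p + V1 p * u2 p) ^+ 2 +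
               ((c3 p + V2 p * u1 p) ^+ 2 + (c4 p + V2 p * u2 p) ^+ 2)) +
  I3 (fun p => (V1X p + V2Y p - (V1 p ^+ 2 + V2 p ^+ 2)) * (u1 p ^+ 2 + u2 p ^+ 2)).
Proof.
move=> hV1 hV2.
have sq f : ccont f -> ccont (fun p => f p ^+ 2).
  move=> cf; have -> : (fun p => f p ^+ 2) = (fun p => f p * f p) by apply/funext => p; rewrite expr2.
  by apply: ccontM => //; case: cf.
have [cV1 cV1X _ _] := hV1; have [cV2 _ cV2Y _] := hV2.
have [cu1X cu1Y] : continuous u1X /\ continuous u1Y by case: hu1.
have [cu2X cu2Y] : continuous u2X /\ continuous u2Y by case: hu2.
have hF1 := hC1M hV1 (hC1D (hC1M hu1 hu1) (hC1M hu2 hu2)).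
have hF2 := hC1M hV2 (hC1D (hC1M hu1 hu1) (hC1M hu2 hu2)).
have su : ccont (fun p => u1 p * u1 p + u2 p * u2 p).
  by apply: ccontD; apply: ccontM => //; [case: su1|case: su2].
have cu1 := su1.1; have cu2 := su2.1.
have sF1' : ccont (fun p => V1X p * (u1 p * u1 p + u2 p * u2 p) +
   V1 p * (u1X p * u1 p + u1 p * u1X p + (u2X p * u2 p + u2 p * u2X p))).
  apply: ccontD; first exact: ccontM.
  by apply: ccontM => //; repeat apply: ccontD; first [exact: ccontM|exact: ccontMr].
have sF2' : ccont (fun p => V2Y p * (u1 p * u1 p + u2 p * u2 p) +
   V2 p * (u1Y p * u1 p + u1 p * u1Y p + (u2Y p * u2 p + u2 p * u2Y p))).
  apply: ccontD; first exact: ccontM.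
  by apply: ccontM => //; repeat apply: ccontD; first [exact: ccontM|exact: ccontMr].
have := hder_integral0 (ccontM cV1 su) sF1' (hC1_X hF1); rewrite (I3E sF1') => -[z1].
have := hder_integral0 (ccontM cV2 su) sF2' (hC1_Y hF2); rewrite (I3E sF2') => -[z2].
have sP : ccont (fun p => (c1 p + V1 p * u1 p) ^+ 2 + (c2 p + V1 p * u2 p) ^+ 2 +
               ((c3 p + V2 p * u1 p) ^+ 2 + (c4 p + V2 p * u2 p) ^+ 2)).
  by repeat apply: ccontD; apply: sq; apply: ccontD => //; exact: ccontM.
have sD : ccont (fun p => c1 p ^+ 2 + c2 p ^+ 2 + (c3 p ^+ 2 + c4 p ^+ 2)).
  by repeat apply: ccontD; exact: sq.
have sV : ccont (fun p => (V1X p + V2Y p - (V1 p ^+ 2 + V2 p ^+ 2)) * (u1 p ^+ 2 + u2 p ^+ 2)).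
  apply: ccontM; first by cont.
  by apply: ccontD; exact: sq.
(* Once the two vanishing integrals X(V1 |u|^2) and Y(V2 |u|^2) are added on the left, the identity
   holds pointwise. *)
rewrite -(I3D sP sV) -[LHS]addr0 -z1 -[LHS]addr0 -z2 -!I3D//; last exact: ccontD.
rewrite /I3; congr fine; apply: eq_integral => p _; congr EFin.
have := cX p; have := cY p.
move: (u1 p) (u2 p) (c1 p) (c2 p) (c3 p) (c4 p) (V1 p) (V2 p) (V1X p) (V2Y p)
  (u1X p) (u2X p) (u1Y p) (u2Y p) => a b d1 d2 d3 d4 v1 v2 v1x v2y ax bx ay by_ h1 h2.
have -> : v1 * (ax * a + a * ax + (bx * b + b * bx)) = 2 * v1 * (a * d1 + b * d2) by rewrite h2; ring.
have -> : v2 * (ay * a + a * ay + (by_ * b + b * by_)) = 2 * v2 * (a * d3 + b * d4) by rewrite h1; ring.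
ring.
Qed.

End Hardy.

(** * The gauge and the Hardy potentials *)

Section Gauge.
Variable R : realType.
Local Notation H := (heis R).
Variable e : R.
Hypothesis e0 : 0 < e.
Implicit Type p : H.

Definition sqr p := cx p ^+ 2 + cy p ^+ 2.
Definition gN p := sqr p ^+ 2 + 16 * cz p ^+ 2.
(** [gN] is rho^4. Adding e makes the quotients and roots below C^1 at the origin; [gL] and [gm] are
    the regularised rho^2 and rho. *)
Definition gM p := gN p + e.
Definition gL p := Num.sqrt (gM p).
Definition gm p := Num.sqrt (gL p).
(* XN = 4 ga1 and YN = 4 ga2 *)
Definition ga1 p := sqr p * cx p - 4 * cy p * cz p.
Definition ga2 p := sqr p * cy p + 4 * cx p * cz p.

Lemma sqr_ge0' p : 0 <= sqr p. Proof. by rewrite addr_ge0 ?sqr_ge0. Qed.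
Lemma gN_ge0 p : 0 <= gN p. Proof. by rewrite addr_ge0 ?sqr_ge0// mulr_ge0 ?sqr_ge0. Qed.
Lemma gM_gt0 p : 0 < gM p. Proof. by rewrite ltr_wpDl ?gN_ge0. Qed.
Lemma gL_gt0 p : 0 < gL p. Proof. by rewrite sqrtr_gt0 gM_gt0. Qed.
Lemma gm_gt0 p : 0 < gm p. Proof. by rewrite sqrtr_gt0 gL_gt0. Qed.
Lemma gL_sq p : gL p ^+ 2 = gM p. Proof. by rewrite sqr_sqrtr// ltW// gM_gt0. Qed.
Lemma gm_sq p : gm p ^+ 2 = gL p. Proof. by rewrite sqr_sqrtr// ltW// gL_gt0. Qed.

Lemma ga_sq p : ga1 p ^+ 2 + ga2 p ^+ 2 = sqr p * gN p.
Proof. rewrite /ga1 /ga2 /gN /sqr; ring. Qed.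

Lemma hC1_sqr : hC1 sqr (fun p => 2 * cx p) (fun p => 2 * cy p).
Proof.
apply: (hC1_ext (hC1D (hC1M (hC1_cx R) (hC1_cx R)) (hC1M (hC1_cy R) (hC1_cy R)))) => p; rewrite /sqr; ring.
Qed.

Lemma hC1_gM : hC1 gM (fun p => 4 * ga1 p) (fun p => 4 * ga2 p).
Proof.
apply: (hC1_ext (hC1D (hC1D (hC1M hC1_sqr hC1_sqr)
  (hC1M (hC1_cst 16) (hC1M (hC1_cz R) (hC1_cz R)))) (hC1_cst e))) => p;
  by rewrite /gM /gN /ga1 /ga2; field.
Qed.

Lemma hC1_gN : hC1 gN (fun p => 4 * ga1 p) (fun p => 4 * ga2 p).
Proof.
apply: (hC1_ext (hC1D (hC1M hC1_sqr hC1_sqr)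
  (hC1M (hC1_cst 16) (hC1M (hC1_cz R) (hC1_cz R))))) => p;
  by rewrite /gN /ga1 /ga2; field.
Qed.

Lemma hC1_gL : hC1 gL (fun p => 2 * ga1 p / gL p) (fun p => 2 * ga2 p / gL p).
Proof.
have gL0 p : gL p != 0 by rewrite gt_eqF// gL_gt0.
by apply: (hC1_ext (hC1_sqrt hC1_gM gM_gt0)) => p //; have := gL0 p;
  rewrite -/(gL p); move: (gL p) => l l0; field.
Qed.

(** Only X of the first component and Y of the second enter a divergence; the other two derivatives
    stay existential. *)
Lemma hC1_ga1 : exists g, hC1 ga1 (fun p => 3 * sqr p) g.
Proof.
eexists; apply: (hC1_ext (hC1D (hC1M hC1_sqr (hC1_cx R))
   (hC1M (hC1M (hC1_cst (- 4)) (hC1_cy R)) (hC1_cz R)))) => p.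
- rewrite /ga1; ring.
- by rewrite /sqr; field.
- by [].
Qed.

Lemma hC1_ga2 : exists g, hC1 ga2 g (fun p => 3 * sqr p).
Proof.
eexists; apply: (hC1_ext (hC1D (hC1M hC1_sqr (hC1_cy R))
   (hC1M (hC1M (hC1_cst 4) (hC1_cx R)) (hC1_cz R)))) => p.
- rewrite /ga2; ring.
- by [].
- by rewrite /sqr; field.
Qed.

Definition V1 p := ga1 p / gM p.
Definition V2 p := ga2 p / gM p.
Definition V1X p := 3 * sqr p / gM p - 4 * ga1 p ^+ 2 / gM p ^+ 2.
Definition V2Y p := 3 * sqr p / gM p - 4 * ga2 p ^+ 2 / gM p ^+ 2.

Lemma gM_neq0 p : gM p != 0. Proof. by rewrite gt_eqF// gM_gt0. Qed.
Lemma gL_neq0 p : gL p != 0. Proof. by rewrite gt_eqF// gL_gt0. Qed.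

Lemma hC1_V1 : exists g, hC1 V1 V1X g.
Proof.
have [g hg] := hC1_ga1; eexists.
apply: (hC1_ext (hC1M hg (hC1_inv hC1_gM gM_neq0))) => p; [by []| |by []].
by rewrite /V1X; have := gM_neq0 p; move: (gM p) (ga1 p) (sqr p) => m a s m0; field.
Qed.

Lemma hC1_V2 : exists g, hC1 V2 g V2Y.
Proof.
have [g hg] := hC1_ga2; eexists.
apply: (hC1_ext (hC1M hg (hC1_inv hC1_gM gM_neq0))) => p; [by []|by []|].
by rewrite /V2Y; have := gM_neq0 p; move: (gM p) (ga2 p) (sqr p) => m a s m0; field.
Qed.

(** V is the horizontal gradient of log [gm]. Hence [gm] times (grad_H + iA + V) u is (grad_H +
    iA)([gm] u). *)
Lemma hC1_gm : hC1 gm (fun p => gm p * V1 p) (fun p => gm p * V2 p).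
Proof.
have h q : gm q != 0 by rewrite gt_eqF// gm_gt0.
apply: (hC1_ext (hC1_sqrt hC1_gL gL_gt0)) => p //; rewrite -/(gm p) /V1 /V2 -gL_sq -gm_sq;
 have := h p; move: (gm p) (ga1 p) (ga2 p) => m a1 a2 m0; field => //.
Qed.

(* The deficit is 5 e r^2 / (N + e)^2. *)
Lemma hardy_potential p : sqr p / gM p <= V1X p + V2Y p - (V1 p ^+ 2 + V2 p ^+ 2).
Proof.
have M0 := gM_gt0 p; have Mn := gM_neq0 p.
have -> : V1X p + V2Y p - (V1 p ^+ 2 + V2 p ^+ 2) =
   6 * sqr p / gM p - 5 * (ga1 p ^+ 2 + ga2 p ^+ 2) / gM p ^+ 2.
  by rewrite /V1X /V2Y /V1 /V2; move: (gM p) (ga1 p) (ga2 p) (sqr p) Mn => m a1 a2 s mn; field.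
rewrite ga_sq (_ : gN p = gM p - e); last by rewrite /gM; ring.
rewrite -subr_ge0.
have -> : 6 * sqr p / gM p - 5 * (sqr p * (gM p - e)) / gM p ^+ 2 - sqr p / gM p =
  5 * e * sqr p / gM p ^+ 2.
  by move: (gM p) (sqr p) Mn => m s mn; field.
by rewrite divr_ge0 ?sqr_ge0// !mulr_ge0 ?sqr_ge0' // ltW.
Qed.

(** The cutoff is a function of N and not of N + e, so its support, the unit gauge ball, does not
    move with e. *)
Definition eta p : R := Num.max 0 (1 - gN p) ^+ 2.
Definition deta p : R := - 2 * Num.max 0 (1 - gN p).

Lemma hC1_eta : hC1 eta (fun p => deta p * (4 * ga1 p)) (fun p => deta p * (4 * ga2 p)).
Proof.
apply: (@hC1_comp _ (fun t => Num.max 0 (1 - t) ^+ 2) (fun t => - 2 * Num.max 0 (1 - t)) _ _ _ hC1_gN).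
  by move=> p; exact: is_derive_bump.
have [cN _ _ _] := hC1_gN.
apply: ctM; first exact: ct_cst.
move=> x; apply: (@continuous_max _ _ (fun _ => 0) (fun p => 1 - gN p)); first exact: cvg_cst.
by apply: continuousB; [exact: cvg_cst|exact: cN].
Qed.

(* W = eta ((x, y) + grad N / (4 L)) / 4 *)
Definition W1 p := eta p * (cx p + ga1 p / gL p) / 4.
Definition W2 p := eta p * (cy p + ga2 p / gL p) / 4.
Definition W1X p := (deta p * (4 * ga1 p) * (cx p + ga1 p / gL p) +
   eta p * (1 + 3 * sqr p / gL p - 2 * ga1 p ^+ 2 / (gL p * gM p))) / 4.
Definition W2Y p := (deta p * (4 * ga2 p) * (cy p + ga2 p / gL p) +
   eta p * (1 + 3 * sqr p / gL p - 2 * ga2 p ^+ 2 / (gL p * gM p))) / 4.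

Lemma hC1_W1 : exists g, hC1 W1 W1X g.
Proof.
have [g hg] := hC1_ga1; eexists.
apply: (hC1_ext (hC1M (hC1M hC1_eta (hC1D (hC1_cx R) (hC1M hg (hC1_inv hC1_gL gL_neq0))))
  (hC1_cst (4^-1)))) => p; [by []| |by []].
rewrite /W1X -gL_sq; have := gL_neq0 p.
move: (gL p) (ga1 p) (sqr p) (eta p) (deta p) (cx p) => l a s t dt x l0; field => //.
Qed.

Lemma hC1_W2 : exists g, hC1 W2 g W2Y.
Proof.
have [g hg] := hC1_ga2; eexists.
apply: (hC1_ext (hC1M (hC1M hC1_eta (hC1D (hC1_cy R) (hC1M hg (hC1_inv hC1_gL gL_neq0))))
  (hC1_cst (4^-1)))) => p; [by []|by []|].
rewrite /W2Y -gL_sq; have := gL_neq0 p.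
move: (gL p) (ga2 p) (sqr p) (eta p) (deta p) (cy p) => l a s t dt x l0; field => //.
Qed.

(** The increase of div V - |V|^2 when V is replaced by V + W. *)
Definition potW p := W1X p + W2Y p - 2 * (V1 p * W1 p + V2 p * W2 p) - (W1 p ^+ 2 + W2 p ^+ 2).

Lemma potW0 p : 1 <= gN p -> potW p = 0.
Proof.
move=> N1; have m0 : Num.max 0 (1 - gN p) = 0 by apply/max_idPl; rewrite subr_le0.
rewrite /potW /W1X /W2Y /W1 /W2 /eta /deta m0; ring.
Qed.

(** With q = r^2 / L and k = N / L^2, both in [0, 1], div W - 2 V.W is [eta] (2 + 6q - 4qk - 2q^2) /
    4 plus a term with the derivative of [eta]. The field (x, y) alone would give 2 - 2q^2, which
    degenerates on z = 0 as e tends to 0, and grad N / (4 L) alone gives 6q - 4qk, zero on the axis;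
    together they stay above 2. The three terms are then bounded by -4 N (1 - N), (1 - N)^2 / 2 and
    -(1 - N)^2 / 4, whose sum is at least 1/4 - 5 N, and N <= L in the unit ball. *)
Lemma potW_ge p : gN p <= 1 -> 4^-1 - 5 * gL p <= potW p.
Proof.
move=> N1; have mE : Num.max 0 (1 - gN p) = 1 - gN p by apply/max_idPr; rewrite subr_ge0.
have M0 := gM_gt0 p; have L0 := gL_gt0 p; have Ln := gL_neq0 p.
have NM : gN p <= gM p by rewrite /gM lerDl ltW.
have N0 := gN_ge0 p; have s0 := sqr_ge0' p.
have xa : cx p * ga1 p + cy p * ga2 p = sqr p ^+ 2 by rewrite /ga1 /ga2 /sqr; ring.
have aa := ga_sq p.
have xx : cx p ^+ 2 + cy p ^+ 2 = sqr p by [].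
have sN : sqr p ^+ 2 <= gN p by rewrite /gN lerDl mulr_ge0// sqr_ge0.
have L2 := gL_sq p.
pose q := sqr p / gL p; pose k := gN p / gL p ^+ 2.
have potE : potW p = deta p * (sqr p ^+ 2 + q * gN p) +
   eta p * (2 + 6 * q - 4 * q * k - 2 * q ^+ 2) / 4 -
   eta p ^+ 2 / 16 * (sqr p * (1 + 2 * q + k)).
  transitivity (deta p * ((cx p * ga1 p + cy p * ga2 p) + (ga1 p ^+ 2 + ga2 p ^+ 2) / gL p) +
   eta p * (2 + 6 * (sqr p / gL p) - 4 * (ga1 p ^+ 2 + ga2 p ^+ 2) / gL p ^+ 3
     - 2 * (cx p * ga1 p + cy p * ga2 p) / gL p ^+ 2) / 4 -
   eta p ^+ 2 / 16 * ((cx p ^+ 2 + cy p ^+ 2) + 2 * (cx p * ga1 p + cy p * ga2 p) / gL p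
     + (ga1 p ^+ 2 + ga2 p ^+ 2) / gL p ^+ 2)).
    rewrite /potW /W1X /W2Y /W1 /W2 /V1 /V2 -L2.
    move: (gL p) (ga1 p) (ga2 p) (eta p) (deta p) (cx p) (cy p) (sqr p) Ln => l a1 a2 t dt x y s l0.
    by field.
  rewrite xa aa xx /q /k.
  move: (gL p) (eta p) (deta p) (gN p) (sqr p) Ln => l t dt n s l0.
  by field.
have q0 : 0 <= q by rewrite divr_ge0// ltW.
have sL : sqr p <= gL p.
  by rewrite -(@ler_pXn2r _ 2) ?nnegrE ?(ltW L0)// L2; exact: le_trans sN NM.
have q1 : q <= 1 by rewrite ler_pdivrMr// mul1r.
have k0 : 0 <= k by rewrite divr_ge0// sqr_ge0.
have k1 : k <= 1 by rewrite /k L2 ler_pdivrMr// mul1r.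
have s1 : sqr p <= 1 by rewrite -(@ler_pXn2r _ 2) ?nnegrE// expr1n; exact: le_trans sN N1.
have NL : gN p <= gL p.
  rewrite -(@ler_pXn2r _ 2) ?nnegrE ?(ltW L0)// L2; apply: le_trans NM; nra.
rewrite potE /eta /deta mE.
clear potE; clearbody q k; move: q k (gN p) (sqr p) (gL p) N0 N1 s0 sN s1 NL q0 q1 k0 k1 => q' k' n s l n0 n1 s0 sn s1 nl q0 q1 k0 k1.
have A1 : - 4 * n * (1 - n) <= - 2 * (1 - n) * (s ^+ 2 + q' * n).
  have h : s ^+ 2 + q' * n <= 2 * n by nra.
  by rewrite -subr_ge0 (_ : _ - _ = 2 * (1 - n) * (2 * n - (s ^+ 2 + q' * n))); [nra|ring].
have A2 : (1 - n) ^+ 2 / 2 <= (1 - n) ^+ 2 * (2 + 6 * q' - 4 * q' * k' - 2 * q' ^+ 2) / 4.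
  have h : 0 <= 6 * q' - 4 * q' * k' - 2 * q' ^+ 2 by nra.
  have h2 : 0 <= (1 - n) ^+ 2 * (6 * q' - 4 * q' * k' - 2 * q' ^+ 2) by rewrite mulr_ge0// sqr_ge0.
  lra.
have A3 : ((1 - n) ^+ 2) ^+ 2 / 16 * (s * (1 + 2 * q' + k')) <= (1 - n) ^+ 2 / 4.
  have h : s * (1 + 2 * q' + k') <= 4 by nra.
  have h0 : 0 <= s * (1 + 2 * q' + k') by nra.
  have h2 : (1 - n) ^+ 2 <= 1 by nra.
  have h3 : 0 <= (1 - n) ^+ 2 by exact: sqr_ge0.
  move: ((1 - n) ^+ 2) (s * _) h h0 h2 h3 => a b h h0 h2 h3.
  rewrite expr2; have : a * b <= 4 by nra.
  nra.
nra.
Qed.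

End Gauge.

(** * Integrals along horizontal paths *)

Section Transport.
Variable R : realType.
Local Notation H := (heis R).
Local Notation RM := (measurableTypeR R).
Local Notation MH := (RM * RM * RM)%type.
Local Notation mu3 := (@lebesgue3 R).
Local Notation lam := (@lebesgue_measure R).
Implicit Types (f d : H -> R) (p q : H) (l : seq (R * R)).

Definition step (p : H) (v : R * R) : H := hmul p (hor v.1 v.2 1).

Definition line_int (v : R * R) d p : \bar R :=
  (\int[lam]_(s in `[0%R, 1%R]) (d (hmul p (hor v.1 v.2 s)))%:E)%E.

(** Every segment is run through in unit time, so this is not an arc-length integral; the factors
    |v|^2 that make up for it appear in [transportable] and [path_cst]. *)
Fixpoint cost d l p : \bar R :=
  if l is v :: l' then (line_int v d p + cost d l' (step p v))%E else 0%E.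

Definition pend l p := foldl step p l.

Lemma line_intE v d p : line_int v d p =
  (\int[lam]_s (d (hmul p (hor v.1 v.2 s)) * \1_(`[0%R, 1%R]%classic : set RM) s)%:E)%E.
Proof.
rewrite /line_int integral_mkcond; apply: eq_integral => s _.
by rewrite patchE indicE; case: ifP => _; rewrite ?mulr1 ?mulr0.
Qed.

Lemma measurable_line v d : continuous d ->
  measurable_fun setT (fun q : MH * RM =>
    (d (hmul q.1 (hor v.1 v.2 q.2)) * \1_(`[0%R, 1%R]%classic : set RM) q.2)%:E).
Proof.
move=> cd; apply/measurable_EFinP; apply: measurable_funM.
  exact: (measurableT_comp (continuous_measurable_heis cd) (hmul_hor_measurable v.1 v.2)).
apply: measurableT_comp; last exact: measurable_snd.
by apply: measurable_indic; exact: measurable_itv.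
Qed.

Lemma line_int_ge0 v d p : (forall p, 0 <= d p) -> (0 <= line_int v d p)%E.
Proof. by move=> d0; apply: integral_ge0 => s _; rewrite lee_fin. Qed.

Lemma measurable_line_int v d : continuous d -> (forall p, 0 <= d p) ->
  measurable_fun (setT : set MH) (line_int v d).
Proof.
move=> cd d0.
have -> : line_int v d = fubini_F lam (fun q : MH * RM =>
    (d (hmul q.1 (hor v.1 v.2 q.2)) * \1_(`[0%R, 1%R]%classic : set RM) q.2)%:E).
  by apply/funext => p; rewrite line_intE.
have mG := measurable_line v cd.
have G0 (q : MH * RM) :
  (0 <= (d (hmul q.1 (hor v.1 v.2 q.2)) * \1_(`[0%R, 1%R]%classic : set RM) q.2)%:E)%E.
  by rewrite lee_fin mulr_ge0.
by apply: measurable_fun_fubini_tonelli_F.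
Qed.

Lemma measurable_step v : measurable_fun setT (step ^~ v : MH -> MH).
Proof. exact: hmul_measurable. Qed.

Lemma cost_ge0 d l p : (forall p, 0 <= d p) -> (0 <= cost d l p)%E.
Proof.
by move=> d0; elim: l p => //= v l IH p; apply: adde_ge0; rewrite ?line_int_ge0.
Qed.

Lemma measurable_cost d l : continuous d -> (forall p, 0 <= d p) ->
  measurable_fun (setT : set MH) (cost d l).
Proof.
move=> cd d0; elim: l => [|v l IH] /=; first exact: measurable_cst.
apply: emeasurable_funD; first exact: measurable_line_int.
exact: (measurableT_comp IH (measurable_step v)).
Qed.

Lemma hmul_box M (h : R) : exists N, forall p q, box M p -> box h q -> box N (hmul p q).
Proof.
exists (M + h + M * h) => -[[x y] z] [[a b] c]; rewrite /box /hmul /cx /cy /cz /=.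
move=> [hx hy hz] [ha hb hc].
have M0 : 0 <= M by exact: le_trans (normr_ge0 _) hx.
have h0 : 0 <= h by exact: le_trans (normr_ge0 _) ha.
have Mh : 0 <= M * h by exact: mulr_ge0.
have t (x' y' : R) : `|x'| <= M -> `|y'| <= h -> `|x' + y'| <= M + h + M * h.
  by move=> h1 h2; apply: le_trans (ler_normD _ _) _; lra.
split; [exact: t|exact: t|].
apply: le_trans (ler_normD _ _) _; apply: lerD.
  by apply: le_trans (ler_normD _ _) _; lra.
rewrite normrM (_ : `|2^-1| = 2^-1 :> R); last by rewrite ger0_norm.
have m (x' y' : R) : `|x'| <= M -> `|y'| <= h -> `|x' * y'| <= M * h.
  by move=> h1 h2; rewrite normrM; exact: ler_pM.
have := ler_normB (x * b) (y * a); have := m _ _ hx hb; have := m _ _ hy ha.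
move: (`|x * b - y * a|) (`|x * b|) (`|y * a|) => *; lra.
Qed.

Lemma hor_box (v : R * R) : exists h, forall s, s \in `[0, 1] -> box h (hor v.1 v.2 s).
Proof.
exists (`|v.1| + `|v.2|) => s; rewrite in_itv /= => /andP[s0 s1].
rewrite /box /hor /cx /cy /cz /= normr0 !normrM (ger0_norm s0).
split; last by rewrite addr_ge0.
  by apply: (@le_trans _ _ `|v.1|); [rewrite ler_piMl|rewrite lerDl].
by apply: (@le_trans _ _ `|v.2|); [rewrite ler_piMl|rewrite lerDr].
Qed.

Lemma box_le M N : M <= N -> box M `<=` (box N : set H).
Proof. by move=> MN p [hx hy hz]; split; apply: le_trans MN. Qed.

Lemma ge0_subset_int (A B : set MH) (f : H -> \bar R) : measurable A -> measurable B ->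
  A `<=` B -> measurable_fun (setT : set MH) f -> (forall p, 0 <= f p)%E ->
  (\int[mu3]_(p in A) f p <= \int[mu3]_(p in B) f p)%E.
Proof.
by move=> mA mB AB mf f0; apply: ge0_subset_integral => //; exact: measurable_funTS.
Qed.

Lemma integral_preimage (E : set MH) q (f : H -> \bar R) : measurable E ->
  measurable_fun (setT : set MH) f -> (forall p, 0 <= f p)%E ->
  (\int[mu3]_(p in [set p : MH | E (hmul p q)]) f (hmul p q) = \int[mu3]_(p in E) f p)%E.
Proof.
move=> mE mf f0.
rewrite [RHS]integral_mkcond -(@ge0_integral_hmul _ q (f \_ E)).
- rewrite [LHS]integral_mkcond; apply: eq_integral => p _.
  by rewrite !patchE; congr (if _ then _ else _); apply/idP/idP; rewrite !inE.
- by apply/(measurable_restrictT _ _).1 => //; exact: measurable_funTS.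
- by move=> p; rewrite patchE; case: ifP.
Qed.

Lemma measurable_preimage_hmul (E : set MH) q : measurable E -> measurable [set p : MH | E (hmul p q)].
Proof.
move=> mE; rewrite -[X in measurable X]setTI.
exact: (hmul_measurable q measurableT mE).
Qed.

(** By Tonelli the line integrals are averaged over p first. For fixed s right invariance turns the
    inner integral into one over a translate of the box, and a single larger box holds all these
    translates. N is chosen before [d]. *)
Lemma line_int_box v M : exists N, forall d, continuous d -> (forall p, 0 <= d p) ->
  (\int[mu3]_(p in box M) line_int v d p <= \int[mu3]_(p in box N) (d p)%:E)%E.
Proof.
have [h hh] := hor_box v; have [N hN] := hmul_box M h.
exists N => d cd d0.
have md : measurable_fun (setT : set MH) (EFin \o d).
  by apply/measurable_EFinP; exact: continuous_measurable_heis.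
have mb := @measurable_box R M; have mN := @measurable_box R N.
pose G (q : MH * RM) : \bar R := ((d (hmul q.1 (hor v.1 v.2 q.2)) * \1_(`[0%R, 1%R]%classic : set RM) q.2)
  * \1_(box M) q.1)%:E.
have mG : measurable_fun setT G.
  apply/measurable_EFinP; apply: measurable_funM.
    by apply/measurable_EFinP; exact: measurable_line.
  by apply: measurableT_comp; [exact: measurable_indic|exact: measurable_fst].
have G0 (q : MH * RM) : (0 <= G q)%E by rewrite lee_fin !mulr_ge0.
have -> : (\int[mu3]_(p in box M) line_int v d p = \int[mu3]_p \int[lam]_s G (p, s))%E.
  rewrite integral_mkcond; apply: eq_integral => p _; rewrite patchE /G /= indicE.
  case: ifP => _ /=; last by rewrite integral0_eq// => s _; rewrite mulr0.
  by rewrite line_intE; apply: eq_integral => s _; rewrite mulr1.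
have -> : (\int[mu3]_p \int[lam]_s G (p, s) = \int[lam]_s \int[mu3]_p G (p, s))%E by exact: fubini_tonelli.
have -> : (\int[mu3]_(p in box N) (d p)%:E = \int[lam]_(s in `[0%R, 1%R]) \int[mu3]_(p in box N) (d p)%:E)%E.
  rewrite integral_cst; last exact: measurable_itv.
  transitivity ((\int[mu3]_(p in box N) (d p)%:E) * 1)%E; first by rewrite mule1.
  by congr (_ * _)%E; exact: (esym (@lebesgue01 R)).
rewrite [leRHS]integral_mkcond; apply: ge0_le_integral => //.
- by move=> s _; apply: integral_ge0.
- by apply: measurable_fun_fubini_tonelli_G.
- apply/(measurable_restrictT _ _).1; first exact: measurable_itv.
  exact: measurable_cst.
move=> s _; rewrite patchE; case: ifPn => [|sn]; last first.
  by rewrite integral0_eq// => p _; rewrite /G /= indicE (negbTE sn) mulr0 mul0r.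
rewrite inE /= => s01.
rewrite -(@integral_preimage (box N) (hor v.1 v.2 s) (EFin \o d)) //.
rewrite [leRHS]integral_mkcond; apply: ge0_le_integral => //.
- by apply: (measurableT_comp mG); apply: measurable_fun_pair => //; exact: measurable_cst.
- apply/(measurable_restrictT _ _).1; first exact: measurable_preimage_hmul.
  by apply: measurable_funTS; exact: (measurableT_comp md (hmul_measurable _)).
move=> p _; rewrite /G /= !indicE patchE.
case: (boolP (p \in box M)) => /=; last first.
  by rewrite mulr0; case: ifP => //=; rewrite lee_fin.
rewrite inE => bp; rewrite mulr1 ifT; last by rewrite inE /=; apply: hN => //; exact: hh.
by rewrite lee_fin ler_piMr//; case: (_ \in _).
Qed.

Lemma cost_box l M : exists N, forall d, continuous d -> (forall p, 0 <= d p) ->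
  (\int[mu3]_(p in box M) cost d l p <= (size l)%:R%:E * \int[mu3]_(p in box N) (d p)%:E)%E.
Proof.
elim: l M => [|v l IH] M /=.
  by exists 0 => d cd d0; rewrite mul0e integral0.
have [N1 h1] := line_int_box v M.
have [h hh] := hor_box v; have [N2 h2] := hmul_box M h.
have [N3 h3] := IH N2.
exists (Num.max N1 N3) => d cd d0.
have md : measurable_fun (setT : set MH) (EFin \o d).
  by apply/measurable_EFinP; exact: continuous_measurable_heis.
have mb := @measurable_box R.
have mc := measurable_cost l cd d0.
have d0' p : (0 <= (EFin \o d) p)%E by rewrite lee_fin.
rewrite ge0_integralD //; last 4 first.
- by move=> p _; exact: line_int_ge0.
- by apply: measurable_funTS; exact: measurable_line_int.
- by move=> p _; exact: cost_ge0.
- by apply: measurable_funTS; exact: (measurableT_comp mc (measurable_step v)).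
rewrite -[in X in (_ <= X%:E * _)%E]add1n natrD EFinD ge0_muleDl// mul1e; apply: leeD.
  apply: le_trans (h1 d cd d0) _; apply: ge0_subset_int => //.
  by apply: box_le; rewrite le_max lexx.
apply: (@le_trans _ _ (\int[mu3]_(p in box N2) cost d l p)%E).
  rewrite -(@integral_preimage (box N2) (hor v.1 v.2 1) (cost d l))//; last first.
    by move=> p; exact: cost_ge0.
  apply: ge0_subset_int => //.
  - exact: measurable_preimage_hmul.
  - by move=> p bp /=; apply: h2 => //; apply: hh; rewrite in_itv /= ler01 lexx.
  - exact: (measurableT_comp mc (measurable_step v)).
  - by move=> p; exact: cost_ge0.
apply: le_trans (h3 d cd d0) _; apply: lee_pmul => //; first by apply: integral_ge0 => p _; rewrite lee_fin.
apply: ge0_subset_int => //.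
by apply: box_le; rewrite le_max lexx orbT.
Qed.

End Transport.

(** * Magnetic Poincare inequality *)

Section Poincare.
Variable R : realType.
Local Notation H := (heis R).
Local Notation RM := (measurableTypeR R).
Local Notation MH := (RM * RM * RM)%type.
Local Notation mu3 := (@lebesgue3 R).
Local Notation lam := (@lebesgue_measure R).
Implicit Types (f d : H -> R) (p q : H) (l : seq (R * R)) (A : potential R).

Definition sqn (v : R * R) : R := v.1 ^+ 2 + v.2 ^+ 2.

(* [f = |w|^2] and [d = |(X + i A_x) w|^2 + |(Y + i A_y) w|^2] for a C^1 function w = w1 + i w2 *)
Definition magnetic_pair A (w1 w2 f d : H -> R) := exists w1X w1Y w2X w2Y,
  [/\ hC1 w1 w1X w1Y, hC1 w2 w2X w2Y,
   [/\ continuous (fun p => w1X p - potx A p * w2 p), continuous (fun p => w2X p + potx A p * w1 p),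
     continuous (fun p => w1Y p - poty A p * w2 p) & continuous (fun p => w2Y p + poty A p * w1 p)],
   f = (fun p => w1 p ^+ 2 + w2 p ^+ 2) &
   d = (fun p => (w1X p - potx A p * w2 p) ^+ 2 + (w2X p + potx A p * w1 p) ^+ 2 +
     ((w1Y p - poty A p * w2 p) ^+ 2 + (w2Y p + poty A p * w1 p) ^+ 2))].

(** All that spreading a bound from one set to another uses. No potential occurs in it, so the
    resulting constants are common to all potentials. *)
Definition transportable f d := [/\ continuous f, continuous d, forall p, 0 <= f p, forall p, 0 <= d p &
  forall v p, ((f p)%:E <= (expR 1 * f (step p v))%:E + (expR 1 * sqn v)%:E * line_int v d p)%E].

Lemma ge0_line_intZ v d p (k : R) : 0 <= k -> continuous d -> (forall p, 0 <= d p) ->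
  (\int[lam]_(s in `[0%R, 1%R]) (k * d (hmul p (hor v.1 v.2 s)))%:E = k%:E * line_int v d p)%E.
Proof.
move=> k0 cd d0; under eq_integral do rewrite EFinM.
have mh : measurable_fun (`[0%R, 1%R]%classic : set RM) (fun s => (d (hmul p (hor v.1 v.2 s)))%:E).
  apply/measurable_EFinP; apply: measurable_funTS; apply: continuous_measurable_fun.
  by move=> s; apply: continuous_comp; [exact: hmul_hor_continuous|exact: cd].
have h0 s : (`[0%R, 1%R]%classic : set RM) s -> (0 <= (d (hmul p (hor v.1 v.2 s)))%:E)%E.
  by rewrite lee_fin.
have mi : measurable (`[0%R, 1%R]%classic : set RM) by exact: measurable_itv.
have k0' : (0 <= k%:E)%E by rewrite lee_fin.
by rewrite (ge0_integralZl lam mi mh h0 k0').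
Qed.

(** A drops out of the derivative f' of |w|^2 along the segment, and Young's inequality gives -f' <=
    f + |v|^2 d. Hence -(exp(s) f)' <= exp(s) |v|^2 d, which is integrated over [0, 1]. *)
Lemma magnetic_transportable A w1 w2 f d : magnetic_pair A w1 w2 f d -> transportable f d.
Proof.
move=> [w1X [w1Y [w2X [w2Y [h1 h2 [k1 k2 k3 k4] fE dE]]]]].
have cw1 : continuous w1 by case: h1.
have cw2 : continuous w2 by case: h2.
have cw1X : continuous w1X by case: h1.
have cw1Y : continuous w1Y by case: h1.
have cw2X : continuous w2X by case: h2.
have cw2Y : continuous w2Y by case: h2.
have cf : continuous f by rewrite fE; apply: ctD; exact: ctX.
have cd : continuous d by rewrite dE; apply: ctD; apply: ctD; exact: ctX.
have f0 p : 0 <= f p by rewrite fE addr_ge0// sqr_ge0.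
have d0 p : 0 <= d p by rewrite dE !addr_ge0// sqr_ge0.
split => // v p.
pose g s := f (hmul p (hor v.1 v.2 s)).
pose f' q := 2 * (w1 q * (v.1 * w1X q + v.2 * w1Y q) + w2 q * (v.1 * w2X q + v.2 * w2Y q)).
have df : hder v.1 v.2 f f'.
  have [_ _ _ /(_ v.1 v.2)] := hC1D (hC1M h1 h1) (hC1M h2 h2).
  rewrite fE (_ : (fun p => w1 p ^+ 2 + w2 p ^+ 2) = (fun p => w1 p * w1 p + w2 p * w2 p)) //.
  by apply: hder_eq => q; rewrite /f'; ring.
have cf' : continuous f' by rewrite /f'; cont.
have cline (h : H -> R) : continuous h -> continuous (fun s => h (hmul p (hor v.1 v.2 s))).
  by move=> ch s; apply: continuous_comp; [exact: hmul_hor_continuous|exact: ch].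
have dg (s : R) : is_derive s 1 (fun s => - (expR s * g s)) (- (expR s * (g s + f' (hmul p (hor v.1 v.2 s))))).
  have d1 := hder_line p s df; rewrite -/g in d1.
  by apply: is_derive_eq; rewrite /GRing.scale /=; ring.
have cg : continuous (fun s => - (expR s * (g s + f' (hmul p (hor v.1 v.2 s))))).
  apply: ctN; apply: ctM; first exact: continuous_expR.
  by apply: ctD; exact: cline.
have I1 := FTC_derive ltr01 dg cg.
have key q : - (f q + f' q) <= sqn v * d q.
  rewrite /f' fE dE /sqn.
  set X1 := w1X q - _; set X2 := w2X q + _; set Y1 := w1Y q - _; set Y2 := w2Y q + _.
  have -> : w1 q * (v.1 * w1X q + v.2 * w1Y q) + w2 q * (v.1 * w2X q + v.2 * w2Y q) =
    w1 q * (v.1 * X1 + v.2 * Y1) + w2 q * (v.1 * X2 + v.2 * Y2) by rewrite /X1 /X2 /Y1 /Y2; ring.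
  have := sqr_ge0 (w1 q + (v.1 * X1 + v.2 * Y1)); have := sqr_ge0 (w2 q + (v.1 * X2 + v.2 * Y2)).
  have := sqr_ge0 (v.1 * Y1 - v.2 * X1); have := sqr_ge0 (v.1 * Y2 - v.2 * X2).
  by move: (w1 q) (w2 q) X1 X2 Y1 Y2 v.1 v.2 => a b X1 X2 Y1 Y2 v1 v2; lra.
have : (\int[lam]_(s in `[0%R, 1%R]) (- (expR s * (g s + f' (hmul p (hor v.1 v.2 s)))))%:E <=
   \int[lam]_(s in `[0%R, 1%R]) (expR 1 * sqn v * d (hmul p (hor v.1 v.2 s)))%:E)%E.
  apply: le_integral.
  - exact: measurable_itv.
  - exact: (integrable01 cg).
  - by apply: (@integrable01 _ (fun s => expR 1 * sqn v * d (hmul p (hor v.1 v.2 s)))); cont; exact: cline.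
  move=> s; rewrite inE /= in_itv /= => /andP[s0 s1]; rewrite lee_fin.
  have e1 : expR s <= expR 1 by rewrite ler_expR.
  have e0 : 0 < expR s by exact: expR_gt0.
  have kk := key (hmul p (hor v.1 v.2 s)).
  rewrite /g -mulrN.
  have sd0 : 0 <= sqn v * d (hmul p (hor v.1 v.2 s)) by rewrite mulr_ge0// addr_ge0// sqr_ge0.
  apply: (@le_trans _ _ (expR s * (sqn v * d (hmul p (hor v.1 v.2 s))))).
    by rewrite ler_pM2l.
  by rewrite -mulrA ler_wpM2r.
have sv0 : 0 <= expR 1 * sqn v by rewrite mulr_ge0 ?expR_ge0// addr_ge0// sqr_ge0.
rewrite I1 ge0_line_intZ// expR0 mul1r /g hmul_hor0 -/(step p v) opprK => h.
by move: (leeD2l (expR 1 * f (step p v))%:E h); rewrite -EFinD addrA subrr add0r.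
Qed.

(** [th] is the integral of A along the path, described by a primitive on each segment. This serves
    alike a smooth potential, where primitives come from integrals, and an Aharonov-Bohm potential,
    where they are arctangents. *)
Fixpoint phase A l p (th : R) : Prop :=
  if l is v :: l' then exists Phi : R -> R, exists th',
    [/\ forall s : R, is_derive s 1 Phi (v.1 * potx A (hmul p (hor v.1 v.2 s)) + v.2 * poty A (hmul p (hor v.1 v.2 s))),
     phase A l' (step p v) th' & th = (Phi 1 - Phi 0) + th']
  else th = 0.

(** Along the segment the derivative of exp(i th) w is exp(i th) times the covariant derivative of
    w, so [sq_increment_le] applies to its real and imaginary parts. *)
Lemma phase_segment A w1 w2 f d v p (Phi : R -> R) : magnetic_pair A w1 w2 f d ->
  (forall s : R, is_derive s 1 Phi (v.1 * potx A (hmul p (hor v.1 v.2 s)) + v.2 * poty A (hmul p (hor v.1 v.2 s)))) ->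
  (((cos (Phi 1 - Phi 0) * w1 (step p v) - sin (Phi 1 - Phi 0) * w2 (step p v) - w1 p) ^+ 2 +
    (sin (Phi 1 - Phi 0) * w1 (step p v) + cos (Phi 1 - Phi 0) * w2 (step p v) - w2 p) ^+ 2)%:E
   <= (sqn v)%:E * line_int v d p)%E.
Proof.
move=> hm dP; set t := Phi 1 - Phi 0; set q := step p v; have [_ cd _ d0 _] := magnetic_transportable hm.
move: hm => [w1X [w1Y [w2X [w2Y [h1 h2 [k1 k2 k3 k4] fE dE]]]]].
pose th s := Phi s - Phi 0.
pose ln s := hmul p (hor v.1 v.2 s).
have cline (h : H -> R) : continuous h -> continuous (fun s => h (ln s)).
  by move=> ch s; apply: continuous_comp; [exact: hmul_hor_continuous|exact: ch].
pose c1 q := v.1 * (w1X q - potx A q * w2 q) + v.2 * (w1Y q - poty A q * w2 q).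
pose c2 q := v.1 * (w2X q + potx A q * w1 q) + v.2 * (w2Y q + poty A q * w1 q).
have cc1 : continuous c1 by apply: ctD; (apply: ctM; [exact: ct_cst|by []]).
have cc2 : continuous c2 by apply: ctD; (apply: ctM; [exact: ct_cst|by []]).
have cth : continuous th.
  by move=> s; apply: is_derive_continuousR; have := dP s => ?; apply: is_derive_eq.
have ccos : continuous (fun s => cos (th s)).
  by move=> s; apply: continuous_comp; [exact: cth|exact: continuous_cos].
have csin : continuous (fun s => sin (th s)).
  by move=> s; apply: continuous_comp; [exact: cth|exact: continuous_sin].
pose a s := v.1 * potx A (ln s) + v.2 * poty A (ln s).
have dth (s : R) : is_derive s 1 th (a s).
  by have := dP s => ?; apply: is_derive_eq; rewrite subr0.
have dcos (s : R) : is_derive s 1 (fun s => cos (th s)) (- sin (th s) * a s).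
  by apply: is_derive1_comp; exact: dth.
have dsin (s : R) : is_derive s 1 (fun s => sin (th s)) (cos (th s) * a s).
  by apply: is_derive1_comp; exact: dth.
have [_ _ _ /(_ v.1 v.2) dw1] := h1; have [_ _ _ /(_ v.1 v.2) dw2] := h2.
pose g1 s := cos (th s) * w1 (ln s) - sin (th s) * w2 (ln s).
pose g2 s := sin (th s) * w1 (ln s) + cos (th s) * w2 (ln s).
pose g1' s := cos (th s) * c1 (ln s) - sin (th s) * c2 (ln s).
pose g2' s := sin (th s) * c1 (ln s) + cos (th s) * c2 (ln s).
have dg1 (s : R) : is_derive s 1 g1 (g1' s).
  have e1 := hder_line p s dw1; have e2 := hder_line p s dw2.
  have := dcos s => e3; have := dsin s => e4.
  apply: is_derive_eq; rewrite /g1' /c1 /c2 /a /GRing.scale /=; rewrite -/(ln s).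
  by move: (cos (th s)) (sin (th s)) (w1 _) (w2 _) (w1X _) (w1Y _) (w2X _) (w2Y _) (potx _ _) (poty _ _) => *; ring.
have dg2 (s : R) : is_derive s 1 g2 (g2' s).
  have e1 := hder_line p s dw1; have e2 := hder_line p s dw2.
  have := dcos s => e3; have := dsin s => e4.
  apply: is_derive_eq; rewrite /g2' /c1 /c2 /a /GRing.scale /=; rewrite -/(ln s).
  by move: (cos (th s)) (sin (th s)) (w1 _) (w2 _) (w1X _) (w1Y _) (w2X _) (w2Y _) (potx _ _) (poty _ _) => *; ring.
have cg1 : continuous g1' by apply: ctD; [|apply: ctN]; apply: ctM => //; exact: cline.
have cg2 : continuous g2' by apply: ctD; apply: ctM => //; exact: cline.
have i1 := sq_increment_le dg1 cg1; have i2 := sq_increment_le dg2 cg2.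
have th0 : th 0 = 0 by rewrite /th subrr.
have E1 : g1 1 - g1 0 = cos t * w1 q - sin t * w2 q - w1 p.
  by rewrite /g1 th0 cos0 sin0 mul1r mul0r subr0 /ln hmul_hor0.
have E2 : g2 1 - g2 0 = sin t * w1 q + cos t * w2 q - w2 p.
  by rewrite /g2 th0 cos0 sin0 mul1r mul0r add0r /ln hmul_hor0.
rewrite E1 in i1; rewrite E2 in i2.
rewrite EFinD; apply: le_trans (leeD i1 i2) _.
have sv0 : 0 <= sqn v by rewrite addr_ge0// sqr_ge0.
rewrite -(ge0_line_intZ v p sv0 cd d0).
have mi : measurable (`[0%R, 1%R]%classic : set RM) by exact: measurable_itv.
have ig1 : lam.-integrable `[0%R, 1%R] (EFin \o (fun s => g1' s ^+ 2)) by apply: integrable01; exact: ctX.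
have ig2 : lam.-integrable `[0%R, 1%R] (EFin \o (fun s => g2' s ^+ 2)) by apply: integrable01; exact: ctX.
rewrite -(integralD_EFin mi ig1 ig2).
apply: le_integral.
- exact: measurable_itv.
- by apply: (@integrable01 _ (fun s => g1' s ^+ 2 + g2' s ^+ 2)); apply: ctD; exact: ctX.
- by apply: (@integrable01 _ (fun s => sqn v * d (ln s))); apply: ctM; [exact: ct_cst|exact: cline].
move=> s _; rewrite lee_fin.
have -> : g1' s ^+ 2 + g2' s ^+ 2 = (cos (th s) ^+ 2 + sin (th s) ^+ 2) * (c1 (ln s) ^+ 2 + c2 (ln s) ^+ 2).
  by rewrite /g1' /g2'; ring.
rewrite cos2Dsin2 mul1r dE /c1 /c2 /sqn -/(ln s).
set X1 := w1X _ - _; set X2 := w2X _ + _; set Y1 := w1Y _ - _; set Y2 := w2Y _ + _.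
have := sqr_ge0 (v.1 * Y1 - v.2 * X1); have := sqr_ge0 (v.1 * Y2 - v.2 * X2).
by move: X1 X2 Y1 Y2 v.1 v.2 => X1 X2 Y1 Y2 v1 v2; lra.
Qed.

(** The factors 2 come from |a + b|^2 <= 2 |a|^2 + 2 |b|^2, used once per segment. *)
Fixpoint path_cst l : R := if l is v :: l' then 2 * sqn v + 2 * path_cst l' else 0.

Lemma path_cst_ge0 l : 0 <= path_cst l.
Proof. by elim: l => //= v l IH; rewrite addr_ge0// mulr_ge0// addr_ge0// sqr_ge0. Qed.

Lemma phase_path A w1 w2 f d l p th : magnetic_pair A w1 w2 f d -> phase A l p th ->
  (((cos th * w1 (pend l p) - sin th * w2 (pend l p) - w1 p) ^+ 2 +
   (sin th * w1 (pend l p) + cos th * w2 (pend l p) - w2 p) ^+ 2)%:E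
   <= (path_cst l)%:E * cost d l p)%E.
Proof.
move=> hm; have [_ cd _ d0 _] := magnetic_transportable hm.
elim: l p th => [|v l IH] p th /=.
  move=> ->; rewrite cos0 sin0 !mul1r !mul0r subr0 add0r !subrr expr0n /= addr0 mul0e.
  by rewrite lexx.
move=> [Phi [th' [dP ph ->]]].
have h1 := phase_segment hm dP; have h2 := IH _ _ ph.
move: h1 h2; set t := Phi 1 - Phi 0; set q := step p v.
rewrite cosD sinD -/(pend l q).
have li0 := line_int_ge0 v p d0; have lc0 := cost_ge0 l q d0.
have sv0 : 0 <= sqn v by rewrite addr_ge0// sqr_ge0.
have pc0 := path_cst_ge0 l.
move: (w1 (pend l q)) (w2 (pend l q)) (w1 q) (w2 q) (w1 p) (w2 p) => e1 e2 q1 q2 p1 p2 h1 h2.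
apply: (@le_trans _ _ ((2 * ((cos t * q1 - sin t * q2 - p1) ^+ 2 + (sin t * q1 + cos t * q2 - p2) ^+ 2))%:E +
  (2 * ((cos th' * e1 - sin th' * e2 - q1) ^+ 2 + (sin th' * e1 + cos th' * e2 - q2) ^+ 2))%:E)%E).
  rewrite -EFinD lee_fin.
  set a1 := _ - q1; set a2 := _ - q2.
  set b1 := cos t * q1 - sin t * q2 - p1; set b2 := sin t * q1 + cos t * q2 - p2.
  have -> : (cos t * cos th' - sin t * sin th') * e1 - (sin t * cos th' + cos t * sin th') * e2 - p1 =
     b1 + (cos t * a1 - sin t * a2) by rewrite /a1 /a2 /b1; ring.
  have -> : (sin t * cos th' + cos t * sin th') * e1 + (cos t * cos th' - sin t * sin th') * e2 - p2 =
     b2 + (sin t * a1 + cos t * a2) by rewrite /a1 /a2 /b2; ring.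
  (* Transport over the first segment is a rotation, so it preserves the size of the error made on
     the remaining ones. *)
  have -> : a1 ^+ 2 + a2 ^+ 2 = (cos t * a1 - sin t * a2) ^+ 2 + (sin t * a1 + cos t * a2) ^+ 2.
    rewrite -[LHS]mul1r -(cos2Dsin2 t); ring.
  move: (cos t * a1 - _) (sin t * a1 + _) => c1 c2.
  have := sqr_ge0 (b1 - c1); have := sqr_ge0 (b2 - c2); lra.
have dbl (X S : R) (L : \bar R) : 0 <= X -> (X%:E <= S%:E * L)%E -> ((2 * X)%:E <= (2 * S)%:E * L)%E.
  by move=> X0 h; rewrite !EFinM -muleA; apply: lee_pmul.
apply: (@le_trans _ _ ((2 * sqn v)%:E * line_int v d p + (2 * path_cst l)%:E * cost d l q)%E).
  by apply: leeD; apply: dbl => //; rewrite addr_ge0// sqr_ge0.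
rewrite [X in (_ <= X)%E](ge0_muleDr _ li0 lc0); apply: leeD; apply: lee_wpmul2r => //; rewrite lee_fin.
  by rewrite lerDl mulr_ge0.
by rewrite lerDr mulr_ge0.
Qed.

(** [2 - 2 * cos th] is |exp(i th) - 1|^2, the relative defect of w(p) after transport around a
    closed path. *)
Definition loop_prop A (G : set H) l (k : R) := forall p, G p ->
  exists th, phase A l p th /\ k <= 2 - 2 * cos th.

Lemma loop_bound A w1 w2 f d G l k p : magnetic_pair A w1 w2 f d -> loop_prop A G l k ->
  (forall p, pend l p = p) -> G p -> ((k * f p)%:E <= (path_cst l)%:E * cost d l p)%E.
Proof.
move=> hm hl cl Gp; have [th [ph kth]] := hl p Gp.
have := phase_path hm ph; rewrite cl; apply: le_trans; rewrite lee_fin.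
have [w1X [w1Y [w2X [w2Y [_ _ _ -> _]]]]] := hm.
have cs := cos2Dsin2 th.
have -> : (cos th * w1 p - sin th * w2 p - w1 p) ^+ 2 + (sin th * w1 p + cos th * w2 p - w2 p) ^+ 2 =
  (2 - 2 * cos th) * (w1 p ^+ 2 + w2 p ^+ 2).
  transitivity ((cos th ^+ 2 + sin th ^+ 2 + 1 - 2 * cos th) * (w1 p ^+ 2 + w2 p ^+ 2)); first ring.
  by rewrite cs; ring.
by rewrite ler_wpM2r// addr_ge0// sqr_ge0.
Qed.

Section Good.
Variable P : (H -> R) -> (H -> R) -> Prop.
Hypothesis PT : forall f d, P f d -> transportable f d.

(** The constants precede the pair [f], [d]; this uniformity over [P] is what leaves the final
    constant independent of the choice of A. *)
Definition good (E : set MH) := measurable E /\ exists C M, [/\ 0 <= C, E `<=` box M &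
  forall f d, P f d -> (\int[mu3]_(p in E) (f p)%:E <= C%:E * \int[mu3]_(p in box M) (d p)%:E)%E].

Lemma int_box_ge0 (M : R) d : (forall p, 0 <= d p) -> (0 <= \int[mu3]_(p in box M) (d p)%:E)%E.
Proof. by move=> d0; apply: integral_ge0 => p _; rewrite lee_fin. Qed.

Lemma int_box_le (M N : R) d : continuous d -> (forall p, 0 <= d p) -> M <= N ->
  (\int[mu3]_(p in box M) (d p)%:E <= \int[mu3]_(p in box N) (d p)%:E)%E.
Proof.
move=> cd d0 MN; apply: ge0_subset_int.
- exact: measurable_box.
- exact: measurable_box.
- exact: box_le.
- by apply/measurable_EFinP; exact: continuous_measurable_heis.
- by move=> p; rewrite lee_fin.
Qed.

Lemma good_subset E E' : measurable E' -> E' `<=` E -> good E -> good E'.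
Proof.
move=> mE' sE [mE [C [M [C0 EM h]]]]; split => //; exists C, M; split => //.
  exact: subset_trans EM.
move=> f d Pfd; have [cf cd f0 d0 _] := PT Pfd; apply: le_trans (h _ _ Pfd).
apply: ge0_subset_int => //.
by apply/measurable_EFinP; exact: continuous_measurable_heis.
Qed.

Lemma good0 : good set0.
Proof.
split; first exact: measurable0.
exists 0, 0; split => // f d Pfd; by rewrite integral_set0 mul0e.
Qed.

Lemma goodU E E' : good E -> good E' -> good (E `|` E').
Proof.
move=> [mE [C [M [C0 EM h]]]] [mE' [C' [M' [C0' EM' h']]]]; split; first exact: measurableU.
exists (C + C'), (Num.max M M'); split.
- exact: addr_ge0.
- move=> p [/EM|/EM']; apply: box_le; by rewrite le_max lexx ?orbT.
move=> f d Pfd; have [cf cd f0 d0 _] := PT Pfd.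
have mf : measurable_fun (setT : set MH) (EFin \o f).
  by apply/measurable_EFinP; exact: continuous_measurable_heis.
have f0' p : (0 <= (EFin \o f) p)%E by rewrite lee_fin.
have mr (B : set MH) : measurable B -> measurable_fun (setT : set MH) ((EFin \o f) \_ B).
  by move=> mB; apply/(measurable_restrictT _ _).1 => //; exact: measurable_funTS.
have r0 (B : set MH) p : (0 <= ((EFin \o f) \_ B) p)%E by rewrite patchE; case: ifP.
apply: (@le_trans _ _ (\int[mu3]_(p in E) (f p)%:E + \int[mu3]_(p in E') (f p)%:E)%E).
  rewrite integral_mkcond [X in (_ <= X + _)%E]integral_mkcond [X in (_ <= _ + X)%E]integral_mkcond.
  rewrite -ge0_integralD//; [|exact: mr|exact: mr].
  apply: ge0_le_integral => //.
  - by apply: mr; exact: measurableU.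
  - by apply: emeasurable_funD; exact: mr.
  move=> p _; rewrite !patchE in_setU; have := f0' p => /=.
  by case: (p \in E); case: (p \in E') => //= fp; rewrite ?adde0 ?add0e// leeDl.
have I0 M0 := int_box_ge0 M0 d0.
rewrite EFinD ge0_muleDl//; apply: leeD.
  apply: le_trans (h _ _ Pfd) _; apply: lee_pmul => //.
  by apply: int_box_le => //; rewrite le_max lexx.
apply: le_trans (h' _ _ Pfd) _; apply: lee_pmul => //.
by apply: int_box_le => //; rewrite le_max lexx orbT.
Qed.

Lemma good_bigcup (I : eqType) (s : seq I) (F : I -> set MH) :
  (forall i, i \in s -> good (F i)) -> good (\big[setU/set0]_(i <- s) F i).
Proof.
elim: s => [|i s IH] gF; first by rewrite big_nil; exact: good0.
rewrite big_cons; apply: goodU; first by apply: gF; rewrite mem_head.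
by apply: IH => j js; apply: gF; rewrite in_cons js orbT.
Qed.

(** Integrate the inequality of [transportable] over the preimage: by invariance the endpoint term
    becomes the integral over E, and [line_int_box] bounds the other. *)
Lemma good_step E v : good E -> good [set p : MH | E (step p v)].
Proof.
move=> [mE [C [M [C0 EM h]]]].
have mE' := measurable_preimage_hmul (hor v.1 v.2 1) mE.
split; first exact: mE'.
have [h1 hh1] := hor_box (- v.1, - v.2).
have [N hN] := hmul_box M h1.
have bE : [set p : MH | E (step p v)] `<=` box N.
  move=> p /= /EM bp.
  have -> : p = hmul (step p v) (hor (- v.1) (- v.2) 1).
    rewrite /step -[LHS](hmul_hor0 p v.1 v.2).
    have -> : hor (- v.1) (- v.2) 1 = hor v.1 v.2 (-1).
      by rewrite /hor; congr (_, _, _); rewrite !mul1r mulN1r.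
    by rewrite hmul_hor subrr.
  by apply: hN => //; apply: (hh1 1); rewrite in_itv /= ler01 lexx.
have [N1 hN1] := line_int_box v N.
exists (expR 1 * C + expR 1 * sqn v), (Num.max N (Num.max M N1)).
have sv0 : 0 <= sqn v by rewrite addr_ge0// sqr_ge0.
have e0 : 0 <= expR 1 :> R by exact: expR_ge0.
split.
- by rewrite addr_ge0// mulr_ge0.
- by apply: subset_trans bE _; apply: box_le; rewrite le_max lexx.
move=> f d Pfd; have [cf cd f0 d0 tr] := PT Pfd.
have mf : measurable_fun (setT : set MH) (EFin \o f).
  by apply/measurable_EFinP; exact: continuous_measurable_heis.
have mfs : measurable_fun (setT : set MH) (fun p => (f (step p v))%:E).
  exact: (measurableT_comp mf (measurable_step v)).
have ml := measurable_line_int v cd d0.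
have l0 p := line_int_ge0 v p d0.
have ms : measurable_fun (setT : set MH) (fun p => (expR 1)%:E * (f (step p v))%:E)%E.
  exact: measurable_funeM.
have mls : measurable_fun (setT : set MH) (fun p => (expR 1 * sqn v)%:E * line_int v d p)%E.
  exact: measurable_funeM.
have es0 : (0 <= (expR 1 * sqn v)%:E :> \bar R)%E by rewrite lee_fin mulr_ge0.
apply: (@le_trans _ _ (\int[mu3]_(p in [set p : MH | E (step p v)])
   ((expR 1)%:E * (f (step p v))%:E + (expR 1 * sqn v)%:E * line_int v d p))%E).
  apply: ge0_le_integral => //.
  - by move=> p _; rewrite lee_fin.
  - exact: measurable_funTS.
  - by apply: measurable_funTS; exact: emeasurable_funD.
  by move=> p _; rewrite -EFinM; exact: tr.
rewrite ge0_integralD//; last 4 first.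
- by move=> p _; rewrite -EFinM lee_fin mulr_ge0.
- exact: measurable_funTS.
- by move=> p _; exact: mule_ge0.
- exact: measurable_funTS.
have nn p : [set p : MH | E (step p v)] p -> (0 <= (f (step p v))%:E)%E by rewrite lee_fin.
have e0' : (0 <= (expR 1)%:E :> \bar R)%E by rewrite lee_fin.
rewrite (ge0_integralZl mu3 mE' (measurable_funTS mfs) nn e0').
rewrite (ge0_integralZl mu3 mE' (measurable_funTS ml) (fun p _ => l0 p) es0).
have I0 M0 := int_box_ge0 M0 d0.
rewrite EFinD ge0_muleDl//; last by rewrite lee_fin mulr_ge0.
apply: leeD.
  rewrite [in leRHS]EFinM -muleA; apply: lee_pmul => //.
  - by apply: integral_ge0 => p _; rewrite lee_fin.
  rewrite (@integral_preimage R E (hor v.1 v.2 1) (EFin \o f)) //.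
  apply: le_trans (h _ _ Pfd) _; apply: lee_pmul => //.
  by apply: int_box_le => //; rewrite !le_max lexx orbT.
apply: lee_pmul => //; first by apply: integral_ge0 => p _.
apply: (@le_trans _ _ (\int[mu3]_(p in box N) line_int v d p)%E).
  by apply: ge0_subset_int => //; exact: measurable_box.
apply: le_trans (hN1 d cd d0) _.
by apply: int_box_le => //; rewrite !le_max lexx !orbT.
Qed.

Lemma good_pend E l : good E -> good [set p : MH | E (pend l p)].
Proof.
move=> gE; elim: l => [|v l IH] //=.
exact: (good_step v IH).
Qed.

Lemma step_continuous v : continuous (fun p : H => step p v).
Proof.
have hx := @cx_continuous R; have hy := @cy_continuous R; have hz := @cz_continuous R.
rewrite /step /hmul; apply: ct_pair; first by apply: ct_pair; (apply: ctD => //; exact: ct_cst).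
apply: ctD; first by apply: ctD => //; exact: ct_cst.
apply: ctM; last exact: ct_cst.
by apply: ctD; [|apply: ctN]; (apply: ctM => //; exact: ct_cst).
Qed.

Lemma pend_continuous l : continuous (pend l).
Proof.
elim: l => [|v l IH]; first by move=> p; exact: cvg_id.
have -> : pend (v :: l) = pend l \o (fun p => step p v) by [].
by move=> p; apply: continuous_comp; [exact: step_continuous|exact: IH].
Qed.

(** Chow's theorem made explicit: one segment corrects x and y, then a rectangle with sides 1 and c,
    being the lift of a closed curve of area c, raises z by c. *)
Lemma pend_transitive p q : exists l, pend l p = q.
Proof.
move: p q => [[x y] z] [[x' y'] z'].
pose a := x' - x; pose b := y' - y; pose c := z' - (z + (x * b - y * a) / 2).
exists [:: (a, b); (1, 0); (0, c); (-1, 0); (0, - c)].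
rewrite /= /step /hmul /hor /cx /cy /cz /= /c /a /b.
by congr (_, _, _); field.
Qed.

Lemma good_box G (q0 : H) (M : R) : open G -> G q0 -> good G -> good (box M).
Proof.
move=> oG Gq gG.
have oF l : open [set p : H | G (pend l p)].
  by move/continuousP : (@pend_continuous l) => /(_ _ oG).
(* finite subcovers are obtained along the filter of finite sets of paths ordered by inclusion *)
pose F : set_system (seq (seq (R * R))) := filter_from setT
  (fun s0 : seq (seq (R * R)) => [set s : seq (seq (R * R)) | {subset s0 <= s}]).
have FF : Filter F.
  apply: filter_from_filter; first by exists [::].
  move=> s1 s2 _ _; exists (s1 ++ s2) => // s /= h.
  by split=> /= l ls; apply: h; rewrite mem_cat ls ?orbT.
have := (compact_near_coveringP (box M : set H)).1 (@compact_box R M).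
move=> /(_ _ F (fun s p => exists2 l, l \in s & G (pend l p)) FF) [|s0 _ /(_ s0 (fun _ h => h)) cov].
  move=> p _; have [l lE] := pend_transitive p q0.
  exists ([set p | G (pend l p)], [set s : seq (seq (R * R)) | {subset [:: l] <= s}]) => /=.
    split; last by exists [:: l].
    by apply: open_nbhs_nbhs; split => //=; rewrite lE.
  by move=> [p' s] /= [Gp' sl]; exists l => //; apply: sl; rewrite mem_seq1.
apply: (@good_subset (\big[setU/set0]_(l <- s0) [set p : MH | G (pend l p)])).
- exact: measurable_box.
- by move=> p /cov [l lD lp]; rewrite -bigcup_seq; exists l.
- by apply: good_bigcup => l _; exact: good_pend.
Qed.

End Good.

Definition loop_pair G l k f d := exists A w1 w2, magnetic_pair A w1 w2 f d /\ loop_prop A G l k.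

Lemma loop_good (G : set MH) l k M : measurable G -> G `<=` box M -> 0 < k ->
  (forall p : H, pend l p = p) -> good (loop_pair G l k) G.
Proof.
move=> mG GM k0 cl; split => //.
have [N hN] := cost_box l M.
have pc0 := path_cst_ge0 l.
exists (k^-1 * path_cst l * (size l)%:R), (Num.max M N); split.
- by rewrite !mulr_ge0// invr_ge0 ltW.
- by apply: subset_trans GM _; apply: box_le; rewrite le_max lexx.
move=> f d [A [w1 [w2 [hm hl]]]]; have [cf cd f0 d0 _] := magnetic_transportable hm.
have mf : measurable_fun (setT : set MH) (EFin \o f).
  by apply/measurable_EFinP; exact: continuous_measurable_heis.
have mc := measurable_cost l cd d0.
have c0 p := cost_ge0 l p d0.
have kp0 : (0 <= (k^-1 * path_cst l)%:E :> \bar R)%E by rewrite lee_fin mulr_ge0// invr_ge0 ltW.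
apply: (@le_trans _ _ (\int[mu3]_(p in box M) ((k^-1 * path_cst l)%:E * cost d l p))%E).
  apply: (@le_trans _ _ (\int[mu3]_(p in G) ((k^-1 * path_cst l)%:E * cost d l p))%E).
    apply: ge0_le_integral => //.
    - by move=> p _; rewrite lee_fin.
    - exact: measurable_funTS.
    - by apply: measurable_funTS; exact: measurable_funeM.
    move=> p Gp; have := loop_bound hm hl cl Gp => h.
    have ki0 : (0 <= (k^-1)%:E :> \bar R)%E by rewrite lee_fin invr_ge0 ltW.
    have := lee_wpmul2l ki0 h; rewrite -EFinM mulrA mulVf ?gt_eqF// mul1r muleA -EFinM.
    exact.
  apply: ge0_subset_int => //; first exact: measurable_box.
    exact: measurable_funeM.
  by move=> p; exact: mule_ge0.
rewrite ge0_integralZl//; [|exact: measurable_box|exact: measurable_funTS].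
rewrite [in leRHS]EFinM -muleA; apply: lee_pmul => //; first by apply: integral_ge0 => p _.
apply: le_trans (hN d cd d0) _; apply: lee_pmul => //; first exact: int_box_ge0.
by apply: int_box_le => //; rewrite le_max lexx orbT.
Qed.

(* The constants do not depend on the potential, only on the loop and on the lower bound k for its holonomy. *)
Theorem magnetic_poincare (G : set H) (q0 : H) l k M : open G -> G q0 -> G `<=` box M -> 0 < k ->
  (forall p : H, pend l p = p) ->
  forall K, good (loop_pair G l k) (box K).
Proof.
move=> oG Gq GM k0 cl K; apply: (@good_box (loop_pair G l k) _ G q0) => //.
- by move=> f d [A [w1 [w2 [hm _]]]]; exact: magnetic_transportable hm.
- by apply: loop_good => //; [exact: open_measurable_heis|exact: GM].
Qed.

End Poincare.

(** * Remainder of the Hardy inequality *)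

Import ComplexField.Normc.

Section Main.
Variable R : realType.
Local Notation H := (heis R).
Local Notation RM := (measurableTypeR R).
Local Notation MH := (RM * RM * RM)%type.
Local Notation mu3 := (@lebesgue3 R).
Implicit Types (f d : H -> R) (p q : H) (l : seq (R * R)) (A : potential R).

Lemma le_int_box f (K : R) : ccont f -> (forall p, ~ box K p -> 0 <= f p) ->
  (\int[mu3]_(p in box K) (f p)%:E <= (I3 f)%:E)%E.
Proof.
move=> cf f0; have mK := @measurable_box R K.
rewrite -I3E// [leLHS]integral_mkcond; apply: le_integral => //.
- by apply/(integrable_mkcond _ mK); apply: integrable_box; case: cf.
- exact: ccont_integrable.
move=> p _ /=; rewrite patchE; case: ifPn => //= /negP np; rewrite lee_fin; apply: f0 => bp.
by apply: np; exact: mem_set.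
Qed.

Lemma I3Z f (k : R) : ccont f -> I3 (fun p => k * f p) = k * I3 f.
Proof.
move=> cf; have ckf : ccont (fun p => k * f p) by apply: ccontM => //; exact: ct_cst.
have : (\int[mu3]_p (k * f p)%:E = (k * I3 f)%:E)%E.
  under eq_integral do rewrite EFinM.
  rewrite EFinM -(I3E cf).
  by rewrite (integralZl measurableT (ccont_integrable cf)).
by rewrite (I3E ckf) => -[].
Qed.

(** With J the integral of |u|^2 over the box, F that of |w|^2 and Q the remainder, this solves J /
    4 <= Q + 5 F and F <= C L Q for J. *)
Definition hc (C L : R) : R := 4^-1 / (1 + 5 * C * L).

Lemma gN_le_box p K : gN p <= 1 -> 1 <= K -> box K p.
Proof.
rewrite /gN /sqr => h K1.
have x0 := sqr_ge0 (cx p); have y0 := sqr_ge0 (cy p); have z0 := sqr_ge0 (cz p).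
have s1 : cx p ^+ 2 + cy p ^+ 2 <= 1.
  rewrite -(@ler_pXn2r _ 2) ?nnegrE ?addr_ge0// expr1n.
  by apply: le_trans h; rewrite lerDl mulr_ge0.
have sq0 : 0 <= (cx p ^+ 2 + cy p ^+ 2) ^+ 2 by exact: sqr_ge0.
have n1 (x : R) : x ^+ 2 <= 1 -> `|x| <= K.
  move=> x1; apply: le_trans K1; rewrite -(@ler_pXn2r _ 2) ?nnegrE// expr1n real_normK ?num_real//.
by split; apply: n1; lra.
Qed.

Lemma gL_box e p M : e <= 1 -> box M p ->
  gL e p <= Num.sqrt ((2 * M ^+ 2) ^+ 2 + 16 * M ^+ 2 + 1).
Proof.
move=> e1 [px py pz].
have sqb (x : R) : `|x| <= M -> x ^+ 2 <= M ^+ 2.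
  by move=> xM; rewrite -[x ^+ 2]real_normK ?num_real// lerXn2r ?nnegrE//; exact: le_trans xM.
have hx := sqb _ px; have hy := sqb _ py; have hz := sqb _ pz.
rewrite /gL ler_wsqrtr// /gM /gN; apply: lerD => //; apply: lerD; last by rewrite ler_wpM2l.
have h : sqr p <= 2 * M ^+ 2 by rewrite /sqr; lra.
have s0 := sqr_ge0' p; by rewrite -subr_ge0 subr_sqr mulr_ge0//; lra.
Qed.

Lemma main_ineq A (u1 u1X u1Y u2 u2X u2Y : H -> R) G l k (C K M e : R) :
  hC1 u1 u1X u1Y -> hC1 u2 u2X u2Y -> ccont u1 -> ccont u2 ->
  ccont (fun p => u1X p - potx A p * u2 p) -> ccont (fun p => u2X p + potx A p * u1 p) ->
  ccont (fun p => u1Y p - poty A p * u2 p) -> ccont (fun p => u2Y p + poty A p * u1 p) ->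
  loop_prop A G l k -> 0 <= C -> 1 <= K ->
  (forall f d, loop_pair G l k f d ->
    (\int[mu3]_(p in box K) (f p)%:E <= C%:E * \int[mu3]_(p in box M) (d p)%:E)%E) ->
  0 < e -> e <= 1 ->
  (\int[mu3]_p (sqr p / gM e p * (u1 p ^+ 2 + u2 p ^+ 2))%:E +
    (hc C (Num.sqrt ((2 * M ^+ 2) ^+ 2 + 16 * M ^+ 2 + 1)))%:E *
      \int[mu3]_(p in box K) (u1 p ^+ 2 + u2 p ^+ 2)%:E <=
   \int[mu3]_p ((u1X p - potx A p * u2 p) ^+ 2 + (u2X p + potx A p * u1 p) ^+ 2 +
     ((u1Y p - poty A p * u2 p) ^+ 2 + (u2Y p + poty A p * u1 p) ^+ 2))%:E)%E.
Proof.
move=> h1 h2 s1 s2 sc1 sc2 sc3 sc4 hl C0 K1 poin e0 e1.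
set c1 := fun p => u1X p - _ in sc1 *; set c2 := fun p => u2X p + _ in sc2 *.
set c3 := fun p => u1Y p - _ in sc3 *; set c4 := fun p => u2Y p + _ in sc4 *.
have cX p : u1 p * c1 p + u2 p * c2 p = u1 p * u1X p + u2 p * u2X p by rewrite /c1 /c2; ring.
have cY p : u1 p * c3 p + u2 p * c4 p = u1 p * u1Y p + u2 p * u2Y p by rewrite /c3 /c4; ring.
have [g1 hV1] := hC1_V1 e0; have [g2 hV2] := hC1_V2 e0.
have [g3 hW1] := hC1_W1 e0; have [g4 hW2] := hC1_W2 e0.
have I1 := ground_state_identity h1 h2 s1 s2 sc1 sc2 sc3 sc4 cX cY hV1 hV2.
have I2 := ground_state_identity h1 h2 s1 s2 sc1 sc2 sc3 sc4 cX cY (hC1D hV1 hW1) (hC1D hV2 hW2).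
have sq f : ccont f -> ccont (fun p => f p ^+ 2).
  move=> cf; have -> : (fun p => f p ^+ 2) = (fun p => f p * f p) by apply/funext => p; rewrite expr2.
  by apply: ccontM => //; case: cf.
pose s p := u1 p ^+ 2 + u2 p ^+ 2.
have ss : ccont s by apply: ccontD; exact: sq.
have s0 p : 0 <= s p by rewrite addr_ge0// sqr_ge0.
have [cV1 cV1X _ _] := hV1; have [cV2 _ cV2Y _] := hV2.
have [cW1 cW1X _ _] := hW1; have [cW2 _ cW2Y _] := hW2.
have [cu1 cu2] := (s1.1, s2.1).
pose D p := c1 p ^+ 2 + c2 p ^+ 2 + (c3 p ^+ 2 + c4 p ^+ 2).
have sD : ccont D by repeat apply: ccontD; exact: sq.
pose P p := (c1 p + V1 e p * u1 p) ^+ 2 + (c2 p + V1 e p * u2 p) ^+ 2 +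
   ((c3 p + V2 e p * u1 p) ^+ 2 + (c4 p + V2 e p * u2 p) ^+ 2).
have sP : ccont P by repeat apply: ccontD; apply: sq; apply: ccontD => //; exact: ccontM.
have P0 p : 0 <= P p by rewrite !addr_ge0// sqr_ge0.
pose pot p := V1X e p + V2Y e p - (V1 e p ^+ 2 + V2 e p ^+ 2).
have cpot : continuous pot by rewrite /pot; cont.
have cpotW : continuous (potW e) by rewrite /potW; cont.
have [cL _ _ _] := hC1_gL e0.
have [cM _ _ _] := hC1_gM e.
have cMi : continuous (fun p => (gM e p)^-1) by apply: ctV => // p; exact: gM_neq0.
have cs : continuous (@sqr R) by case: (hC1_sqr R).
have cS : ccont (fun p => sqr p / gM e p * s p) by apply: ccontM => //; exact: ctM.
set Q := I3 P.
have hI1 : I3 (fun p => sqr p / gM e p * s p) + Q <= I3 D.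
  rewrite [X in _ <= X]I1 -/Q addrC lerD2l; apply: I3_le => //; first exact: ccontM.
  by move=> p; apply: ler_wpM2r => //; exact: hardy_potential.
(* The identities for V and V + W have the same left side; the square for V + W is dropped, and what
   remains is compared with Q. *)
have hI2 : I3 (fun p => potW e p * s p) <= Q.
  have : I3 D >= I3 (fun p => (pot p + potW e p) * s p).
    rewrite [X in _ <= X]I2.
    set Y := I3 (fun p => (_ - _) * _).
    have -> : I3 (fun p => (pot p + potW e p) * s p) = Y.
      congr I3; apply/funext => p; congr (_ * _); rewrite /pot /potW; ring.
    rewrite lerDr; apply: fine_ge0; apply: integral_ge0 => p _.
    by rewrite lee_fin !addr_ge0// sqr_ge0.
  rewrite [X in _ <= X -> _]I1 -/Q -/pot.
  have -> : I3 (fun p => (pot p + potW e p) * s p) = I3 (fun p => pot p * s p) + I3 (fun p => potW e p * s p).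
    rewrite -I3D; [|exact: ccontM|exact: ccontM].
    by congr I3; apply/funext => p; rewrite mulrDl.
  by rewrite addrC lerD2r.
set LM := Num.sqrt _.
have LM0 : 0 <= LM by exact: sqrtr_ge0.
pose w1 p := gm e p * u1 p; pose w2 p := gm e p * u2 p.
have hw1 := hC1M (hC1_gm e0) h1; have hw2 := hC1M (hC1_gm e0) h2.
pose f p := gL e p * s p; pose d p := gL e p * P p.
have cgm : continuous (gm e) by case: (hC1_gm e0).
have Lp p : 0 < gL e p by exact: gL_gt0.
(* Since grad_H [gm] = [gm] V, the covariant gradient of w is [gm] times the one shifted by V; its
   square is [gL] times [P]. *)
have pair : magnetic_pair A w1 w2 f d.
  do 4 eexists; split; [exact: hw1|exact: hw2| | |].
  - have cc (v : H -> R) (c u : H -> R) : ccont c -> continuous u -> continuous v ->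
      continuous (fun p => gm e p * (c p + v p * u p)).
      by move=> [cc _] cu cv; apply: ctM => //; apply: ctD => //; exact: ctM.
    split.
    + have -> // : (fun p => gm e p * V1 e p * u1 p + gm e p * u1X p - potx A p * w2 p) =
        (fun p => gm e p * (c1 p + V1 e p * u1 p)).
        by apply/funext => p; rewrite /w2 /c1; ring.
      exact: cc.
    + have -> // : (fun p => gm e p * V1 e p * u2 p + gm e p * u2X p + potx A p * w1 p) =
        (fun p => gm e p * (c2 p + V1 e p * u2 p)).
        by apply/funext => p; rewrite /w1 /c2; ring.
      exact: cc.
    + have -> // : (fun p => gm e p * V2 e p * u1 p + gm e p * u1Y p - poty A p * w2 p) =
        (fun p => gm e p * (c3 p + V2 e p * u1 p)).
        by apply/funext => p; rewrite /w2 /c3; ring.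
      exact: cc.
    + have -> // : (fun p => gm e p * V2 e p * u2 p + gm e p * u2Y p + poty A p * w1 p) =
        (fun p => gm e p * (c4 p + V2 e p * u2 p)).
        by apply/funext => p; rewrite /w1 /c4; ring.
      exact: cc.
  - by apply/funext => p; rewrite /f /s /w1 /w2 -(gm_sq e0); ring.
  - apply/funext => p; rewrite /d /P /w1 /w2 -(gm_sq e0) /c1 /c2 /c3 /c4.
    by move: (gm e p) (V1 e p) (V2 e p) (u1 p) (u2 p) (u1X p) (u2X p) (u1Y p) (u2Y p)
      (potx A p) (poty A p) => *; ring.
have cf : continuous f by apply: ctM => //; case: ss.
have cd : continuous d by apply: ctM => //; case: sP.
have mK := @measurable_box R K; have mM := @measurable_box R M.
have fin (h : H -> R) (B : R) : continuous h ->
    (\int[mu3]_(p in box B) (h p)%:E)%E = (fine (\int[mu3]_(p in box B) (h p)%:E)%E)%:E.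
  by move=> ch; rewrite fineK//; apply: (@integrable_fin_num _ _ _ _ _ (measurable_box B) _ (integrable_box B ch)).
have csc := ss.1.
pose J := fine (\int[mu3]_(p in box K) (s p)%:E)%E.
pose F := fine (\int[mu3]_(p in box K) (f p)%:E)%E.
have JE : (\int[mu3]_(p in box K) (s p)%:E)%E = J%:E by exact: fin.
have FE : (\int[mu3]_(p in box K) (f p)%:E)%E = F%:E by exact: fin.
have J0 : 0 <= J by apply: fine_ge0; apply: integral_ge0 => p _; rewrite lee_fin.
(* Poincaré for w; on the larger box the weight in [d] is at most [LM], uniformly for e <= 1. *)
have hF : F <= C * LM * Q.
  rewrite -lee_fin -FE; apply: le_trans (poin f d _) _; first by exists A, w1, w2.
  rewrite -mulrA EFinM; apply: lee_wpmul2l; first by rewrite lee_fin.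
  apply: (@le_trans _ _ (\int[mu3]_(p in box M) (LM * P p)%:E)%E).
    apply: le_integral => //.
    - exact: integrable_box.
    - by apply: (@integrable_box R (fun p => LM * P p)); apply: ctM; [exact: ct_cst|case: sP].
    move=> p; rewrite inE => bp; rewrite lee_fin ler_wpM2r//.
    exact: gL_box.
  have sLP : ccont (fun p => LM * P p) by apply: ccontM => //; exact: ct_cst.
  apply: le_trans (le_int_box sLP _) _; first by move=> p _; rewrite mulr_ge0.
  by rewrite (I3Z LM sP).
have hJ : 4^-1 * J <= Q + 5 * F.
  have sW : ccont (fun p => potW e p * s p) by exact: ccontM.
  have off p : ~ box K p -> 0 <= potW e p * s p.
    move=> np; rewrite potW0 ?mul0r// leNgt; apply/negP => N1; apply: np.
    exact: gN_le_box (ltW N1) K1.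
  have hW := le_int_box sW off; rewrite (fin _ K sW.1) lee_fin in hW.
  set B := fine _ in hW.
  have BE : (\int[mu3]_(p in box K) (potW e p * s p)%:E)%E = B%:E by exact: fin sW.1.
  apply: (@le_trans _ _ (B + 5 * F)); last by rewrite lerD2r; exact: le_trans hW hI2.
  have c5f : continuous (fun p => 5 * f p) by apply: ctM => //; exact: ct_cst.
  have c4s : continuous (fun p => 4^-1 * s p) by apply: ctM => //; exact: ct_cst.
  rewrite -lee_fin EFinM -JE EFinD EFinM -FE -BE.
  rewrite -(integralZl mK (integrable_box K csc)) -(integralZl mK (integrable_box K cf)).
  rewrite -(integralD_EFin mK (integrable_box K sW.1) (integrable_box K c5f)).
  apply: le_integral => //.
  - exact: (integrable_box K c4s).
  - apply: (@integrable_box R (fun p => potW e p * s p + 5 * f p)); apply: ctD => //; exact: sW.1.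
  move=> p _; rewrite -EFinM -EFinD lee_fin /f mulrA -mulrDl; apply: ler_wpM2r => //.
  (* Outside the unit gauge ball [potW] is 0 while [gL >= 1], so the claim 1/4 <= [potW] + 5 [gL]
     holds there too. *)
  have [N1|N1] := leP (gN p) 1; first by have := potW_ge e0 N1; lra.
  rewrite potW0 ?ltW// add0r.
  have : 1 <= gL e p.
    rewrite /gL -[leLHS]sqrtr1 ler_wsqrtr//; apply: (le_trans (ltW N1)).
    by rewrite /gM lerDl ltW.
  lra.
have key : hc C LM * J <= Q.
  have Q0 : 0 <= Q by apply: fine_ge0; apply: integral_ge0 => p _; rewrite lee_fin.
  have CL0 : 0 <= C * LM by exact: mulr_ge0.
  have d0 : 0 < 1 + 5 * C * LM by rewrite -mulrA; lra.
  rewrite /hc mulrAC ler_pdivrMr//; apply: le_trans hJ _; nra.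
rewrite JE (I3E cS) (I3E sD) -EFinM -EFinD lee_fin.
apply: le_trans hI1; by rewrite lerD2l.
Qed.

End Main.

(** * From a loop to the Hardy inequality for test functions *)

Section HardyFromLoop.
Variable R : realType.
Local Notation H := (heis R).
Local Notation RM := (measurableTypeR R).
Local Notation MH := (RM * RM * RM)%type.
Local Notation mu3 := (@lebesgue3 R).
Implicit Types (f d : H -> R) (p q : H) (l : seq (R * R)) (A : potential R) (U : set H).

Lemma compact_box_bound (K : set H) : compact K -> exists M, K `<=` box M.
Proof.
move=> /compact_bounded[M [_ hM]]; exists (M + 1) => p Kp.
have : `|p| <= M + 1 by apply: (hM (M + 1)); rewrite ?ltrDl.
by rewrite prod_normE prod_normE !ge_max => /andP[/andP[? ?] ?].
Qed.

(* the product extends by zero outside the support of g *)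
Lemma continuous_mul_supp U (a g : H -> R) (K : set H) : open U -> closed K -> K `<=` U ->
  {in U, continuous a} -> continuous g -> (forall p, ~ K p -> g p = 0) ->
  continuous (fun p => a p * g p).
Proof.
move=> oU cK KU ca cg gK p.
have [Kp|nKp] := pselect (K p).
  by apply: continuousM; [apply: ca; rewrite inE; exact: KU|exact: cg].
have nb : \forall q \near p, ~ K q.
  by apply: open_nbhs_nbhs; split; [exact: closed_openC|].
rewrite /continuous_at (gK p nKp) mulr0; apply: cvg_near_cst.
by near=> q; rewrite gK ?mulr0//; near: q.
Unshelve. all: by end_near. Qed.

Lemma hder_supp f f' a b (K : set H) : closed K -> hder a b f f' -> (forall p, ~ K p -> f p = 0) ->
  forall p, ~ K p -> f' p = 0.
Proof.
move=> cK df fK p nKp.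
have [_ <-] := df p.
have c0 : {for (0 : R), continuous (fun s => hmul p (hor a b s))} by exact: hmul_hor_continuous.
have nb : \forall s \near (0 : R), f (hmul p (hor a b s)) = cst 0 s.
  have : nbhs (hmul p (hor a b 0)) [set q | ~ K q].
    by rewrite hmul_hor0; apply: open_nbhs_nbhs; split; [exact: closed_openC|].
  move=> /c0 h; near=> s; apply: fK; near: s; exact: h.
by rewrite (near_eq_derive _ nb) ?oner_neq0// derive_cst.
Unshelve. all: by end_near. Qed.

Lemma ccont_supp f (K : set H) M : continuous f -> K `<=` box M -> (forall p, ~ K p -> f p = 0) -> ccont f.
Proof.
move=> cf KM fK; split => //; exists M => p fp; apply: KM.
by apply: contrapT => /fK fp0; rewrite fp0 eqxx in fp.
Qed.

(** A is controlled on U only, so its products with u are continuous as extensions by zero from the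
    compact support. The finiteness of the form is recorded for the subtractions in [\bar R] to
    come. *)
Lemma test_function_ineq U A (u : H -> R[i]) G l k (C K M : R) :
  open U -> {in U, continuous (potx A)} -> {in U, continuous (poty A)} -> test_function U u ->
  loop_prop A G l k -> 0 <= C -> 1 <= K ->
  (forall f d, loop_pair G l k f d ->
    (\int[mu3]_(p in box K) (f p)%:E <= C%:E * \int[mu3]_(p in box M) (d p)%:E)%E) ->
  (magnetic_form A u \is a fin_num) /\
  forall e, 0 < e -> e <= 1 ->
  (\int[mu3]_p (sqr p / gM e p * normc (u p) ^+ 2)%:E +
    (hc C (Num.sqrt ((2 * M ^+ 2) ^+ 2 + 16 * M ^+ 2 + 1)))%:E *
      \int[mu3]_(p in box K) (normc (u p) ^+ 2)%:E <= magnetic_form A u)%E.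
Proof.
move=> oU cAx cAy [su1 su2 Kc KU] hl C0 K1 poin.
pose u1 p := complex.Re (u p); pose u2 p := complex.Im (u p).
have h1 := smooth_hC1 su1; have h2 := smooth_hC1 su2.
set S := closure _ in Kc KU.
have cS : closed S by exact: closed_closure.
have uS p : ~ S p -> u p = 0.
  by move=> nS; apply: contrapT => /eqP up; apply: nS; exact: subset_closure.
have u1S p : ~ S p -> u1 p = 0 by move=> /uS; rewrite /u1 => ->.
have u2S p : ~ S p -> u2 p = 0 by move=> /uS; rewrite /u2 => ->.
have [B SB] := compact_box_bound Kc.
have cu1 : continuous u1 by case: h1.
have cu2 : continuous u2 by case: h2.
have s1 : ccont u1 by exact: ccont_supp SB u1S.
have s2 : ccont u2 by exact: ccont_supp SB u2S.
have X1 : ccont (vfX u1) by apply: (ccont_supp _ SB); [case: h1|exact: (hder_supp cS (hC1_X h1))].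
have X2 : ccont (vfX u2) by apply: (ccont_supp _ SB); [case: h2|exact: (hder_supp cS (hC1_X h2))].
have Y1 : ccont (vfY u1) by apply: (ccont_supp _ SB); [case: h1|exact: (hder_supp cS (hC1_Y h1))].
have Y2 : ccont (vfY u2) by apply: (ccont_supp _ SB); [case: h2|exact: (hder_supp cS (hC1_Y h2))].
have sm (a g : H -> R) : {in U, continuous a} -> continuous g -> (forall p, ~ S p -> g p = 0) ->
    ccont (fun p => a p * g p).
  move=> ca cg gS; apply: (ccont_supp _ SB); first exact: (continuous_mul_supp oU cS KU).
  by move=> p /gS ->; rewrite mulr0.
have sN f : ccont f -> ccont (fun p => - f p).
  by move=> [cf [N hN]]; split; [exact: ctN|exists N => p; rewrite oppr_eq0; exact: hN].
have sc1 : ccont (fun p => vfX u1 p - potx A p * u2 p) by apply: ccontD => //; apply: sN; exact: sm.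
have sc2 : ccont (fun p => vfX u2 p + potx A p * u1 p) by apply: ccontD => //; exact: sm.
have sc3 : ccont (fun p => vfY u1 p - poty A p * u2 p) by apply: ccontD => //; apply: sN; exact: sm.
have sc4 : ccont (fun p => vfY u2 p + poty A p * u1 p) by apply: ccontD => //; exact: sm.
have nE (z : R[i]) : normc z ^+ 2 = complex.Re z ^+ 2 + complex.Im z ^+ 2.
  by case: z => a b /=; rewrite sqr_sqrtr// addr_ge0// sqr_ge0.
have uE p : normc (u p) ^+ 2 = u1 p ^+ 2 + u2 p ^+ 2 by rewrite nE.
have mE : magnetic_form A u = (\int[mu3]_p ((vfX u1 p - potx A p * u2 p) ^+ 2 + (vfX u2 p + potx A p * u1 p) ^+ 2 +
     ((vfY u1 p - poty A p * u2 p) ^+ 2 + (vfY u2 p + poty A p * u1 p) ^+ 2))%:E)%E.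
  apply: eq_integral => p _; congr EFin; rewrite !nE /lift_complex /u1 /u2.
  case: (u p) => a b /=.
  by congr (_ ^+ 2 + _ ^+ 2 + (_ ^+ 2 + _ ^+ 2)); ring.
split.
  rewrite mE; apply: integrable_fin_num => //; apply: ccont_integrable.
  have sq f : ccont f -> ccont (fun p => f p ^+ 2).
    move=> cf; have -> : (fun p => f p ^+ 2) = (fun p => f p * f p) by apply/funext => p; rewrite expr2.
    by apply: ccontM => //; case: cf.
  by repeat apply: ccontD; exact: sq.
move=> e e0 e1.
have := main_ineq h1 h2 s1 s2 sc1 sc2 sc3 sc4 hl C0 K1 poin e0 e1.
rewrite -mE.
under eq_integral do rewrite -uE.
by under [in X in (_ + _ * X <= _)%E -> _]eq_integral do rewrite -uE.
Qed.

Lemma rho4 p : rho p ^+ 4 = gN p.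
Proof.
rewrite /rho -/(sqr p) -/(gN p) -powR_mulrn ?powR_ge0// -powRrM mulVf ?pnatr_eq0//.
by rewrite powRr1// gN_ge0.
Qed.

Lemma rr2 p : rr p ^+ 2 = sqr p.
Proof. by rewrite /rr sqr_sqrtr// sqr_ge0'. Qed.

(** Monotone convergence along e = 1/(n+1): the weight r^2 / (N + e) increases as e decreases. *)
Lemma hardy_limit (v : H -> R) (X : \bar R) : measurable_fun (setT : set MH) v ->
  (forall p, 0 <= v p) ->
  (forall e, 0 < e -> e <= 1 -> (\int[mu3]_p (sqr p / gM e p * v p)%:E <= X)%E) ->
  (\int[mu3]_p (rr p ^+ 2 / rho p ^+ 4 * v p)%:E <= X)%E.
Proof.
move=> mv v0 h.
pose e n : R := n.+1%:R^-1.
have e0 n : 0 < e n by rewrite invr_gt0 ltr0n.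
have e1 n : e n <= 1 by rewrite invf_le1// ler1n.
pose g n p : \bar R := (sqr p / gM (e n) p * v p)%:E.
have csq : continuous (@sqr R) by case: (hC1_sqr R).
have mg n : measurable_fun (setT : set MH) (g n).
  apply/measurable_EFinP; apply: measurable_funM => //.
  have [cM _ _ _] := hC1_gM (e n).
  apply: continuous_measurable_heis; apply: ctM => //; apply: ctV => // p.
  by rewrite gt_eqF// gM_gt0.
have g0 n p : (0 <= g n p)%E.
  by rewrite lee_fin mulr_ge0// divr_ge0 ?sqr_ge0'// ltW// gM_gt0.
have nd p : {homo g ^~ p : n m / (n <= m)%N >-> (n <= m)%E}.
  move=> n m nm; rewrite lee_fin ler_wpM2r// ler_wpM2l ?sqr_ge0'// lef_pV2 ?posrE ?gM_gt0//.
  by rewrite /gM lerD2l lef_pV2 ?posrE// ler_nat.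
have lim p : limn (g ^~ p) = (rr p ^+ 2 / rho p ^+ 4 * v p)%:E.
  rewrite rr2 rho4; apply/cvg_lim => //; apply: cvg_EFin; first by near=> n.
  (* At the origin r = 0, so every regularised weight vanishes, and so does the limit weight, where
     division by 0 gives 0. *)
  have [N0|N0] := eqVneq (gN p) 0.
    have s0 : sqr p = 0.
      apply/eqP; rewrite -sqrf_eq0 eq_le sqr_ge0 andbT -N0 /gN lerDl mulr_ge0// sqr_ge0.
      by [].
    rewrite s0 !mul0r.
    apply: cvg_near_cst; near=> n; by rewrite /g /= s0 !mul0r.
  apply: cvgM; last exact: cvg_cst.
  apply: cvgM; first exact: cvg_cst.
  apply: cvgV => //; rewrite -[X in _ --> X]addr0; apply: cvgD; first exact: cvg_cst.
  exact: cvg_harmonic.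
have -> : (\int[mu3]_p (rr p ^+ 2 / rho p ^+ 4 * v p)%:E = \int[mu3]_p limn (g ^~ p))%E.
  by apply: eq_integral => p _; rewrite lim.
rewrite monotone_convergence//.
apply: lime_le; last by near=> n; exact: h.
apply: ereal_nondecreasing_is_cvgn => n m nm; apply: ge0_le_integral => // p _; exact: nd.
Unshelve. all: by end_near. Qed.

Lemma hardy_from_loop (Omega U : set H) (A : potential R) G l k (C K M : R) :
  open Omega -> Omega `<=` box K -> open U ->
  {in U, continuous (potx A)} -> {in U, continuous (poty A)} ->
  loop_prop A G l k -> 0 <= C -> 1 <= K ->
  (forall f d, loop_pair G l k f d ->
    (\int[mu3]_(p in box K) (f p)%:E <= C%:E * \int[mu3]_(p in box M) (d p)%:E)%E) ->
  hardy_ineq U Omega A (hc C (Num.sqrt ((2 * M ^+ 2) ^+ 2 + 16 * M ^+ 2 + 1))).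
Proof.
move=> oO OK oU cAx cAy hl C0 K1 poin u tu.
set c := hc _ _.
have [fm ineq] := test_function_ineq oU cAx cAy tu hl C0 K1 poin.
have mv : measurable_fun (setT : set MH) (fun p => normc (u p) ^+ 2).
  case: tu => su1 su2 _ _.
  have cu1 : continuous (fun p => complex.Re (u p)) by case: (smooth_hC1 su1).
  have cu2 : continuous (fun p => complex.Im (u p)) by case: (smooth_hC1 su2).
  apply: continuous_measurable_heis.
  have -> : (fun p => normc (u p) ^+ 2) = (fun p => complex.Re (u p) ^+ 2 + complex.Im (u p) ^+ 2).
    apply/funext => p; case: (u p) => a b /=; rewrite sqr_sqrtr// addr_ge0// sqr_ge0 //.
  by apply: ctD; exact: ctX.
set J := (\int[mu3]_(p in box K) (normc (u p) ^+ 2)%:E)%E in ineq.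
have c0 : 0 <= c.
  rewrite /c /hc divr_ge0// addr_ge0// mulr_ge0 ?sqrtr_ge0// mulr_ge0//.
have OJ : (\int[mu3]_(p in Omega) (normc (u p) ^+ 2)%:E <= J)%E.
  apply: ge0_subset_int => //.
  - exact: open_measurable_heis.
  - exact: measurable_box.
  - exact/measurable_EFinP.
  - by move=> p; rewrite lee_fin sqr_ge0.
have J0 : (0 <= J)%E by apply: integral_ge0 => p _; rewrite lee_fin sqr_ge0.
have cJ0 : (0 <= c%:E * J)%E by apply: mule_ge0 => //; rewrite lee_fin.
have w0 e : 0 < e -> (0 <= \int[mu3]_p (sqr p / gM e p * normc (u p) ^+ 2)%:E)%E.
  move=> e0; apply: integral_ge0 => p _; rewrite lee_fin mulr_ge0 ?sqr_ge0// divr_ge0 ?sqr_ge0'//.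
  by rewrite ltW// gM_gt0.
(* Terms can be moved across an inequality in [\bar R] once they are finite; this one lies below the
   finite magnetic form. *)
have cJf : (c%:E * J)%E \is a fin_num.
  rewrite ge0_fin_numE//; apply: le_lt_trans (_ : (_ <= magnetic_form A u)%E) _; last first.
    by rewrite -ge0_fin_numE// ; apply: integral_ge0 => p _; rewrite lee_fin addr_ge0// sqr_ge0.
  by apply: le_trans (ineq 1 ltr01 (lexx _)); rewrite leeDr// w0.
have hW : (\int[mu3]_p (rr p ^+ 2 / rho p ^+ 4 * normc (u p) ^+ 2)%:E <= magnetic_form A u - c%:E * J)%E.
  apply: hardy_limit => // [p|e e0 e1]; first exact: sqr_ge0.
  by rewrite leeBrDr//; exact: ineq.
have fW : (\int[mu3]_p (rr p ^+ 2 / rho p ^+ 4 * normc (u p) ^+ 2)%:E)%E \is a fin_num.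
  rewrite ge0_fin_numE; last first.
    by apply: integral_ge0 => p _; rewrite lee_fin mulr_ge0 ?sqr_ge0// divr_ge0 ?sqr_ge0// rho4 gN_ge0.
  by apply: le_lt_trans hW _; rewrite ltey_eq fin_numB fm cJf.
rewrite leeBrDr//; apply: le_trans (_ : (_ <= c%:E * J + \int[mu3]_p (rr p ^+ 2 / rho p ^+ 4 * normc (u p) ^+ 2)%:E)%E) _.
  by apply: leeD => //; apply: lee_wpmul2l => //; rewrite lee_fin.
by rewrite addeC -leeBrDr.
Qed.

End HardyFromLoop.

(** * Holonomy of a smooth potential *)

Section C1fun.
Variable R : realType.
Local Notation H := (heis R).
Implicit Types (f g : H -> R).

Lemma smooth_partial i f : smooth_on setT f -> smooth_on setT (partial i f).
Proof.
move=> sf s p _; have := sf (rcons s i) p I.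
by rewrite -cats1 foldr_cat /=.
Qed.

Lemma gC1D f g : gC1 f -> gC1 g -> gC1 (fun p => f p + g p).
Proof.
move=> [cf df pf] [cg dg pg]; split; first exact: ctD.
  by move=> p i; exact: derivableD.
move=> i; have -> : partial i (fun p => f p + g p) = (fun p => partial i f p + partial i g p).
  by apply/funext => p; rewrite /partial deriveD.
exact: ctD.
Qed.

Lemma gC1N f : gC1 f -> gC1 (fun p => - f p).
Proof.
move=> [cf df pf]; split; first exact: ctN.
  by move=> p i; exact: derivableN.
move=> i; have -> : partial i (fun p => - f p) = (fun p => - partial i f p).
  by apply/funext => p; rewrite /partial deriveN.
exact: ctN.
Qed.

Lemma gC1M f g : gC1 f -> gC1 g -> gC1 (fun p => f p * g p).
Proof.
move=> [cf df pf] [cg dg pg]; split; first exact: ctM.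
  by move=> p i; exact: derivableM.
move=> i; have -> : partial i (fun p => f p * g p) = (fun p => f p * partial i g p + g p * partial i f p).
  by apply/funext => p; rewrite /partial (deriveM (df p i) (dg p i)).
by apply: ctD; exact: ctM.
Qed.

Lemma gC1_linear (f : H -> R) : continuous f -> (forall p q, f (p + q) = f p + f q) ->
  (forall (h : R) p, f (h *: p) = h * f p) -> gC1 f.
Proof.
move=> cf fD fZ.
have e p v : (fun h : R => h^-1 *: ((f \o shift p) (h *: v) - f p)) @ 0^' --> f v.
  apply: cvg_near_cst; near=> h.
  have h0 : h != 0 by near: h; exact: nbhs_dnbhs_neq.
  by rewrite /= fD fZ addrK /GRing.scale /= mulKf.
split => //.
- by move=> p i; apply: cvgP (e p _).
move=> i; have -> : partial i f = (fun _ => f (basis_vec R i)).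
  by apply/funext => p; apply/cvg_lim; [|exact: e].
exact: ct_cst.
Unshelve. all: by end_near. Qed.

Lemma gC1_cst (k : R) : gC1 (fun _ => k).
Proof.
split; first exact: ct_cst.
  by move=> p i; exact: derivable_cst.
move=> i; have -> : partial i (fun _ => k) = (fun _ => 0).
  by apply/funext => p; rewrite /partial derive_cst.
exact: ct_cst.
Qed.

Lemma gC1_cx : gC1 (@cx R).
Proof. by apply: gC1_linear => //; exact: cx_continuous. Qed.

Lemma gC1_cy : gC1 (@cy R).
Proof. by apply: gC1_linear => //; exact: cy_continuous. Qed.

Lemma gC1_curlH (A : potential R) : smooth_potential setT A -> gC1 (curlH A).
Proof.
move=> [sx sy].
have px i : gC1 (partial i (potx A)) by exact/smooth_gC1/smooth_partial.
have py i : gC1 (partial i (poty A)) by exact/smooth_gC1/smooth_partial.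
rewrite /curlH /vfX /vfY; apply: gC1D; last apply: gC1N.
  apply: gC1D => //; apply: gC1N; apply: gC1M => //; apply: gC1M; [exact: gC1_cy|exact: gC1_cst].
by apply: gC1D => //; apply: gC1M => //; apply: gC1M; [exact: gC1_cx|exact: gC1_cst].
Qed.

Lemma magnetic_field_continuous (A : potential R) : smooth_potential setT A ->
  continuous (fun p => (magnetic_field A p).1) /\ continuous (fun p => (magnetic_field A p).2).
Proof.
move=> sA; have [_ cX cY _] := gC1_hC1 (gC1_curlH sA).
have [[_ _ px] [_ _ py]] := (smooth_gC1 sA.1, smooth_gC1 sA.2).
by split; apply: ctD => //; apply: ctN; [exact: px|exact: py].
Qed.

End C1fun.

(** * Integrals over [0, 1] depending on a parameter *)

Section RI.
Variable R : realType.
Local Notation RM := (measurableTypeR R).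
Local Notation lam := (@lebesgue_measure R).

Definition RI (h : R -> R) : R := Rintegral lam `[0%R, 1%R] h.

Lemma RI_E h : continuous h -> (\int[lam]_(s in `[0%R, 1%R]) (h s)%:E)%E = (RI h)%:E.
Proof.
move=> ch; rewrite /RI /Rintegral fineK//; apply: integrable_fin_num; first exact: measurable_itv.
exact: integrable01.
Qed.

Lemma RI_FTC (h h' : R -> R) : (forall s : R, is_derive s 1 h (h' s)) -> continuous h' ->
  RI h' = h 1 - h 0.
Proof. by move=> dh ch; have := FTC_derive ltr01 dh ch; rewrite (RI_E ch) => -[]. Qed.

Lemma RI_D (h g : R -> R) : continuous h -> continuous g -> RI (fun s => h s + g s) = RI h + RI g.
Proof.
move=> ch cg; have mi : measurable (`[0%R, 1%R]%classic : set RM) by exact: measurable_itv.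
exact: (RintegralD mi (integrable01 ch) (integrable01 cg)).
Qed.

Lemma RI_Z (k : R) (h : R -> R) : continuous h -> RI (fun s => k * h s) = k * RI h.
Proof.
move=> ch; have mi : measurable (`[0%R, 1%R]%classic : set RM) by exact: measurable_itv.
exact: (RintegralZl k mi (integrable01 ch)).
Qed.

Lemma RI_close (h g : R -> R) (d : R) : continuous h -> continuous g ->
  (forall s : R, 0 <= s <= 1 -> `|h s - g s| <= d) -> `|RI h - RI g| <= d.
Proof.
move=> ch cg hg.
have key (h1 h2 : R -> R) : continuous h1 -> continuous h2 ->
    (forall s : R, 0 <= s <= 1 -> h1 s <= h2 s + d) -> RI h1 <= RI h2 + d.
  move=> c1 c2 h12.
  have cd : continuous (fun _ : R => d) by exact: ct_cst.
  have -> : d = RI (fun _ => d).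
    by have := @integral01_cst R d; rewrite (RI_E cd) => -[].
  rewrite -RI_D// -lee_fin -!RI_E//; last exact: ctD.
  apply: le_integral; first exact: measurable_itv.
  - exact: integrable01.
  - by apply: (@integrable01 _ (fun s => h2 s + d)); exact: ctD.
  by move=> s; rewrite inE /= in_itv /= lee_fin => /h12.
have k1 := key _ _ ch cg; have k2 := key _ _ cg ch.
have {}k1 : RI h <= RI g + d by apply: k1 => s /hg; rewrite ler_norml => /andP[]; lra.
have {}k2 : RI g <= RI h + d by apply: k2 => s /hg; rewrite ler_norml => /andP[]; lra.
by rewrite ler_norml; apply/andP; split; lra.
Qed.

Lemma is_derive_RI (g g' : R -> R -> R) : (forall x s : R, is_derive x 1 (g ^~ s) (g' x s)) ->
  (forall x, continuous (g x)) -> continuous (fun q : R * R => g' q.1 q.2) ->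
  forall x : R, is_derive x 1 (fun x => RI (g x)) (RI (g' x)).
Proof.
move=> dg cg cg' x.
have [K hK] : exists K, forall y s, x - 1 <= y <= x + 1 -> 0 <= s <= 1 -> `|g' y s| <= K.
  have cA : compact (`[x - 1, x + 1]%classic `*` `[0, 1]%classic : set (R * R)).
    by apply: compact_setX; exact: segment_compact.
  have : compact [set g' q.1 q.2 | q in (`[x - 1, x + 1]%classic `*` `[0, 1]%classic : set (R * R))].
    by apply: continuous_compact => //; exact: continuous_subspaceT.
  move=> /compact_bounded[K [_ hK]]; exists (K + 1) => y s hy hs.
  apply: (hK (K + 1)); first by rewrite ltrDl.
  by exists (y, s) => //=; split; rewrite /= in_itv.
have K0 : 0 <= K by apply: le_trans (hK x 0 _ _); rewrite ?lexx ?ler01//; lra.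
have Ix : (`]x - 1, x + 1[%classic : set R) x by rewrite /= in_itv /=; lra.
have mi : measurable (`[0%R, 1%R]%classic : set RM) by exact: measurable_itv.
have d1 y s : partial1of2 g y s = g' y s by rewrite partial1of2E; case: (dg y s).
have ig y : (`]x - 1, x + 1[%classic : set R) y -> lam.-integrable `[0%R, 1%R] (EFin \o g y).
  by move=> _; exact: integrable01.
have dd y (s : RM) : (`]x - 1, x + 1[%classic : set R) y -> (`[0%R, 1%R]%classic : set RM) s -> derivable (g ^~ s) y 1.
  by move=> _ _; case: (dg y s).
have iK : lam.-integrable `[0%R, 1%R] (EFin \o (fun _ : RM => K)).
  by apply: (@integrable01 _ (fun _ => K)); exact: ct_cst.
have bd y (s : RM) : (`]x - 1, x + 1[%classic : set R) y -> (`[0%R, 1%R]%classic : set RM) s -> `|partial1of2 g y s| <= K.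
  rewrite d1 /= !in_itv /= => /andP[y1 y2] s01; apply: hK => //.
  by rewrite !ltW.
split.
  exact: (derivable_under_integral mi Ix ig dd (fun _ => K0) iK bd).
have := differentiation_under_integral mi Ix ig dd (fun _ => K0) iK bd.
rewrite derive1E => ->.
by apply: eq_Rintegral => s _; exact: d1.
Qed.

(** F(x) = int_0^1 x h(xt) dt is a primitive on the whole line, for both signs of x: differentiating
    under the integral yields the t-derivative of t h(xt), which integrates to h(x). *)
Lemma primitive_ex (h h' : R -> R) : (forall s : R, is_derive s 1 h (h' s)) -> continuous h' ->
  exists F : R -> R, forall s : R, is_derive s 1 F (h s).
Proof.
move=> dh ch'.
have ch : continuous h by move=> s; exact: is_derive_continuousR (dh s).
exists (fun x => RI (fun t => x * h (x * t))) => x.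
have dhx (y t : R) : is_derive y 1 (fun y => h (y * t)) (t * h' (y * t)).
  have d1 : is_derive y 1 (fun y : R => y * t) t by apply: is_derive_eq; rewrite /GRing.scale/=; ring.
  have := @is_derive1_comp R h (fun y : R => y * t) y _ _ (dh (y * t)) d1.
  by rewrite mulrC.
suff E : RI (fun t => h (x * t) + x * (t * h' (x * t))) = h x.
  rewrite -E; apply: (@is_derive_RI (fun y t => y * h (y * t)) (fun y t => h (y * t) + y * (t * h' (y * t)))).
  - by move=> y t; have := dhx y t => d; apply: is_derive_eq; rewrite /GRing.scale/=; ring.
  - by move=> y; apply: ctM; [exact: ct_cst|apply: ct_comp => //; apply: ctM; [exact: ct_cst|exact: ct_id]].
  - have c1 : continuous (fun q : R * R => q.1 * q.2) by apply: ctM => q; [exact: cvg_fst|exact: cvg_snd].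
    apply: ctD; first exact: ct_comp.
    apply: ctM; first by move=> q; exact: cvg_fst.
    by apply: ctM; [move=> q; exact: cvg_snd|exact: ct_comp].
have D (t : R) : is_derive t 1 (fun t => t * h (x * t)) (h (x * t) + x * (t * h' (x * t))).
  have d1 : is_derive t 1 (fun t => h (x * t)) (x * h' (x * t)).
    by have := dhx t x; rewrite (mulrC t x); under eq_fun do rewrite mulrC.
  by apply: is_derive_eq; rewrite /GRing.scale/=; ring.
rewrite (RI_FTC D) ?mulr1 ?mul1r ?mul0r ?subr0//.
have c1 : continuous (fun t : R => x * t) by apply: ctM; [exact: ct_cst|exact: ct_id].
apply: ctD; first exact: ct_comp.
apply: ctM; first exact: ct_cst.
by apply: ctM; [exact: ct_id|exact: ct_comp].
Qed.

Lemma RI_linear (c d : R) : RI (fun s => c + d * s) = c + d / 2.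
Proof.
have D (s : R) : is_derive s 1 (fun s => c * s + d / 2 * s ^+ 2) (c + d * s).
  by apply: is_derive_eq; rewrite /GRing.scale/=; field.
rewrite (RI_FTC D); first by field.
by apply: ctD; [exact: ct_cst|apply: ctM; [exact: ct_cst|exact: ct_id]].
Qed.

End RI.

(** * Circulation along dilated loops and Stokes' formula *)

Section Dilation.
Variable R : realType.
Local Notation H := (heis R).
Implicit Types (f : H -> R) (p v : H) (A : potential R) (l : seq (R * R)).

(** Left translation to [p] of the anisotropic dilation, a group automorphism; hence horizontal
    segments go to horizontal segments ([dil_hor]). *)
Definition dil p (t : R) v : H := hmul p (t * cx v, t * cy v, t ^+ 2 * cz v).

Lemma dil_hor p t v a b s : dil p t (hmul v (hor a b s)) = hmul (dil p t v) (hor (t * a) (t * b) s).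
Proof. by rewrite /dil /hmul /hor /cx /cy /cz /=; congr (_, _, _); field. Qed.

Lemma dil0 p t : dil p t (0, 0, 0) = p.
Proof. by case: p => -[x y] z; rewrite /dil /hmul /cx /cy /cz /=; congr (_, _, _); field. Qed.

Lemma dil_continuous p v a b : continuous (fun q : R * R => dil p q.1 (hmul v (hor a b q.2))).
Proof.
have c1 : continuous (fun q : R * R => q.1) by move=> q; exact: cvg_fst.
have c2 : continuous (fun q : R * R => q.2) by move=> q; exact: cvg_snd.
by rewrite /dil /hmul /hor /cx /cy /cz /=; cont.
Qed.

Lemma dil_continuous1 p v a b t : continuous (fun s : R => dil p t (hmul v (hor a b s))).
Proof. by rewrite /dil /hmul /hor /cx /cy /cz /=; cont. Qed.

Lemma is_derive_dil f p v (t : R) : gC1 f ->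
  is_derive t 1 (fun t => f (dil p t v)) (cx v * vfX f (dil p t v) + cy v * vfY f (dil p t v)
    + 2 * t * cz v * vfZ f (dil p t v)).
Proof.
move=> /gC1_at Cf; rewrite /dil /hmul /vfX /vfY /vfZ.
move: (cx p) (cy p) (cz p) (cx v) (cy v) (cz v) => p1 p2 p3 v1 v2 v3.
pose c1 (s : R) := p1 + s * v1; pose c2 (s : R) := p2 + s * v2.
pose c3 (s : R) := p3 + s ^+ 2 * v3 + (p1 * (s * v2) - p2 * (s * v1)) / 2.
have d1 : is_derive t 1 c1 v1 by apply: is_derive_eq; rewrite /GRing.scale/=; ring.
have d2 : is_derive t 1 c2 v2 by apply: is_derive_eq; rewrite /GRing.scale/=; ring.
have d3 : is_derive t 1 c3 (2 * t * v3 + (p1 * v2 - p2 * v1) / 2).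
  by apply: is_derive_eq; rewrite /GRing.scale/=; field.
have := chain_rule (erefl (c1 t, c2 t, c3 t)) (Cf _) d1 d2 d3.
rewrite /c1 /c2 /c3 /cx /cy /cz /= => D; apply: is_derive_eq.
by move: (partial 0 f _) (partial 1 f _) (partial 2 f _) => q0 q1 q2; field.
Qed.

Lemma is_derive_dil_hor f p v a b (t s : R) : gC1 f ->
  is_derive s 1 (fun s => f (dil p t (hmul v (hor a b s))))
   (t * (a * vfX f (dil p t (hmul v (hor a b s))) + b * vfY f (dil p t (hmul v (hor a b s))))).
Proof.
move=> /gC1_hC1[_ _ _ df].
have := hder_line (dil p t v) s (df (t * a) (t * b)).
rewrite -dil_hor; under eq_fun do rewrite -dil_hor.
by move=> D; apply: is_derive_eq; ring.
Qed.

Lemma slice_continuous (F : R * R -> R) (t : R) : continuous F -> continuous (fun s => F (t, s)).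
Proof.
move=> cF s; apply: (@continuous_comp _ _ _ (fun s : R => (t, s))); last exact: cF.
by apply: ct_pair => ?; [exact: cvg_cst|exact: cvg_id].
Qed.

Section Flux.
Variables (A : potential R) (sA : smooth_potential setT A) (p : H).

(** The lifted form A_x dx + A_y dy + (curlH A) omega on the velocity xX + yY + 2tzZ of t ->
    [dil p t v]; [tang] is the same form on the velocity along the dilated segment, where omega
    vanishes. *)
Definition rad (t : R) v : R := cx v * potx A (dil p t v) + cy v * poty A (dil p t v)
  + 2 * t * cz v * curlH A (dil p t v).

Definition tang (w : R * R) v (t s : R) : R := t * (w.1 * potx A (dil p t (hmul v (hor w.1 w.2 s)))
  + w.2 * poty A (dil p t (hmul v (hor w.1 w.2 s)))).

Fixpoint circ l v t : R := if l is w :: l' then RI (tang w v t) + circ l' (step v w) t else 0.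

(** Evaluating b_1 dx /\ omega + b_2 dy /\ omega on the t- and s-velocities of the dilated segment
    gives -2 t^2 times this; the power of t is split off so that the rest has a limit as t tends to
    0. *)
Definition flux1 (B : H -> R * R) (w : R * R) v (t s : R) : R :=
  cz (hmul v (hor w.1 w.2 s)) * (w.1 * (B (dil p t (hmul v (hor w.1 w.2 s)))).1
  + w.2 * (B (dil p t (hmul v (hor w.1 w.2 s)))).2).

Fixpoint flux (B : H -> R * R) l v t : R :=
  if l is w :: l' then RI (flux1 B w v t) + flux B l' (step v w) t else 0.

Lemma dil_comp_continuous f w v : continuous f ->
  continuous (fun q : R * R => f (dil p q.1 (hmul v (hor w.1 w.2 q.2)))).
Proof. by move=> cf q; apply: continuous_comp; [exact: dil_continuous|exact: cf]. Qed.

Lemma dil_hor_continuous f w v t : continuous f ->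
  continuous (fun s : R => f (dil p t (hmul v (hor w.1 w.2 s)))).
Proof. by move=> cf q; apply: continuous_comp; [exact: dil_continuous1|exact: cf]. Qed.

Lemma hor_cz_continuous w v : continuous (fun s : R => cz (hmul v (hor w.1 w.2 s))).
Proof. by rewrite /hmul /hor /cx /cy /cz /=; cont. Qed.

Lemma flux1_continuous B w v t : continuous (fun q => (B q).1) -> continuous (fun q => (B q).2) ->
  continuous (flux1 B w v t).
Proof.
move=> c1 c2; have c3 := @hor_cz_continuous w v.
have c4 := dil_hor_continuous (w := w) (v := v) (t := t) c1.
have c5 := dil_hor_continuous (w := w) (v := v) (t := t) c2.
by rewrite /flux1; cont.
Qed.

Definition dtang w v (t s : R) : R := w.1 * potx A (dil p t (hmul v (hor w.1 w.2 s))) + w.2 * poty A (dil p t (hmul v (hor w.1 w.2 s)))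
   + t * (w.1 * (cx (hmul v (hor w.1 w.2 s)) * vfX (potx A) (dil p t (hmul v (hor w.1 w.2 s)))
            + cy (hmul v (hor w.1 w.2 s)) * vfY (potx A) (dil p t (hmul v (hor w.1 w.2 s)))
            + 2 * t * cz (hmul v (hor w.1 w.2 s)) * vfZ (potx A) (dil p t (hmul v (hor w.1 w.2 s))))
        + w.2 * (cx (hmul v (hor w.1 w.2 s)) * vfX (poty A) (dil p t (hmul v (hor w.1 w.2 s)))
            + cy (hmul v (hor w.1 w.2 s)) * vfY (poty A) (dil p t (hmul v (hor w.1 w.2 s)))
            + 2 * t * cz (hmul v (hor w.1 w.2 s)) * vfZ (poty A) (dil p t (hmul v (hor w.1 w.2 s))))).

Lemma is_derive_tang w v (t s : R) : is_derive t 1 (fun t => tang w v t s) (dtang w v t s).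
Proof.
have dx := is_derive_dil p (hmul v (hor w.1 w.2 s)) t (smooth_gC1 sA.1).
have dy := is_derive_dil p (hmul v (hor w.1 w.2 s)) t (smooth_gC1 sA.2).
rewrite /tang /dtang; apply: is_derive_eq; rewrite /GRing.scale /=.
move: (vfX _ _) (vfY _ _) (vfZ _ _) (vfX _ _) (vfY _ _) (vfZ _ _) => *; ring.
Qed.

(** Infinitesimal Stokes for the lifted form: the s-derivative of the radial component minus the
    t-derivative of the tangential one is minus its differential on the two velocities. *)
Lemma is_derive_rad w v (t s : R) : is_derive s 1 (fun s => rad t (hmul v (hor w.1 w.2 s)))
  (dtang w v t s + 2 * t ^+ 2 * flux1 (magnetic_field A) w v t s).
Proof.
have dx := is_derive_dil_hor p v w.1 w.2 t s (smooth_gC1 sA.1).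
have dy := is_derive_dil_hor p v w.1 w.2 t s (smooth_gC1 sA.2).
have db := is_derive_dil_hor p v w.1 w.2 t s (gC1_curlH sA).
have e1 : is_derive s 1 (fun s => cx (hmul v (hor w.1 w.2 s))) w.1.
  by rewrite /hmul /hor /cx /=; apply: is_derive_eq; rewrite /GRing.scale/=; ring.
have e2 : is_derive s 1 (fun s => cy (hmul v (hor w.1 w.2 s))) w.2.
  by rewrite /hmul /hor /cy /=; apply: is_derive_eq; rewrite /GRing.scale/=; ring.
have e3 : is_derive s 1 (fun s => cz (hmul v (hor w.1 w.2 s)))
   ((cx (hmul v (hor w.1 w.2 s)) * w.2 - cy (hmul v (hor w.1 w.2 s)) * w.1) / 2).
  by rewrite /hmul /hor /cz /cx /cy /=; apply: is_derive_eq; rewrite /GRing.scale/=; field.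
rewrite /rad; apply: is_derive_eq; rewrite /flux1 /dtang /GRing.scale.
move: (hmul v (hor w.1 w.2 s)) => u; move: (dil p t u) => q.
have -> : curlH A q = vfX (poty A) q - vfY (potx A) q by [].
rewrite /magnetic_field /=.
move: (cx u) (cy u) (cz u) (vfX (curlH A) q) (vfY (curlH A) q) => x y z X Y.
by move: (vfX (potx A) q) (vfY (potx A) q) (vfZ (potx A) q)
  (vfX (poty A) q) (vfY (poty A) q) (vfZ (poty A) q) (potx A q) (poty A q) w.1 w.2 => *; field.
Qed.

Lemma dtang_continuous w v : continuous (fun q : R * R => dtang w v q.1 q.2).
Proof.
have [hx hy] := (gC1_hC1 (smooth_gC1 sA.1), gC1_hC1 (smooth_gC1 sA.2)).
have [_ _ zx] := smooth_gC1 sA.1; have [_ _ zy] := smooth_gC1 sA.2.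
have [c1 c2 c3 _] := hx; have [c4 c5 c6 _] := hy.
have k1 := dil_comp_continuous (w := w) (v := v) c1.
have k2 := dil_comp_continuous (w := w) (v := v) c2.
have k3 := dil_comp_continuous (w := w) (v := v) c3.
have k4 := dil_comp_continuous (w := w) (v := v) c4.
have k5 := dil_comp_continuous (w := w) (v := v) c5.
have k6 := dil_comp_continuous (w := w) (v := v) c6.
have k7 := dil_comp_continuous (w := w) (v := v) (zx 2).
have k8 := dil_comp_continuous (w := w) (v := v) (zy 2).
have f1 : continuous (fun q : R * R => q.1) by move=> q; exact: cvg_fst.
have f2 : continuous (fun q : R * R => q.2) by move=> q; exact: cvg_snd.
have g1 : continuous (fun q : R * R => cx (hmul v (hor w.1 w.2 q.2))) by rewrite /hmul /hor /cx /cy /cz /=; cont.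
have g2 : continuous (fun q : R * R => cy (hmul v (hor w.1 w.2 q.2))) by rewrite /hmul /hor /cx /cy /cz /=; cont.
have g3 : continuous (fun q : R * R => cz (hmul v (hor w.1 w.2 q.2))) by rewrite /hmul /hor /cx /cy /cz /=; cont.
have K (a b : R) (u1 u2 u3 u4 u5 u6 u7 u8 u9 v1 v2 v3 : R * R -> R) :
  continuous u1 -> continuous u2 -> continuous u3 -> continuous u4 -> continuous u5 -> continuous u6 ->
  continuous u7 -> continuous u8 -> continuous u9 -> continuous v1 -> continuous v2 -> continuous v3 ->
  continuous (fun q => a * u1 q + b * u2 q + u3 q * (a * (v1 q * u4 q + v2 q * u5 q + 2 * u3 q * v3 q * u6 q)
     + b * (v1 q * u7 q + v2 q * u8 q + 2 * u3 q * v3 q * u9 q))).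
  move=> i1 i2 i3 i4 i5 i6 i7 i8 i9 j1 j2 j3.
  have ca : continuous (fun _ : R * R => a) by exact: ct_cst.
  have cb : continuous (fun _ : R * R => b) by exact: ct_cst.
  have c0 : continuous (fun _ : R * R => 2 : R) by exact: ct_cst.
  have cz6 := ctM (ctM (ctM c0 i3) j3) i6; have cz9 := ctM (ctM (ctM c0 i3) j3) i9.
  have m1 := ctM ca (ctD (ctD (ctM j1 i4) (ctM j2 i5)) cz6).
  have m2 := ctM cb (ctD (ctD (ctM j1 i7) (ctM j2 i8)) cz9).
  exact (ctD (ctD (ctM ca i1) (ctM cb i2)) (ctM i3 (ctD m1 m2))).
exact: (K _ _ _ _ _ _ _ _ _ _ _ _ _ _ k1 k4 f1 k2 k3 k7 k5 k6 k8 g1 g2 g3).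
Qed.

Lemma tang_continuous w v t : continuous (tang w v t).
Proof.
have [c1 _ _] := smooth_gC1 sA.1; have [c2 _ _] := smooth_gC1 sA.2.
have k1 := dil_hor_continuous (w := w) (v := v) (t := t) c1.
have k2 := dil_hor_continuous (w := w) (v := v) (t := t) c2.
by rewrite /tang; cont.
Qed.

(** Integrated over the segments, the radial terms telescope to the two ends of the path. *)
Lemma is_derive_circ l v (t : R) : is_derive t 1 (circ l v)
  (rad t (pend l v) - rad t v - 2 * t ^+ 2 * flux (magnetic_field A) l v t).
Proof.
elim: l v => [|w l IH] v /=.
  by have := is_derive_cst (0 : R) t 1; rewrite subrr mulr0 subr0.
have D := is_derive_RI (fun t s => is_derive_tang w v t s) (fun x => @tang_continuous w v x) (@dtang_continuous w v) t.
have := IH (step v w); rewrite -/(pend l _) => D2.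
have c1 : continuous (dtang w v t).
  exact (@slice_continuous (fun q => dtang w v q.1 q.2) t (@dtang_continuous w v)).
have [bc1 bc2] := magnetic_field_continuous sA.
have c2 := flux1_continuous (w := w) (v := v) (t := t) bc1 bc2.
have c3 : continuous (fun s => 2 * t ^+ 2 * flux1 (magnetic_field A) w v t s) by cont.
have := RI_FTC (fun s => is_derive_rad w v t s) (ctD c1 c3).
rewrite (RI_D c1 c3).
have -> : RI (fun s => 2 * t ^+ 2 * flux1 (magnetic_field A) w v t s) = 2 * t ^+ 2 * RI (flux1 (magnetic_field A) w v t).
  exact: RI_Z.
rewrite hmul_hor0 -/(step v w) => E.
apply: is_derive_eq; rewrite /= in E *.
move: E; set x := RI _; set y := RI (flux1 _ _ _ _) => E.
have -> : x = rad t (step v w) - rad t v - 2 * t ^+ 2 * y by rewrite -E /x; ring.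
by rewrite /pend /=; move: (flux _ _ _ _) (rad t _) (rad t _) (rad t _) => *; ring.
Qed.

Lemma phase_dil l v (t : R) : phase A [seq (t * w.1, t * w.2) | w <- l] (dil p t v) (circ l v t).
Proof.
elim: l v => [//|w l IH] v /=.
have d (s : R) : is_derive s 1 (tang w v t) (t * (w.1 * (t * (w.1 * vfX (potx A) (dil p t (hmul v (hor w.1 w.2 s)))
    + w.2 * vfY (potx A) (dil p t (hmul v (hor w.1 w.2 s)))))
  + w.2 * (t * (w.1 * vfX (poty A) (dil p t (hmul v (hor w.1 w.2 s)))
    + w.2 * vfY (poty A) (dil p t (hmul v (hor w.1 w.2 s))))))).
  have dx := is_derive_dil_hor p v w.1 w.2 t s (smooth_gC1 sA.1).
  have dy := is_derive_dil_hor p v w.1 w.2 t s (smooth_gC1 sA.2).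
  by rewrite /tang; apply: is_derive_eq; rewrite /GRing.scale /=.
have [Phi dP] : exists F : R -> R, forall s : R, is_derive s 1 F (tang w v t s).
  apply: primitive_ex d _.
  have [_ c1 c2 _] := gC1_hC1 (smooth_gC1 sA.1); have [_ c3 c4 _] := gC1_hC1 (smooth_gC1 sA.2).
  have k1 := dil_hor_continuous (w := w) (v := v) (t := t) c1.
  have k2 := dil_hor_continuous (w := w) (v := v) (t := t) c2.
  have k3 := dil_hor_continuous (w := w) (v := v) (t := t) c3.
  have k4 := dil_hor_continuous (w := w) (v := v) (t := t) c4.
  by cont.
exists Phi, (circ l (step v w) t); split.
- by move=> s; have := dP s; rewrite /tang dil_hor mulrDr !mulrA.
- by have := IH (step v w); rewrite [dil p t _]dil_hor.
- by rewrite (RI_FTC dP)//; exact: tang_continuous.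
Qed.

Lemma circ0 l v : circ l v 0 = 0.
Proof.
elim: l v => [//|w l IH] v /=; rewrite IH addr0.
have -> : tang w v 0 = (fun s => 0 + 0 * s) by apply/funext => s; rewrite /tang !mul0r addr0.
by rewrite RI_linear mul0r addr0.
Qed.

(* By [is_derive_circ] the derivative of the circulation F in the dilation parameter t is -2 t^2 times the flux; the mean
   value theorem is applied to F(s) t^3 - F(t) s^3. *)
Lemma circ_flux l (t : R) : pend l (0, 0, 0) = (0, 0, 0) -> 0 < t ->
  exists2 s, 0 < s < t & circ l (0, 0, 0) t = - (2 / 3) * t ^+ 3 * flux (magnetic_field A) l (0, 0, 0) s.
Proof.
move=> cl t0; pose F := circ l (0, 0, 0).
have dF (s : R) : is_derive s 1 F (- 2 * s ^+ 2 * flux (magnetic_field A) l (0, 0, 0) s).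
  by have D := is_derive_circ l (0, 0, 0) s; apply: is_derive_eq; rewrite cl; ring.
pose k s := F s * t ^+ 3 - F t * s ^+ 3.
have dk (s : R) : is_derive s 1 k (- 2 * s ^+ 2 * flux (magnetic_field A) l (0, 0, 0) s * t ^+ 3 - F t * (3 * s ^+ 2)).
  have D := dF s; rewrite /k; apply: is_derive_eq; rewrite /GRing.scale /=.
  by move: (flux _ _ _ _) (F s) (F t) => *; ring.
have ck : {within `[0, t], continuous k}.
  by apply: derivable_within_continuous => s _; case: (dk s).
have [s sI] := MVT t0 (fun s _ => dk s) ck.
have -> : k 0 = 0 by rewrite /k /F circ0; ring.
have -> : k t = 0 by rewrite /k; ring.
rewrite !subr0 => /esym/eqP; rewrite mulf_eq0 (gt_eqF t0) orbF => /eqP E.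
move: sI; rewrite in_itv /= => /andP[s0 st]; exists s; first by rewrite s0.
rewrite -/(F t); move: E; set f := flux _ _ _ _ => E.
have s2 : s ^+ 2 != 0 by rewrite expf_neq0// gt_eqF.
apply: (mulfI s2); lra.
Qed.

End Flux.
End Dilation.

(** * A loop with nontrivial holonomy near a point where the field does not vanish *)

Section FieldLoop.
Variable R : realType.
Local Notation H := (heis R).
Implicit Types (f : H -> R) (p v : H) (A : potential R) (B : H -> R * R) (l : seq (R * R)).

Fixpoint path_in (N : R) l v : Prop := if l is w :: l' then
  (forall s : R, 0 <= s <= 1 -> box N (hmul v (hor w.1 w.2 s))) /\ path_in N l' (step v w) else True.

Lemma path_in_le N N' l v : N <= N' -> path_in N l v -> path_in N' l v.
Proof.
move=> NN; elim: l v => [//|w l IH] v /= [h1 /IH h2]; split => // s /h1; exact: box_le.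
Qed.

Lemma path_in_ex l v : exists2 N, 0 <= N & path_in N l v.
Proof.
elim: l v => [|w l IH] v /=; first by exists 0.
have [N1 N10 h1] := IH (step v w).
have [h hh] := hor_box w.
have [N2 h2] := hmul_box (`|cx v| + `|cy v| + `|cz v|) h.
exists (Num.max N1 N2); first by rewrite le_max N10.
split; last by apply: path_in_le h1; rewrite le_max lexx.
move=> s s01; apply: (@box_le R N2); first by rewrite le_max lexx orbT.
apply: h2; last by apply: hh; rewrite in_itv.
by split; [rewrite -addrA lerDl addr_ge0|rewrite addrAC lerDr addr_ge0|rewrite lerDr addr_ge0].
Qed.

Definition weight l : R := \sum_(w <- l) (`|w.1| + `|w.2|).

Lemma weight_ge0 l : 0 <= weight l.
Proof. by apply: sumr_ge0 => w _; rewrite addr_ge0. Qed.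

Lemma flux_close B (b : R * R) p l v (t N d : R) : continuous (fun q => (B q).1) ->
  continuous (fun q => (B q).2) -> 0 <= N -> path_in N l v ->
  (forall u, box N u -> `|(B (dil p t u)).1 - b.1| <= d /\ `|(B (dil p t u)).2 - b.2| <= d) ->
  `|flux p B l v t - flux p (fun _ => b) l v t| <= weight l * N * d.
Proof.
move=> c1 c2 N0 + hB; elim: l v => [|w l IH] v; first by rewrite /weight big_nil /= subrr normr0 !mul0r.
move=> [h1 /IH h2] /=; rewrite /weight big_cons -/(weight l).
have -> : RI (flux1 p B w v t) + flux p B l (step v w) t - (RI (flux1 p (fun _ => b) w v t) + flux p (fun _ => b) l (step v w) t)
  = (RI (flux1 p B w v t) - RI (flux1 p (fun _ => b) w v t)) + (flux p B l (step v w) t - flux p (fun _ => b) l (step v w) t).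
  by ring.
apply: le_trans (ler_normD _ _) _; rewrite !mulrDl; apply: lerD; last by [].
rewrite -!mulrDl; apply: RI_close.
- exact: flux1_continuous.
- by apply: flux1_continuous; exact: ct_cst.
move=> s /h1 hs; have [b1 b2] := hB _ hs; rewrite /flux1.
move: (hmul v _) hs b1 b2 => u [_ _ hz] b1 b2; set q := dil p t u in b1 b2 *.
rewrite -mulrBr normrM [X in _ <= X * _]mulrC -mulrA; apply: ler_pM => //.
have -> : w.1 * (B q).1 + w.2 * (B q).2 - (w.1 * b.1 + w.2 * b.2) = w.1 * ((B q).1 - b.1) + w.2 * ((B q).2 - b.2) by ring.
by apply: le_trans (ler_normD _ _) _; rewrite mulrDl !normrM; apply: lerD; rewrite ler_wpM2l.
Qed.

Lemma RI_flux_cst (b w : R * R) p v t : RI (flux1 p (fun _ => b) w v t) =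
  (cz v + (cx v * w.2 - cy v * w.1) / 4) * (w.1 * b.1 + w.2 * b.2).
Proof.
have -> : flux1 p (fun _ => b) w v t = (fun s => cz v * (w.1 * b.1 + w.2 * b.2)
   + (cx v * w.2 - cy v * w.1) / 2 * (w.1 * b.1 + w.2 * b.2) * s).
  by apply/funext => s; rewrite /flux1 /hmul /hor /cx /cy /cz /=; field.
by rewrite RI_linear; field.
Qed.

(* Horizontal loops are those whose projection to the plane encloses no net area: two bow ties. *)
Lemma bow_tie (b : R * R) : b <> 0 -> exists l, exists2 c, c != 0 &
  (forall p t, flux p (fun _ => b) l (0, 0, 0) t = c) /\
  (forall (t : R) p, pend [seq (t * w.1, t * w.2) | w <- l] p = p) /\ pend l (0, 0, 0) = (0, 0, 0).
Proof.
move=> b0; have [b10|b10] := eqVneq b.1 0.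
  have b20 : b.2 != 0 by apply/eqP => b20; apply: b0; case: b b10 b20 => ? ? /= -> ->.
  exists [:: (1, 1); (-1, 0); (1, -1); (-1, 0)], (- b.2 / 4).
    by rewrite mulf_neq0// ?oppr_eq0// invr_eq0 pnatr_eq0.
  split; [|split].
  - by move=> p t; rewrite /= !RI_flux_cst /step /hmul /hor /cx /cy /cz /= b10; field.
  - by move=> t -[[x y] z]; rewrite /= /step /hmul /hor /cx /cy /cz /=; congr (_, _, _); field.
  - by rewrite /= /step /hmul /hor /cx /cy /cz /=; congr (_, _, _); field.
exists [:: (1, 1); (0, -1); (-1, 1); (0, -1)], (b.1 / 4).
  by rewrite mulf_neq0// invr_eq0 pnatr_eq0.
split; [|split].
- by move=> p t; rewrite /= !RI_flux_cst /step /hmul /hor /cx /cy /cz /=; field.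
- by move=> t -[[x y] z]; rewrite /= /step /hmul /hor /cx /cy /cz /=; congr (_, _, _); field.
- by rewrite /= /step /hmul /hor /cx /cy /cz /=; congr (_, _, _); field.
Qed.

Lemma cos_le_gap (x th : R) : 0 <= x -> x <= `|th| -> `|th| <= 1 -> cos th <= cos x.
Proof.
move=> x0 xth th1; have -> : cos th = cos `|th|.
  by case: (ger0P th) => // _; rewrite cosN.
have pi1 : 1 <= pi :> R by have := @pi_ge2 R; lra.
by rewrite leNgt ltr_cos ?in_itv /= -?leNgt//; lra.
Qed.

Lemma cos_lt1_gap (x : R) : 0 < x -> x <= 1 -> cos x < 1.
Proof.
move=> x0 x1; rewrite -(@cos0 R); have pi1 : 1 <= pi :> R by have := @pi_ge2 R; lra.
by rewrite ltr_cos// in_itv /=; lra.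
Qed.

Lemma heis_ball (p q : H) (d : R) : ball (cx p) d (cx q) -> ball (cy p) d (cy q) -> ball (cz p) d (cz q) ->
  ball p d q.
Proof. by move=> h1 h2 h3; split; [split|]. Qed.

(** M bounds the x and y coordinates of [p], which enter through the twist (x t u_2 - y t u_1) / 2
    of the group law. *)
Lemma dil_ball p p0 u (r N M t d : R) : ball p0 r p -> r <= 1 -> 0 <= N ->
  `|cx p0| + `|cy p0| + 1 <= M -> 0 <= t -> t <= 1 -> box N u -> r + t * N * (1 + M) <= d ->
  ball p0 d (dil p t u).
Proof.
case: p p0 u => -[x y] z [[x0 y0] z0] [[u1 u2] u3] [[/= bx by_] bz] r1 N0.
rewrite /box /cx /cy /cz /= => hM t0 t1 [h1 h2 h3] hd.
rewrite -!ball_normE /ball_ /= in bx by_ bz.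
have M0 : 0 <= M by apply: le_trans hM; rewrite !addr_ge0.
have tN : 0 <= t * N by rewrite mulr_ge0.
have tNM : 0 <= t * N * M by rewrite mulr_ge0.
have e1 : `|t * u1| <= t * N by rewrite normrM ger0_norm// ler_wpM2l.
have e2 : `|t * u2| <= t * N by rewrite normrM ger0_norm// ler_wpM2l.
have e3 : `|t ^+ 2 * u3| <= t * N.
  rewrite expr2 -mulrA normrM ger0_norm//; apply: ler_wpM2l => //.
  by rewrite normrM ger0_norm//; apply: le_trans h3; rewrite ler_piMl.
have hx : `|x| <= M.
  have := ler_normB x0 (x0 - x); rewrite opprB addrC subrK => /le_trans; apply.
  by apply: le_trans hM; have := normr_ge0 y0; lra.
have hy : `|y| <= M.
  have := ler_normB y0 (y0 - y); rewrite opprB addrC subrK => /le_trans; apply.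
  by apply: le_trans hM; have := normr_ge0 x0; lra.
have f1 : `|x * (t * u2)| <= t * N * M by rewrite normrM mulrC ler_pM.
have f2 : `|y * (t * u1)| <= t * N * M by rewrite normrM mulrC ler_pM.
have f3 : `|(x * (t * u2) - y * (t * u1)) / 2| <= t * N * M.
  rewrite normrM [`|2^-1|]ger0_norm//; have := ler_normB (x * (t * u2)) (y * (t * u1)); lra.
move: hd; rewrite mulrDr mulr1 => hd.
apply: heis_ball; rewrite -ball_normE /ball_ /dil /hmul /cx /cy /cz /=.
- have -> : x0 - (x + t * u1) = (x0 - x) - t * u1 by ring.
  have := ler_normB (x0 - x) (t * u1); lra.
- have -> : y0 - (y + t * u2) = (y0 - y) - t * u2 by ring.
  have := ler_normB (y0 - y) (t * u2); lra.
- have -> : z0 - (z + t ^+ 2 * u3 + (x * (t * u2) - y * (t * u1)) / 2) = (z0 - z) - (t ^+ 2 * u3 + (x * (t * u2) - y * (t * u1)) / 2) by ring.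
  have := ler_normB (z0 - z) (t ^+ 2 * u3 + (x * (t * u2) - y * (t * u1)) / 2).
  have := ler_normD (t ^+ 2 * u3) ((x * (t * u2) - y * (t * u1)) / 2); lra.
Qed.

Lemma ball_box p0 (r : R) : exists M, ball p0 r `<=` box M.
Proof.
exists (`|cx p0| + `|cy p0| + `|cz p0| + r).
case: p0 => -[x0 y0] z0 [[x y] z] [[/= bx by_] bz].
move: bx by_ bz; rewrite -!ball_normE /ball_ /box /cx /cy /cz /= => bx by_ bz.
have n1 := normr_ge0 x0; have n2 := normr_ge0 y0; have n3 := normr_ge0 z0.
have m1 := ler_normB x0 (x0 - x); have m2 := ler_normB y0 (y0 - y); have m3 := ler_normB z0 (z0 - z).
by move: m1 m2 m3; rewrite !opprB ![_ + (_ - _)]addrC !subrK => *; split; lra.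
Qed.

Lemma field_loop B p0 : continuous (fun q => (B q).1) -> continuous (fun q => (B q).2) -> B p0 <> 0 ->
  exists (G : set H) l k M, [/\ open G, G p0, G `<=` box M, 0 < k & forall p, pend l p = p] /\
    forall A, smooth_potential setT A -> magnetic_field A = B -> loop_prop A G l k.
Proof.
move=> c1 c2 B0; have [l [c c0 [fl [cl cl0]]]] := bow_tie B0.
have [N N0 hN] := path_in_ex l (0, 0, 0).
have nc : 0 < `|c| by rewrite normr_gt0.
pose C := weight l * N; have C0 : 0 <= C by rewrite mulr_ge0// weight_ge0.
(* If B varies by at most d on the loop, then [flux_close] gives an error C d <= |c| / 2. *)
pose d := `|c| / 2 / (C + 1); have d0 : 0 < d by rewrite !divr_gt0//; lra.
have [e1 e10 h1] : exists2 e, 0 < e & forall q, ball p0 e q -> `|(B p0).1 - (B q).1| <= d.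
  have /cvgrPdist_le /(_ d d0) := c1 p0.
  by move=> /nbhs_ballP[e /= ep he]; exists e.
have [e2 e20 h2] : exists2 e, 0 < e & forall q, ball p0 e q -> `|(B p0).2 - (B q).2| <= d.
  have /cvgrPdist_le /(_ d d0) := c2 p0.
  by move=> /nbhs_ballP[e /= ep he]; exists e.
pose e := Num.min e1 e2; have e0 : 0 < e by rewrite lt_min e10.
pose r := Num.min (e / 2) 1; have r0 : 0 < r by rewrite lt_min ltr01 divr_gt0.
pose M := `|cx p0| + `|cy p0| + 1; have M0 : 0 <= M by rewrite !addr_ge0.
pose K := (N + 1) * (1 + M); have K0 : 0 < K by rewrite mulr_gt0//; lra.
(* The second bound keeps the loops started in the ball of radius r <= e / 2 inside the e-ball
   around p0; the third keeps the holonomy in [-1, 1], where cos is decreasing in the modulus. *)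
pose t := Num.min 1 (Num.min (e / 2 / K) (1 + `|c|)^-1).
have t0 : 0 < t by rewrite !lt_min ltr01 !divr_gt0//= invr_gt0; lra.
have t1 : t <= 1 by rewrite /t ge_min lexx.
have tK : t * K <= e / 2 by rewrite -ler_pdivlMr// /t !ge_min lexx !orbT.
have tc : t * `|c| <= 1.
  have : t <= (1 + `|c|)^-1 by rewrite /t !ge_min lexx !orbT.
  by rewrite -[X in _ <= X]div1r ler_pdivlMr//; lra.
have t3 : 0 < t ^+ 3 by rewrite exprn_gt0.
have t3c : t ^+ 3 * `|c| <= 1.
  by rewrite exprSr -mulrA; apply: mulr_ile1 => //; rewrite ?mulr_ge0 ?exprn_ge0 ?exprn_ile1// ltW.
have x0 : 0 < t ^+ 3 * `|c| / 3 by rewrite divr_gt0 ?mulr_gt0.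
have [M' hM'] := ball_box p0 r.
exists (ball p0 r), [seq (t * w.1, t * w.2) | w <- l], (2 - 2 * cos (t ^+ 3 * `|c| / 3)), M'.
split; first split => //.
- exact: ball_open.
- exact: ballxx.
- have := cos_lt1_gap x0; lra.
move=> A sA BA p Gp; exists (circ A p l (0, 0, 0) t); split.
  by have := phase_dil sA p l (0, 0, 0) t; rewrite dil0.
have [s /andP[s0 st] ->] := circ_flux sA p cl0 t0; rewrite BA.
have hf : `|flux p B l (0, 0, 0) s - c| <= `|c| / 2.
  rewrite -{1}(fl p s); apply: le_trans (flux_close (d := d) c1 c2 N0 hN _) _.
    move=> u hu; have bu : ball p0 e (dil p s u).
      apply: (dil_ball (N := N) (M := M) Gp) => //; rewrite ?(ltW s0)//.
      - by rewrite /r ge_min lexx orbT.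
      - by apply: le_trans t1; exact: ltW.
      - have re : r <= e / 2 by rewrite /r ge_min lexx.
        have : s * N * (1 + M) <= t * K.
          rewrite /K mulrA; apply: ler_wpM2r; first lra.
          by apply: ler_pM => //; [exact: ltW|exact: ltW|rewrite lerDl].
        lra.
    split; rewrite distrC; [apply: h1|apply: h2]; apply: le_ball bu; rewrite /e ge_min lexx ?orbT//.
  have dC : d * (C + 1) = `|c| / 2 by rewrite /d divfK// gt_eqF//; lra.
  by rewrite -/C -dC mulrC ler_wpM2l ?lerDl// ltW.
have hc : cos (- (2 / 3) * t ^+ 3 * flux p B l (0, 0, 0) s) <= cos (t ^+ 3 * `|c| / 3).
  have -> : - (2 / 3) * t ^+ 3 * flux p B l (0, 0, 0) s = - (t ^+ 3 * (2 / 3 * flux p B l (0, 0, 0) s)) by ring.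
  move: (flux _ _ _ _ _) hf => f hf.
  have nf1 : `|c| / 2 <= `|f|.
    have := ler_normB f (f - c); rewrite opprB addrC subrK; lra.
  have nf2 : `|f| <= 3 / 2 * `|c|.
    have := ler_normD (f - c) c; rewrite subrK; lra.
  have nE : `|- (t ^+ 3 * (2 / 3 * f))| = t ^+ 3 * (2 / 3 * `|f|).
    by rewrite normrN normrM (gtr0_norm t3) normrM [`|2 / 3|]gtr0_norm// divr_gt0.
  apply: cos_le_gap; rewrite ?nE ?(ltW x0)//.
    by rewrite -mulrA; apply: ler_wpM2l; [exact: ltW|lra].
  by apply: le_trans t3c; apply: ler_wpM2l; [exact: ltW|lra].
lra.
Qed.

End FieldLoop.

(** * Holonomy of an Aharonov-Bohm potential *)

Section Trigo.
Variable R : realType.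
Implicit Types (x a b : R).

Lemma atan_gt0 x : 0 < x -> 0 < atan x.
Proof.
move=> x0; rewrite ltNge; apply/negP => t0.
have c0 : 0 < cos (atan x) by apply: cos_gt0_pihalf; rewrite atan_gtNpi2 atan_ltpi2.
have : 0 < sin (atan x) by have := x0; rewrite -{1}(atanK x) /tan pmulr_lgt0 ?invr_gt0.
move: t0; rewrite le_eqVlt => /orP[/eqP ->|t0]; first by rewrite sin0 ltxx.
have : 0 < sin (- atan x) by apply: sin_gt0_pihalf; have := atan_gtNpi2 x; lra.
by rewrite sinN; lra.
Qed.

Lemma atan_inv x : 0 < x -> atan x + atan x^-1 = pi / 2.
Proof.
move=> x0; have t0 := atan_gt0 x0; have t1 := atan_ltpi2 x.
suff -> : x^-1 = tan (pi / 2 - atan x) by rewrite tanK ?in_itv /=; lra.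
rewrite -{1}(atanK x) /tan invf_div sinB cosB sin_pihalf cos_pihalf.
by rewrite !mul1r !mul0r subr0 add0r.
Qed.

(** At a corner of a rectangle the primitive of d phi changes from -atan(x / y) to atan(y / x); this
    lemma and the next evaluate the jump. *)
Lemma atan_pair_pos a b : 0 < a * b -> atan (a / b) + atan (b / a) = pi / 2.
Proof.
move=> ab; have b0 : b != 0 by apply/eqP => b0; move: ab; rewrite b0 mulr0 ltxx.
have -> : b / a = (a / b)^-1 by rewrite invf_div.
apply: atan_inv; have -> : a / b = a * b / b ^+ 2 by field.
by rewrite divr_gt0// exprn_even_gt0.
Qed.

Lemma atan_pair_neg a b : a * b < 0 -> atan (a / b) + atan (b / a) = - (pi / 2).
Proof.
move=> ab; have : 0 < (- a) * b by rewrite mulNr oppr_gt0.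
by move=> /atan_pair_pos; rewrite mulNr invrN mulrN !atanN => <-; ring.
Qed.

Lemma cosD2piz x (n : int) : cos (x + pi *+ 2 * n%:~R) = cos x.
Proof.
have K (m : nat) (y : R) : cos (y + pi *+ 2 * m%:R) = cos y.
  elim: m y => [|m IH] y; first by rewrite mulr0 addr0.
  by rewrite -natr1 mulrDr mulr1 addrA cosD2pi.
case: n => m; first exact: K.
by rewrite NegzE mulrNz mulrN -(K m.+1 (x - _)) subrK.
Qed.

(** With b the fractional part, in (0, 1), the cosine is 1 - 2 sin(pi b)^2. *)
Lemma cos_2pi_lt1 x : x \isn't a Num.int -> cos (pi *+ 2 * x) < 1.
Proof.
move=> xi; pose b := x - (Num.floor x)%:~R.
have b0 : 0 < b.
  rewrite subr_gt0 lt_neqAle floor_le andbT; apply: contra xi => /eqP <-; exact: intr_int.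
have b1 : b < 1 by have := floorD1_gt x; rewrite /b intrD; lra.
have -> : pi *+ 2 * x = pi * b *+ 2 + pi *+ 2 * (Num.floor x)%:~R.
  by rewrite -mulrnAl -mulrDr subrK.
rewrite cosD2piz cos_mulr2n cos2sin2.
have s0 : 0 < sin (pi * b) by apply: sin_gt0_pi; rewrite mulr_gt0 ?pi_gt0//= gtr_pMr ?pi_gt0.
have : 0 < sin (pi * b) ^+ 2 by rewrite exprn_gt0.
lra.
Qed.

End Trigo.

Section AharonovBohm.
Variable R : realType.
Local Notation H := (heis R).
Local Notation U := (~` @zaxis R).

Lemma open_off_axis : open U.
Proof.
have c : continuous (fun p : H => cx p ^+ 2 + cy p ^+ 2).
  by have := @cx_continuous R; have := @cy_continuous R => ? ?; cont.
have -> : U = (fun p : H => cx p ^+ 2 + cy p ^+ 2) @^-1` [set t | t != 0].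
  apply/seteqP; split => p /=; rewrite /zaxis /=.
    move=> n; apply/negP => /eqP e; apply: n; move/eqP: e; rewrite paddr_eq0 ?sqr_ge0// !sqrf_eq0.
    by move=> /andP[/eqP -> /eqP ->].
  by move=> /negP n [h1 h2]; apply: n; rewrite h1 h2 expr0n addr0.
apply: open_comp; last exact: open_neq.
by move=> p _; exact: c.
Qed.

Lemma is_derive_line_at (f : H -> R) p (a b s : R) : C1_at f (hmul p (hor a b s)) ->
  is_derive s 1 (fun s => f (hmul p (hor a b s)))
   (a * vfX f (hmul p (hor a b s)) + b * vfY f (hmul p (hor a b s))).
Proof. by move=> h; apply: is_derive_line; exact: C1_at_hder. Qed.

Section Potential.
Variables (A : potential R) (alpha : R) (f : H -> R).
Hypothesis sf : smooth_on U f.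
Hypothesis AE : forall p, U p -> A p = alpha *: dphi p + dH f p.

Lemma potxE p : U p -> potx A p = - alpha * cy p / (cx p ^+ 2 + cy p ^+ 2) + vfX f p.
Proof.
move=> Up; rewrite /potx AE// /= /dphi /rr sqr_sqrtr ?addr_ge0 ?sqr_ge0//= /GRing.scale /=.
by rewrite mulNr mulrN mulrA mulNr mulNr.
Qed.

Lemma potyE p : U p -> poty A p = alpha * cx p / (cx p ^+ 2 + cy p ^+ 2) + vfY f p.
Proof.
move=> Up; rewrite /poty AE// /= /dphi /rr sqr_sqrtr ?addr_ge0 ?sqr_ge0//= /GRing.scale /=.
by rewrite mulrA.
Qed.

Lemma is_derive_atan_line (u a v s : R) : v != 0 ->
  is_derive s 1 (fun s => atan ((u + s * a) / v)) (a * v / ((u + s * a) ^+ 2 + v ^+ 2)).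
Proof.
move=> v0; have d1 : is_derive s 1 (fun s : R => (u + s * a) / v) (a / v).
  by apply: is_derive_eq; rewrite /GRing.scale/=; ring.
have := @is_derive1_comp R atan (fun s : R => (u + s * a) / v) s _ _ (is_derive1_atan _) d1.
move=> D; apply: is_derive_eq; move: (u + s * a) => w.
have n1 : w ^+ 2 + v ^+ 2 != 0 by rewrite gt_eqF// ltr_wpDl ?sqr_ge0// exprn_even_gt0.
by field; rewrite v0 /= ?n1 // addrC n1.
Qed.

Lemma phase_X (a : R) l p th : cy p != 0 -> phase A l (step p (a, 0)) th ->
  phase A ((a, 0) :: l) p (f (step p (a, 0)) - f p
    - alpha * (atan ((cx p + a) / cy p) - atan (cx p / cy p)) + th).
Proof.
move=> y0 hl.
have hU s : U (hmul p (hor a 0 s)).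
  by rewrite /zaxis /hmul /hor /cx /cy /= => -[_ /eqP]; rewrite mulr0 addr0 (negbTE y0).
exists (fun s => f (hmul p (hor a 0 s)) - alpha * atan ((cx p + s * a) / cy p)), th; split => //.
- move=> s; rewrite /= potxE// mul0r addr0.
  have d1 := is_derive_line_at (smooth_C1_at open_off_axis sf (hU s)).
  have d2 := is_derive_atan_line (cx p) a s y0.
  apply: is_derive_eq; rewrite /GRing.scale /= mul0r addr0.
  have -> : cy (hmul p (hor a 0 s)) = cy p by rewrite /hmul /hor /cy /=; ring.
  have -> : cx (hmul p (hor a 0 s)) = cx p + s * a by rewrite /hmul /hor /cx /=.
  move: (vfX f _) (_^-1) => *; ring.
- rewrite hmul_hor0 mul1r mul0r addr0 /step /=; ring.
Qed.

Lemma phase_Y (b : R) l p th : cx p != 0 -> phase A l (step p (0, b)) th ->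
  phase A ((0, b) :: l) p (f (step p (0, b)) - f p
    + alpha * (atan ((cy p + b) / cx p) - atan (cy p / cx p)) + th).
Proof.
move=> x0 hl.
have hU s : U (hmul p (hor 0 b s)).
  by rewrite /zaxis /hmul /hor /cx /cy /= => -[/eqP]; rewrite mulr0 addr0 (negbTE x0).
exists (fun s => f (hmul p (hor 0 b s)) + alpha * atan ((cy p + s * b) / cx p)), th; split => //.
- move=> s; rewrite /= potyE// mul0r add0r.
  have d1 := is_derive_line_at (smooth_C1_at open_off_axis sf (hU s)).
  have d2 := is_derive_atan_line (cy p) b s x0.
  apply: is_derive_eq; rewrite /GRing.scale /= mul0r add0r.
  have -> : cx (hmul p (hor 0 b s)) = cx p by rewrite /hmul /hor /cx /=; ring.
  have -> : cy (hmul p (hor 0 b s)) = cy p + s * b by rewrite /hmul /hor /cy /=.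
  rewrite [_ + cx p ^+ 2]addrC; move: (vfY f _) (_^-1) => *; ring.
- rewrite hmul_hor0 mul1r mul0r addr0 /step /=; ring.
Qed.

(* The clockwise square that does not enclose the axis cancels the area of the first one, which does. *)
Definition ab_loop_path : seq (R * R) :=
  [:: (2, 0); (0, 2); (-2, 0); (0, -2); (-2, 0); (0, 2); (2, 0); (0, -2)].

Lemma step_X (x y z a : R) : step (x, y, z) (a, 0) = (x + a, y, z - y * a / 2).
Proof. by rewrite /step /hmul /hor /cx /cy /cz /=; congr (_, _, _); field. Qed.

Lemma step_Y (x y z b : R) : step (x, y, z) (0, b) = (x, y + b, z + x * b / 2).
Proof. by rewrite /step /hmul /hor /cx /cy /cz /=; congr (_, _, _); field. Qed.

Lemma square_loop (p : H) (a b : R) : pend [:: (a, 0); (0, b); (- a, 0); (0, - b)] p = (cx p, cy p, cz p + a * b).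
Proof.
case: p => -[x y] z; rewrite /pend /= (step_X x y) (step_Y (x + a)) (step_X (x + a)) (step_Y (x + a - a)) /cx /cy /cz /=.
by congr (_, _, _); field.
Qed.

Lemma ab_loop_closed p : pend ab_loop_path p = p.
Proof.
have -> : ab_loop_path = [:: (2, 0); (0, 2); (- 2, 0); (0, - 2)] ++ [:: (-2, 0); (0, 2); (- - 2, 0); (0, - 2)].
  by rewrite opprK.
rewrite /pend foldl_cat; have := square_loop p 2 2; rewrite /pend => ->.
have := square_loop (cx p, cy p, cz p + 2 * 2) (-2) 2; rewrite /pend => ->.
by case: p => -[x y] z; rewrite /cx /cy /cz /=; congr (_, _, _); ring.
Qed.

(** For x and y in (-3/2, -1/2) the first square surrounds the axis, the second lies beside it in x
    < 0, and the coordinate held fixed on each of the eight sides is nonzero. *)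
Lemma ab_loop_phase p : `|cx p + 1| < 2^-1 -> `|cy p + 1| < 2^-1 ->
  phase A ab_loop_path p (pi *+ 2 * alpha).
Proof.
pose x := cx p; pose y := cy p; rewrite -/x -/y !ltr_norml => /andP[x1 x2] /andP[y1 y2].
pose q0 : H := p; pose q1 := step q0 (2, 0); pose q2 := step q1 (0, 2); pose q3 := step q2 (-2, 0).
pose q4 := step q3 (0, -2); pose q5 := step q4 (-2, 0); pose q6 := step q5 (0, 2); pose q7 := step q6 (2, 0).
have [X0 Y0] : cx q0 = x /\ cy q0 = y by [].
have [X1 Y1] : cx q1 = x + 2 /\ cy q1 = y by rewrite /q1 /step /hmul /hor /cx /cy /=; split; ring.
have [X2 Y2] : cx q2 = x + 2 /\ cy q2 = y + 2.
  by move: X1 Y1; rewrite /q2 /step /hmul /hor /cx /cy /= => -> ->; split; ring.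
have [X3 Y3] : cx q3 = x /\ cy q3 = y + 2.
  by move: X2 Y2; rewrite /q3 /step /hmul /hor /cx /cy /= => -> ->; split; ring.
have [X4 Y4] : cx q4 = x /\ cy q4 = y.
  by move: X3 Y3; rewrite /q4 /step /hmul /hor /cx /cy /= => -> ->; split; ring.
have [X5 Y5] : cx q5 = x - 2 /\ cy q5 = y.
  by move: X4 Y4; rewrite /q5 /step /hmul /hor /cx /cy /= => -> ->; split; ring.
have [X6 Y6] : cx q6 = x - 2 /\ cy q6 = y + 2.
  by move: X5 Y5; rewrite /q6 /step /hmul /hor /cx /cy /= => -> ->; split; ring.
have [X7 Y7] : cx q7 = x /\ cy q7 = y + 2.
  by move: X6 Y6; rewrite /q7 /step /hmul /hor /cx /cy /= => -> ->; split; ring.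
have P8 : phase A [::] (step q7 (0, -2)) 0 by [].
have n7 : cx q7 != 0 by rewrite X7 lt_eqF//; lra.
have n6 : cy q6 != 0 by rewrite Y6 gt_eqF//; lra.
have n5 : cx q5 != 0 by rewrite X5 lt_eqF//; lra.
have n4 : cy q4 != 0 by rewrite Y4 lt_eqF//; lra.
have n3 : cx q3 != 0 by rewrite X3 lt_eqF//; lra.
have n2 : cy q2 != 0 by rewrite Y2 gt_eqF//; lra.
have n1 : cx q1 != 0 by rewrite X1 gt_eqF//; lra.
have n0 : cy q0 != 0 by rewrite Y0 lt_eqF//; lra.
have := phase_X n0 (phase_Y n1 (phase_X n2 (phase_Y n3 (phase_X n4 (phase_Y n5 (phase_X n6 (phase_Y n7 P8))))))).
rewrite -/q1 -/q2 -/q3 -/q4 -/q5 -/q6 -/q7 -/(ab_loop_path) X0 Y0 X1 Y1 X2 Y2 X3 Y3 X4 Y4 X5 Y5 X6 Y6 X7 Y7.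
(* The gauge terms telescope around the closed loop. The jumps at the corners remain: four times pi
   / 2 from the first square, while those of the second add up to zero. *)
have E8 : f (step q7 (0, -2)) = f q0 by rewrite -[in RHS](ab_loop_closed q0).
rewrite E8 !subrK !addrK.
have a1 : atan ((x + 2) / y) + atan (y / (x + 2)) = - (pi / 2) by apply: atan_pair_neg; nra.
have a2 : atan (x / y) + atan (y / x) = pi / 2 by apply: atan_pair_pos; nra.
have a3 : atan ((y + 2) / (x + 2)) + atan ((x + 2) / (y + 2)) = pi / 2 by apply: atan_pair_pos; nra.
have a4 : atan (x / (y + 2)) + atan ((y + 2) / x) = - (pi / 2) by apply: atan_pair_neg; nra.
have a5 : atan ((x - 2) / y) + atan (y / (x - 2)) = pi / 2 by apply: atan_pair_pos; nra.
have a6 : atan ((y + 2) / (x - 2)) + atan ((x - 2) / (y + 2)) = - (pi / 2) by apply: atan_pair_neg; nra.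
set T := (X in phase A _ q0 X -> _); suff -> : T = pi *+ 2 * alpha by [].
rewrite /T {T P8}.
have b1 : atan ((x + 2) / y) = - (pi / 2) - atan (y / (x + 2)) by rewrite -a1 addrK.
have b2 : atan (x / y) = pi / 2 - atan (y / x) by rewrite -a2 addrK.
have b3 : atan ((y + 2) / (x + 2)) = pi / 2 - atan ((x + 2) / (y + 2)) by rewrite -a3 addrK.
have b4 : atan (x / (y + 2)) = - (pi / 2) - atan ((y + 2) / x) by rewrite -a4 addrK.
have b5 : atan ((x - 2) / y) = pi / 2 - atan (y / (x - 2)) by rewrite -a5 addrK.
have b6 : atan ((y + 2) / (x - 2)) = - (pi / 2) - atan ((x - 2) / (y + 2)) by rewrite -a6 addrK.
rewrite b1 b2 b3 b4 b5 b6.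
move: (atan (y / (x + 2))) (atan (y / x)) (atan ((x + 2) / (y + 2))) (atan ((y + 2) / x))
  (atan (y / (x - 2))) (atan ((x - 2) / (y + 2))) (f q0) (f q1) (f q2) (f q3) (f q4) (f q5) (f q6) (f q7) pi.
by clear => u1 u2 u3 u4 u5 u6 f0 f1 f2 f3 f4 f5 f6 f7 P; field.
Qed.

End Potential.

Lemma ab_loop (A : potential R) : typeii A ->
  exists (G : set H) q0 l k M, [/\ open G, G q0, G `<=` box M, 0 < k & forall p, pend l p = p] /\
    loop_prop A G l k.
Proof.
move=> [_ [alpha [f [ai sf AE]]]]; pose q0 : H := (-1, -1, 0).
have [M hM] := ball_box q0 2^-1.
exists (ball q0 2^-1), q0, ab_loop_path, (2 - 2 * cos (pi *+ 2 * alpha)), M; split.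
  split; [exact: ball_open|by apply: ballxx; rewrite invr_gt0|by []| |exact: ab_loop_closed].
  by have := cos_2pi_lt1 ai; lra.
move=> p [[b1 b2] _]; exists (pi *+ 2 * alpha); split => //.
apply: (ab_loop_phase sf AE).
  by move: b1; rewrite -ball_normE /ball_ /= /cx -normrN opprD !opprK addrC.
by move: b2; rewrite -ball_normE /ball_ /= /cy -normrN opprD !opprK addrC.
Qed.

End AharonovBohm.

(** * Choice of the constants *)

Section Final.
Variable R : realType.
Local Notation H := (heis R).

Lemma bounded_box (Omega : set H) : bounded_set Omega -> exists2 K, 1 <= K & Omega `<=` box K.
Proof.
move=> [M [_ hM]]; exists (Num.max 1 (M + 1)); first by rewrite le_max lexx.
move=> p /(hM (Num.max 1 (M + 1))); rewrite lt_max ltrDl ltr01 orbT => /(_ isT).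
case: p => -[x y] z /=; rewrite /box /cx /cy /cz /= => h.
by move: h; rewrite prod_normE ge_max prod_normE ge_max /= => /andP[/andP[-> ->] ->].
Qed.

(** [c] precedes [U] and [A]: every potential with the holonomy bound k on this loop shares it. *)
Lemma hardy_loop (Omega G : set H) q0 l k M : open Omega -> bounded_set Omega ->
  open G -> G q0 -> G `<=` box M -> 0 < k -> (forall p, pend l p = p) ->
  exists2 c, 0 < c & forall U A, open U -> {in U, continuous (potx A)} -> {in U, continuous (poty A)} ->
    loop_prop A G l k -> hardy_ineq U Omega A c.
Proof.
move=> oO /bounded_box[K K1 OK] oG Gq GM k0 cl.
have [_ [C [N [C0 BN hC]]]] := magnetic_poincare oG Gq GM k0 cl K.
exists (hc C (Num.sqrt ((2 * N ^+ 2) ^+ 2 + 16 * N ^+ 2 + 1))).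
  by rewrite /hc divr_gt0 ?invr_gt0// ltr_wpDr// mulr_ge0 ?sqrtr_ge0// mulr_ge0.
move=> U A oU cX cY hl; exact: (hardy_from_loop oO OK oU cX cY hl C0 K1 hC).
Qed.

Lemma hardy_ineq_sub (U V Omega : set H) A (c : R) : U `<=` V -> hardy_ineq V Omega A c -> hardy_ineq U Omega A c.
Proof. by move=> UV h u [s1 s2 cu su]; apply: h; split => //; exact: subset_trans UV. Qed.

(** Any one potential [A0] with field B supplies the continuity of B and a point where B is nonzero;
    the loop is then built from B and serves all the others. If there is no such potential, the
    claim is vacuous. *)
Lemma hardy_field (Omega : set H) (B : H -> R * R) : open Omega -> bounded_set Omega ->
  exists c, 0 < c /\ forall A, typei Omega A -> magnetic_field A = B -> hardy_ineq setT Omega A c.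
Proof.
move=> oO bO; have [[A0 [[sA0 [p0 _ Bp0]] <-]]|n] := pselect (exists A, typei Omega A /\ magnetic_field A = B).
  have [c1 c2] := magnetic_field_continuous sA0.
  have [G [l [k [M [[oG Gp GM k0 cl] hl]]]]] := field_loop c1 c2 Bp0.
  have [c c0 hc] := hardy_loop oO bO oG Gp GM k0 cl; exists c; split => // A [sA _] AB.
  apply: hc; [exact: openT| | |exact: hl].
  - by move=> p _; have [c3 _ _] := smooth_gC1 sA.1; exact: c3.
  - by move=> p _; have [c3 _ _] := smooth_gC1 sA.2; exact: c3.
by exists 1; split => // A tA AB; exfalso; apply: n; exists A.
Qed.

Lemma hardy_flux (Omega : set H) A : open Omega -> bounded_set Omega ->
  exists c, 0 < c /\ (typeii A -> hardy_ineq (~` @zaxis R) Omega A c).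
Proof.
move=> oO bO; have [tA|n] := pselect (typeii A); last by exists 1; split.
have [G [q0 [l [k [M [[oG Gp GM k0 cl] hl]]]]]] := ab_loop tA.
have [c c0 hc] := hardy_loop oO bO oG Gp GM k0 cl; exists c; split => // _.
have [[[sX sY] _ _] _] := tA.
apply: hc hl; first exact: open_off_axis.
- by move=> p; rewrite inE => Up; have [] := sX [::] p Up.
- by move=> p; rewrite inE => Up; have [] := sY [::] p Up.
Qed.

End Final.

Theorem theorem2p4 (R : realType) (Omega : set (heis R))
    (Omega_open : open Omega) (Omega_bounded : bounded_set Omega)
    (Omega_lipschitz : lipschitz_boundary Omega) :
  exists c : potential R -> R,
    [/\ forall A : potential R, typei Omega A ->
          0 < c A /\ hardy_ineq setT Omega A (c A),
        forall A : potential R, typeii A ->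
          0 < c A /\ hardy_ineq (~` @zaxis R) Omega A (c A) &
        forall A A' : potential R, typei Omega A -> typei Omega A' ->
          magnetic_field A = magnetic_field A' -> c A = c A'].
Proof.
have [c1 h1] := choice (fun B => hardy_field B Omega_open Omega_bounded).
have [c2 h2] := choice (fun A => hardy_flux A Omega_open Omega_bounded).
(* The two types need not be shown exclusive: type (i) takes precedence, and for a potential of both
   types its inequality is restricted to test functions supported off the axis. *)
exists (fun A => if `[< typei Omega A >] then c1 (magnetic_field A) else c2 A); split.
- move=> A tA; rewrite asboolT//; have [c0 h] := h1 (magnetic_field A); split => //; exact: h.
- move=> A tA; case: asboolP => [t1|_].
    have [c0 h] := h1 (magnetic_field A); split => //.
    by apply: hardy_ineq_sub (h _ t1 erefl).
  by have [c0 h] := h2 A; split => //; exact: h.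
- by move=> A A' tA tA' e; rewrite !asboolT// e.
Qed.
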